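(* Let $T$ be a bounded linear operator on a complex separable Banach space $X$. (a) Assume that $T$ has a perfectly spanning set of unimodular eigenvectors, and that the periodic eigenvectors of $T$ are dense in the set of all unimodular eigenvectors of $T$. Then $\overline{\mathcal F}_T(HC(T))$ is a dense $G_\delta$ subset of $\overline{\mathcal F}_T(X)$. (b) Assume only that $T$ has a perfectly spanning set of unimodular eigenvectors. Then $\overline{\mathcal S}_T(HC(T))$ is a dense $G_\delta$ subset of $\overline{\mathcal S}_T(X)$.
   Context: $\mathcal P(X)$ is the space of Borel probability measures on $X$ with the Prokhorov (weak) topology generated by bounded continuous functions; for Borel $A\subset X$, $\mathcal P(A)=\{m\in\mathcal P(X): m(A)=1\}$. $HC(T)$ is the set of vectors with dense $T$-orbit. A unimodular eigenvector is an eigenvector with eigenvalue in $\mathbb T$; a periodic eigenvector is one whose eigenvalue is a root of unity. $T$ has a perfectly spanning set of unimodular eigenvectors if for every countable $D\subset\mathbb T$, $\overline{\mathrm{span}}[\ker(T-\lambda I):\lambda\in\mathbb T\setminus D]=X$. A periodic measure for $T$ is $\frac1N\sum_{n=0}^{N-1}\delta_{T^na}$ with $N\ge1$, $T^Na=a$; $\mathcal F_T(X)$ is the convex hull of all periodic measures, $\overline{\mathcal F}_T(X)$ its closure in $\mathcal P(X)$, and $\overline{\mathcal F}_T(A)=\overline{\mathcal F}_T(X)\cap\mathcal P(A)$. A Steinhaus measure for $T$ is the distribution of a random variable $\sum_{j\in J}\chi_jx_j$, $J$ finite, $x_j$ unimodular eigenvectors of $T$, $(\chi_j)$ independent random variables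 uniformly distributed on $\mathbb T$; $\mathcal S_T(X)$ is the set of these, $\overline{\mathcal S}_T(X)$ its closure in $\mathcal P(X)$, and $\overline{\mathcal S}_T(A)=\overline{\mathcal S}_T(X)\cap\mathcal P(A)$. *)

(* Defs.v *)
From HB Require Import structures.
From mathcomp Require Import all_boot all_order all_algebra.
From mathcomp Require Import complex.
From mathcomp Require Import all_classical all_reals all_analysis.

Set Implicit Arguments.
Unset Strict Implicit.
Unset Printing Implicit Defensive.

Import Order.TTheory GRing.Theory Num.Theory.
Import numFieldNormedType.Exports.
Local Open Scope classical_set_scope.
Local Open Scope ring_scope.

Definition borel (X : ptopologicalType) : measurableType _ :=
  g_sigma_algebraType (@open X).

Notation Prob X R := (probability (borel X) R).

Definition bcontinuous (X : ptopologicalType) (R : realType) (f : X -> R) :=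
  continuous f /\ exists M : R, forall x, `|f x| <= M.

(** Basic neighbourhoods of the weak (Prokhorov) topology on P(X), generated
    by the maps m |-> \int f dm, f bounded continuous:
    U is a neighbourhood of m iff it contains some
    {m' | |\int f_i dm' - \int f_i dm| < e for all i < n}. *)
Definition wnbhs (X : ptopologicalType) (R : realType) (m : Prob X R)
  (U : set (Prob X R)) : Prop :=
  exists (n : nat) (f : 'I_n -> X -> R) (e : R), 0 < e /\
    (forall i, bcontinuous (f i)) /\
    forall m' : Prob X R,
      (forall i, (`| \int[m']_x (f i x)%:E - \int[m]_x (f i x)%:E | < e%:E)%E) ->
      U m'.

Definition wopen (X : ptopologicalType) (R : realType) (U : set (Prob X R)) :=
  forall m, U m -> wnbhs m U.

Definition wclosure (X : ptopologicalType) (R : realType) (A : set (Prob X R)) :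
  set (Prob X R) :=
  [set m | forall U, wnbhs m U -> A `&` U !=set0].

Definition dense_Gdelta_in (X : ptopologicalType) (R : realType)
  (A B : set (Prob X R)) : Prop :=
  (exists U : nat -> set (Prob X R),
      (forall k, wopen (U k)) /\ A = B `&` \bigcap_k U k) /\
  B `<=` wclosure A.

Definition probs_on (X : ptopologicalType) (R : realType) (A : set X) :
  set (Prob X R) := [set m | m A = 1%E].

Section operator_notions.
Context (R : realType) (X : normedModType R[i]).

Definition separable_space := exists D : set X, countable D /\ closure D = setT.

Definition HC (T : X -> X) : set X :=
  [set x | dense (range (fun n : nat => iter n T x))].

Definition eigenspace (T : X -> X) (l : R[i]) : set X := [set x | T x = l *: x].

Definition unimodular_eigenvector (T : X -> X) (x : X) :=
  x != 0 /\ exists l : R[i], `|l| = 1 /\ T x = l *: x.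

Definition periodic_eigenvector (T : X -> X) (x : X) :=
  x != 0 /\ exists (l : R[i]) (N : nat), (0 < N)%N /\ l ^+ N = 1 /\ T x = l *: x.

Definition span (S : set X) : set X :=
  [set v | exists (n : nat) (a : 'I_n -> R[i]) (x : 'I_n -> X),
      (forall i, S (x i)) /\ v = \sum_(i < n) a i *: x i].

Definition unit_circle : set R[i] := [set l | `|l| = 1].

Definition perfectly_spanning (T : X -> X) :=
  forall D : set R[i], countable D ->
    closure (span (\bigcup_(l in unit_circle `\` D) eigenspace T l)) = setT.

Definition periodic_dense (T : X -> X) :=
  unimodular_eigenvector T `<=` closure (periodic_eigenvector T).

Definition periodic_measure (T : X -> X) (m : Prob X R) :=
  exists (N : nat) (a : X), (0 < N)%N /\ iter N T a = a /\
    forall A : set (borel X), measurable A ->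
      m A = ((N%:R)^-1%:E * \sum_(n < N) @dirac _ (borel X) (iter n T a) R A)%E.

Definition FT (T : X -> X) : set (Prob X R) :=
  [set m | exists (k : nat) (c : 'I_k -> R) (mu : 'I_k -> Prob X R),
     (forall i, 0 <= c i) /\ \sum_(i < k) c i = 1 /\
     (forall i, periodic_measure T (mu i)) /\
     forall A : set (borel X), measurable A ->
       m A = (\sum_(i < k) (c i)%:E * mu i A)%E].

Definition FTbar (T : X -> X) : set (Prob X R) := wclosure (FT T).

Definition FTbar_on (T : X -> X) (A : set X) : set (Prob X R) :=
  FTbar T `&` @probs_on _ R A.

Definition expi2pi (t : R) : R[i] := Complex (cos (2 * pi * t)) (sin (2 * pi * t)).

(** Steinhaus measures: distributions of sum_{j in J} chi_j x_j, J finite,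
    x_j unimodular eigenvectors, chi_j independent uniform on the circle;
    chi_j is written e^{2 i pi theta_j} with theta_j independent uniform on
    [0,1]. *)
Definition steinhaus_measure (T : X -> X) (m : Prob X R) :=
  exists (n : nat) (x : 'I_n -> X), (forall j, unimodular_eigenvector T (x j)) /\
  exists (d : measure_display) (Om : measurableType d) (P : probability Om R)
         (th : 'I_n -> Om -> R),
    (forall j, measurable_fun setT (th j)) /\
    (forall j (A : set R), measurable A ->
        P (th j @^-1` A) = lebesgue_measure (A `&` `[0, 1])) /\
    (forall A : 'I_n -> set R, (forall j, measurable (A j)) ->
        P (\bigcap_(j in [set: 'I_n]) (th j @^-1` A j))
        = (\prod_(j < n) P (th j @^-1` A j))%E) /\
    forall B : set (borel X), measurable B ->
      m B = P [set w | B (\sum_(j < n) expi2pi (th j w) *: x j)].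

Definition ST (T : X -> X) : set (Prob X R) := [set m | steinhaus_measure T m].

Definition STbar (T : X -> X) : set (Prob X R) := wclosure (ST T).

Definition STbar_on (T : X -> X) (A : set X) : set (Prob X R) :=
  STbar T `&` @probs_on _ R A.

End operator_notions.

(* Main.v *)
Require Import Defs.
From HB Require Import structures.
From mathcomp Require Import all_boot all_order all_algebra.
From mathcomp Require Import complex.
From mathcomp Require Import all_classical all_reals all_analysis.
From mathcomp Require Import measurable_realfun.
From mathcomp Require Import ring lra zify.
Set Implicit Arguments.
Unset Strict Implicit.
Unset Printing Implicit Defensive.
Import Order.TTheory GRing.Theory Num.Theory.
Import numFieldNormedType.Exports.
Local Open Scope classical_set_scope.
Local Open Scope ring_scope.

(** [HC T] is a countable intersection of open sets, which gives the G_delta part. For the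
    density, realise a given measure [m] of [FT T] (or [ST T]) as the law of a random vector [S]
    on a fixed probability space and perturb [S] countably many times, along summable errors.
    One perturbation takes [u], [v], [delta] and produces a random vector of the same kind,
    close to [S] in probability, such that every outcome that was within [delta] of [u] now has
    an iterate within [2 delta] of [v]. Running through countably many triples [(u, v, delta)],
    the limit is almost surely hypercyclic, and its law is a limit of measures in [FT T]
    (or [ST T]) that is close to [m].

    A perturbation must add to [S] a vector that is small with high probability but has an
    iterate close to a given vector at a time when [S] is back at its initial position. By
    perfect spanning any vector is almost a sum of vectors [g] near which there are eigenvectors
    for uncountably many eigenvalues. The average of [L] such eigenvectors is close to [g], while
    the same average with rotating phases has size O(L^-1/2) in mean square.
    For (a) the eigenvectors are periodic: a periodic vector [a] is replaced by [a + b] with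
    [b] periodic and close to [v - a], and an odometer on the unit interval couples the orbits
    of [a] and of [a + b].
    For (b) the phases are independent and uniform; all but countably many eigenvalues can be
    brought by Kronecker's argument to any phase along times at which finitely many given
    phases return. *)

(** Laws are compared through almost sure convergence on one space: weak convergence is then
    dominated convergence, and full mass on [HC T] is checked outcome by outcome. The obstacle is
    that a hit must survive infinitely many later perturbations, although the hitting time depends
    on the outcome. It is first truncated to a bounded horizon, at the cost of a small event, and
    the next error is chosen afterwards, in terms of that horizon and a bound for [T]. This is why a
    perturbation may be large on a small event but must hit at every outcome. The randomness must
    never run out. In (a) one uniform variable is read in ever finer cells. In (b) the binary digits
    of one uniform variable are split into infinitely many independent uniform variables, on a new
    factor of the probability space, so that the given phases are kept as they are. *)

Lemma exists_invS_lt (R : realType) (e : R) : 0 < e ->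
  exists p : nat, p.+1%:R^-1 < e.
Proof.
move=> e0; exists (Num.truncn e^-1); rewrite invf_plt ?posrE//.
exact: truncnS_gt.
Qed.

Lemma exists_pow2_lt (R : realType) (c e : R) : 0 < e ->
  exists K : nat, c / 2 ^+ K < e.
Proof.
move=> e0; pose K := (Num.truncn (c / e)).+1; exists K.
have : c / e < 2 ^+ K.
  apply: (@lt_le_trans _ _ K%:R); first exact: truncnS_gt.
  by rewrite -natrX ler_nat; exact/ltnW/ltn_expl.
by rewrite ltr_pdivrMr// mulrC -ltr_pdivrMr// exprn_gt0.
Qed.

(** * Real-valued modulus and norm *)

Section real_modulus.
Context (R : realType).

(* The norms of [R[i]] and of [X] take values in [R[i]]; [nc] and [nr] read them in [R]. *)
Definition nc (a : R[i]) : R := complex.Re `|a|.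

Lemma ncE a : `|a| = (nc a)%:C%C.
Proof. by rewrite /nc RRe_real// normr_real. Qed.

Lemma nc_ge0 a : 0 <= nc a.
Proof. by rewrite -lecR -ncE normr_ge0. Qed.

Lemma ncM a b : nc (a * b) = nc a * nc b.
Proof. by apply: complexI; rewrite -ncE normrM rmorphM /= -!ncE. Qed.

Lemma nc_real (r : R) : 0 <= r -> nc r%:C%C = r.
Proof. by move=> r0; apply: complexI; rewrite -ncE ger0_norm// ler0c. Qed.

Lemma nc1P a : `|a| = 1 <-> nc a = 1.
Proof. by rewrite ncE; split=> [[]|->]. Qed.

Lemma nc_sqr a : nc a ^+ 2 = complex.Re a ^+ 2 + complex.Im a ^+ 2.
Proof. by apply: complexI; rewrite rmorphXn /= -ncE -add_Re2_Im2. Qed.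

End real_modulus.

Section real_norm.
Context (R : realType) (X : normedModType R[i]).

Definition nr (x : X) : R := complex.Re `|x|.

Lemma nrE x : `|x| = (nr x)%:C%C.
Proof. by rewrite /nr RRe_real// normr_real. Qed.

Lemma nr_ge0 x : 0 <= nr x.
Proof. by rewrite -lecR -nrE normr_ge0. Qed.

Lemma nr0 : nr 0 = 0.
Proof. by apply: complexI; rewrite -nrE normr0. Qed.

Lemma nrN x : nr (- x) = nr x.
Proof. by rewrite /nr normrN. Qed.

Lemma nrD x y : nr (x + y) <= nr x + nr y.
Proof. by rewrite -lecR rmorphD /= -!nrE ler_normD. Qed.

Lemma nrBC x y : nr (x - y) = nr (y - x).
Proof. by rewrite -nrN opprB. Qed.

Lemma nr_trans y x z : nr (x - z) <= nr (x - y) + nr (y - z).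
Proof. by have := nrD (x - y) (y - z); rewrite addrA subrK. Qed.

Lemma nr_gt0 x : x != 0 -> 0 < nr x.
Proof. by move=> x0; rewrite -ltcR -nrE normr_gt0. Qed.

Lemma nrZ (a : R[i]) x : nr (a *: x) = nc a * nr x.
Proof. by apply: complexI; rewrite -nrE normrZ rmorphM /= -nrE -ncE. Qed.

Lemma nr_sum (I : Type) (s : seq I) (P : pred I) (f : I -> X) :
  nr (\sum_(i <- s | P i) f i) <= \sum_(i <- s | P i) nr (f i).
Proof.
elim/big_ind2: _ => [|x a y b xa yb|//]; first by rewrite nr0.
by rewrite (le_trans (nrD _ _))// lerD.
Qed.

Lemma nr_dist x y : `|nr x - nr y| <= nr (x - y).
Proof.
rewrite ler_norml; apply/andP; split.
  rewrite lerBrDr addrC lerBlDr nrBC (le_trans _ (nrD _ _))//.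
  by rewrite addrC subrK.
by rewrite lerBlDr (le_trans _ (nrD _ _))// subrK.
Qed.

Lemma nbhs_nrP x (A : set X) :
  nbhs x A <-> exists2 e : R, 0 < e & forall y, nr (y - x) < e -> A y.
Proof.
split.
  move=> /nbhs_ballP[e /= e0 eA]; exists (complex.Re e).
    by move: e0; rewrite ltcE => /andP[].
  move=> y yx; apply: eA; rewrite -ball_normE /= distrC nrE.
  by rewrite -[e]RRe_real ?ltcR// gtr0_real.
move=> [e e0 eA]; apply/nbhs_ballP; exists e%:C%C; rewrite /= ?ltcR//.
by move=> y; rewrite -ball_normE /= distrC nrE ltcR; exact: eA.
Qed.

Lemma open_nr_ball x (e : R) : open [set y | nr (y - x) < e].
Proof.
rewrite openE => y /= yx; apply/nbhs_nrP; exists (e - nr (y - x)).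
  by rewrite subr_gt0.
by move=> z; rewrite ltrBrDr; apply: le_lt_trans; exact: nr_trans.
Qed.

Lemma nr_continuous (z : X) : continuous (fun x => nr (x - z)).
Proof.
move=> x; apply/cvgrPdist_lt => e e0; apply/nbhs_nrP; exists e => // y.
rewrite distrC; apply: le_lt_trans; apply: le_trans (nr_dist _ _) _.
by rewrite opprB addrA subrK.
Qed.

Lemma cvg_nrP (s : nat -> X) l : s @ \oo --> l <->
  forall e : R, 0 < e -> exists n, forall m, (n <= m)%N -> nr (s m - l) < e.
Proof.
split.
  move=> sl e e0; have /sl[n _ h] : nbhs l [set y | nr (y - l) < e].
    by apply/nbhs_nrP; exists e.
  by exists n => m; exact: h.
move=> h A /nbhs_nrP[e /h[n nh] eA]; exists n => // m /= nm.
exact/eA/nh.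
Qed.

Lemma cvg_nr (s : nat -> X) l z : s @ \oo --> l ->
  nr (s k - z) @[k --> \oo] --> nr (l - z).
Proof.
move=> sl; apply/cvgrPdist_lt => e /((cvg_nrP s l).1 sl)[n h]; exists n => // m /h.
rewrite distrC; apply: le_lt_trans; apply: le_trans (nr_dist _ _) _.
by rewrite opprB addrA subrK.
Qed.

Lemma closure_nrP (A : set X) x :
  closure A x <-> forall e : R, 0 < e -> exists2 y, A y & nr (y - x) < e.
Proof.
split=> [cA e e0|h B /nbhs_nrP[e /h[y Ay yx] eB]].
  have [|y [Ay yx]] := cA [set y | nr (y - x) < e].
    by apply/nbhs_nrP; exists e.
  by exists y.
by exists y; split => //; exact: eB.
Qed.

End real_norm.

(** * Geometric convergence *)

Section complete.
Context (R : realType) (X : completeNormedModType R[i]).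

Lemma geometric_cvg (s : nat -> X) (eps : nat -> R) K :
  (forall k, 0 < eps k) -> (forall k, eps k.+1 <= eps k / 2) ->
  (forall k, (K <= k)%N -> nr (s k.+1 - s k) <= eps k) ->
  exists2 l, s @ \oo --> l & forall k, (K <= k)%N -> nr (l - s k) <= 2 * eps k.
Proof.
move=> e0 eh sK.
(* The difference on the right makes the induction close: halving gives eps m <= 2 (eps m - eps (m +
   1)), so the bounds telescope. *)
have step k n : (K <= k)%N -> nr (s (n + k)%N - s k) <= 2 * (eps k - eps (n + k)%N).
  move=> Kk; elim: n => [|n IH]; first by rewrite subrr nr0 subrr mulr0.
  apply: le_trans (nr_trans (s (n + k)%N) _ _) _.
  have := sK (n + k)%N (leq_trans Kk (leq_addl _ _)).
  by have := eh (n + k)%N; rewrite addSn; lra.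
have step' k n : (K <= k)%N -> nr (s (n + k)%N - s k) <= 2 * eps k.
  by move=> Kk; have := step _ n Kk; have := e0 (n + k)%N; lra.
have eps_small e : 0 < e -> exists2 k, (K <= k)%N & 2 * eps k < e.
  move=> epos.
  have ek k : eps k <= eps 0%N / 2 ^+ k.
    elim: k => [|k IH]; first by rewrite expr0 divr1.
    rewrite exprS invfM mulrCA; have := eh k; lra.
  have /cvgrPdist_lt : (fun k => (2 * eps 0%N) / 2 ^+ k) @ \oo --> (2 * eps 0%N * 0).
    apply: cvgM; first exact: cvg_cst.
    under eq_cvg do rewrite -exprVn.
    by apply: cvg_expr; rewrite ger0_norm ?invr_ge0// invf_lt1// ltr1n.
  rewrite mulr0 => /(_ _ epos)[n _ h].
  exists (n + K)%N; first exact: leq_addl.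
  have := h (n + K)%N (leq_addr _ _); rewrite /= sub0r normrN ger0_norm; last first.
    by rewrite divr_ge0 ?mulr_ge0 ?exprn_ge0// ltW.
  apply: le_lt_trans; rewrite -mulrA; apply: ler_wpM2l; rewrite ?ler0n//; exact: ek.
have : cvg (s @ \oo).
  apply/cauchy_cvgP/cauchy_ballP => e e0'.
  have : 0 < complex.Re e / 2 by move: e0'; rewrite ltcE => /andP[_ /=] ?; rewrite divr_gt0.
  move=> /eps_small[k Kk ek].
  have mem : (s @ \oo) [set y | nr (y - s k) < complex.Re e / 2].
    exists k => // m /= km; rewrite -(subnK km).
    exact: le_lt_trans (step' _ _ Kk) ek.
  exists ([set y | nr (y - s k) < complex.Re e / 2], [set y | nr (y - s k) < complex.Re e / 2]).
    by split.
  move=> [y z] /= [yk zk]; rewrite -ball_normE /= nrE.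
  rewrite -[e]RRe_real ?ltcR ?gtr0_real//.
  apply: le_lt_trans (nr_trans (s k) _ _) _; rewrite (nrBC (s k)).
  by lra.
move=> /cvg_ex[l sl]; exists l => // k Kk; apply/ler_addgt0Pr => e epos.
move/cvg_nrP : sl => /(_ _ epos)[n h].
have := h (n + k)%N (leq_addr _ _); have := step' _ n Kk.
have := nr_trans (s (n + k)%N) l (s k); rewrite (nrBC l (s (n + k)%N)); lra.
Qed.

End complete.

(** * Iterates of a bounded operator *)

Section operator.
Context (R : realType) (X : normedModType R[i]) (T : {linear X -> X}).

(** With C >= 1 the powers of C increase, so one power bounds all iterates up to a given time. *)
Lemma continuous_nr_bounded : continuous T ->
  exists2 C : R, 1 <= C & forall x, nr (T x) <= C * nr x.
Proof.
move=> /(_ 0) cT.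
have /nbhs_nrP[e ep eT] : nbhs (0 : X) (T @^-1` [set y | nr (y - T 0) < 1]).
  by apply: cT; apply/nbhs_nrP; exists 1; rewrite ?ltr01.
exists (1 + 2 / e); first by rewrite lerDl divr_ge0// ltW.
move=> x; have [->|x0] := eqVneq x 0; first by rewrite linear0 nr0 mulr0.
have nx := nr_gt0 x0.
pose a : R[i] := (e / 2 / nr x)%:C%C.
have na : nc a = e / 2 / nr x.
  by rewrite nc_real// !divr_ge0// ltW.
have := eT (a *: x); rewrite subr0 nrZ na divfK ?gt_eqF//.
rewrite ltr_pdivrMr// ltr_pMr ?ltr1n// => /(_ isT) /=.
rewrite linear0 subr0 linearZ /= nrZ na => h1.
have : nr (T x) < 2 / e * nr x.
  move: h1; rewrite -ltr_pdivlMl ?divr_gt0// mulr1 => h1; apply: lt_le_trans h1 _.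
  by rewrite invf_div invf_div mulrC.
by rewrite mulrDl mul1r; lra.
Qed.

Lemma iterD_lin n x y : iter n T (x + y) = iter n T x + iter n T y.
Proof. by elim: n => //= n ->; rewrite linearD. Qed.

Lemma iterN_lin n x : iter n T (- x) = - iter n T x.
Proof. by elim: n => //= n ->; rewrite linearN. Qed.

Lemma iterZ_lin n a x : iter n T (a *: x) = a *: iter n T x.
Proof. by elim: n => //= n ->; rewrite linearZ. Qed.

Lemma iter_sum_lin n I (s : seq I) P (f : I -> X) :
  iter n T (\sum_(i <- s | P i) f i) = \sum_(i <- s | P i) iter n T (f i).
Proof. by elim: n => //= n ->; rewrite linear_sum. Qed.

Lemma iter_eigen n x (l : R[i]) : T x = l *: x -> iter n T x = l ^+ n *: x.
Proof.
move=> Tx; elim: n => [|n IH]; first by rewrite expr0 scale1r.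
by rewrite iterS IH linearZ /= Tx scalerA -exprSr.
Qed.

Lemma iter_periodic N n q x : iter N T x = x ->
  iter (n + q * N) T x = iter n T x.
Proof.
move=> Nx; rewrite iterD; congr (iter n T _).
by elim: q => // q IH; rewrite mulSn iterD IH.
Qed.

Lemma iter_continuous n : continuous T -> continuous (iter n T).
Proof.
move=> cT; elim: n => [|n IH] x; first exact: cvg_id.
by rewrite /= -[X in continuous_at _ X]/(T \o iter n T); apply: continuous_comp; [exact: IH|exact: cT].
Qed.

End operator.

(** * Kronecker approximation outside a countable set *)

Section kronecker.
Context (R : realType).
Implicit Types (x y a b k : R).

Definition nearZ k x := exists p : int, `|x - p%:~R| < k.

Lemma nearZ0 k : 0 < k -> nearZ k 0.
Proof. by move=> k0; exists 0; rewrite subrr normr0. Qed.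

Lemma nearZ_le k l x : k <= l -> nearZ k x -> nearZ l x.
Proof. by move=> kl [p xp]; exists p; exact: lt_le_trans kl. Qed.

Lemma nearZD k l x y : nearZ k x -> nearZ l y -> nearZ (k + l) (x + y).
Proof.
move=> [p xp] [q yq]; exists (p + q); rewrite rmorphD /= opprD addrACA.
by rewrite (le_lt_trans (ler_normD _ _))// ltrD.
Qed.

Lemma nearZN k x : nearZ k x -> nearZ k (- x).
Proof. by move=> [p xp]; exists (- p); rewrite rmorphN /= -opprD normrN. Qed.

Lemma nearZM k l (n : nat) x : n%:R * k < l -> nearZ k x -> nearZ l (n%:R * x).
Proof.
move=> nkl [p xp]; exists (p *+ n); rewrite rmorphMn /= -[p%:~R *+ n]mulr_natl -mulrBr.
rewrite normrM ger0_norm ?ler0n// (le_lt_trans _ nkl)//.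
by rewrite ler_wpM2l ?ler0n// ltW.
Qed.

Definition frac x : R := x - (Num.floor x)%:~R.

Lemma frac_itv x : 0 <= frac x < 1.
Proof.
rewrite /frac subr_ge0 Num.Theory.floor_le /= ltrBlDr.
by rewrite addrC -[X in _ + X]/(1%:~R) -rmorphD /= floorD1_gt.
Qed.

Definition cell (q : nat) x : nat := Num.truncn (q%:R * frac x).

Lemma cell_ltn q x : (0 < q)%N -> (cell q x < q)%N.
Proof.
move=> q0; have /andP[f0 f1] := frac_itv x.
rewrite -(ltr_nat R); apply: le_lt_trans (_ : q%:R * frac x < _).
  by rewrite truncn_le// mulr_ge0 ?ler0n.
by rewrite gtr_pMr ?ltr0n.
Qed.

Lemma cell_nearZ q x y : (0 < q)%N -> cell q x = cell q y ->
  nearZ q%:R^-1 (x - y).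
Proof.
move=> q0 xy; exists (Num.floor x - Num.floor y).
have -> : x - y - (Num.floor x - Num.floor y)%:~R = frac x - frac y.
  by rewrite /frac rmorphB /=; ring.
have q0' : (0 : R) < q%:R by rewrite ltr0n.
rewrite -(ltr_pM2l q0') divff ?gt_eqF// -{1}(ger0_norm (ltW q0')) -normrM mulrBr.
have h z : (cell q z)%:R <= q%:R * frac z < (cell q z).+1%:R.
  by apply: truncn_itv; have /andP[f0 _] := frac_itv z; rewrite mulr_ge0// ltW.
have := h x; have := h y; rewrite xy -natr1 ltr_norml; lra.
Qed.

Lemma nearZ_mul_int x : (forall N : nat, nearZ 4^-1 (N%:R * x)) ->
  exists p : int, x = p%:~R.
Proof.
move=> h; have [p] := h 1%N; rewrite mul1r => xp; exists p.
pose d := x - p%:~R.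
(* Doubling: if |y| < 1/4 and 2 y is within 1/4 of an integer, that integer is 0, so |2 y| < 1/4
   again. All numbers 2^k d stay bounded, which forces d = 0. *)
have dk (k : nat) : `|(2 ^ k)%:R * d| < 4^-1.
  elim: k => [|k IH]; first by rewrite expn0 mul1r.
  have [q hq] := h (2 ^ k.+1)%N; pose q' := q - p *+ (2 ^ k.+1).
  have e : (2 ^ k.+1)%:R * x - q%:~R = (2 ^ k.+1)%:R * d - q'%:~R.
    by rewrite /d /q' rmorphB rmorphMn /= -[p%:~R *+ _]mulr_natl; ring.
  move: hq; rewrite e => hq.
  have e2 : (2 ^ k.+1)%:R * d = 2 * ((2 ^ k)%:R * d) by rewrite expnS natrM mulrA.
  suff q0 : q' = 0 by move: hq; rewrite q0 subr0.
  have : `|q'%:~R : R| < 1.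
    by move: hq IH; rewrite e2 !ltr_norml; lra.
  by rewrite -intr_norm -[1]/(1%:~R) ltr_int; lia.
apply/eqP; rewrite -subr_eq0 -normr_le0 -/d; apply/ler_addgt0Pr => e e0; rewrite add0r.
have [k ke] : exists k : nat, e^-1 < k%:R.
  by exists (Num.truncn e^-1).+1; rewrite truncnS_gt.
have := dk k; rewrite normrM ger0_norm ?ler0n// => hk.
have k0 : (0 : R) < k%:R by apply: lt_trans ke; rewrite invr_gt0.
have k2 : (k%:R : R) <= (2 ^ k)%:R by rewrite ler_nat ltnW// ltn_expl.
have : k%:R * `|d| < 1.
  apply: le_lt_trans (ler_wpM2r (normr_ge0 _) k2) _; apply: lt_trans hk _.
  by rewrite invf_lt1// ltr1n.
rewrite -ltr_pdivlMl// mulr1 => dk'; apply: ltW; apply: lt_trans dk' _.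
by rewrite invf_plt// posrE.
Qed.

Variables (n : nat) (th : nat -> R).

(* Up to the tolerances, [al] is in [bad k q] when [k al] depends only on the position of
   [N th] in the torus; [finite_recurrence] leaves finitely many such dependences. *)
Let bad (k q : nat) : set R := [set al | forall N m : nat,
  (forall j, (j < n)%N -> nearZ q.+1%:R^-1 (N%:R * th j - m%:R * th j)) ->
  nearZ 12^-1 (k%:R * (N%:R * al - m%:R * al))].

(** Pigeonhole on the cells of side 1/(q + 1) of the torus: each visited cell keeps one
    representative, and M exceeds them all. *)
Lemma finite_recurrence (q : nat) : exists M : nat, forall N : nat,
  exists2 m, (m < M)%N & forall j, (j < n)%N ->
    nearZ q.+1%:R^-1 (N%:R * th j - m%:R * th j).
Proof.
pose c (N : nat) : {ffun 'I_n -> 'I_q.+1} :=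
  [ffun j : 'I_n => inord (cell q.+1 (N%:R * th j))].
have /choice[f hf] : forall v, exists m, (exists N, c N = v) -> c m = v.
  move=> v; have [[N cN]|no] := pselect (exists N, c N = v); first by exists N.
  by exists 0%N.
exists (\max_v f v).+1 => N; exists (f (c N)).
  by rewrite ltnS; apply: leq_bigmax.
move=> j jn; apply: cell_nearZ => //.
have /ffunP/(_ (Ordinal jn)) := hf (c N) (ex_intro _ N erefl).
by rewrite !ffunE /= => /(congr1 val); rewrite /= !inordK ?cell_ltn.
Qed.

(** Two members with the same [code] differ by an element of (1/k)Z. Compare each N with its
    representative m < M: badness of both numbers and agreement of the codes at m give three errors
    of 1/12, which add up to the 1/4 of [nearZ_mul_int]. *)
Lemma countable_bad (k q : nat) : (0 < k)%N -> countable (bad k q).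
Proof.
move=> k0; have [M hM] := finite_recurrence q.
pose code al : {ffun 'I_M -> 'I_12} :=
  [ffun m : 'I_M => inord (cell 12 (k%:R * (m%:R * al)))].
have -> : bad k q = \bigcup_(w in setT) [set al | bad k q al /\ code al = w].
  apply/seteqP; split => al; first by exists (code al).
  by move=> [w _ []].
apply: bigcup_countable; first exact: finite_set_countable.
move=> w _; have [[a0 [ba0 ca0]]|no] :=
  pselect (exists a0, bad k q a0 /\ code a0 = w); last first.
  by rewrite (_ : [set _ | _] = set0)// -subset0 => al ?; apply: no; exists al.
apply: (@sub_countable _ _ _ [set a0 + p%:~R / k%:R | p in [set: int]]); last first.
  exact: card_le_trans (card_image_le _ _) (countableP _).
apply: subset_card_le => al [bal cal].
suff [p hp] : exists p : int, k%:R * (al - a0) = p%:~R.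
  exists p => //; rewrite -hp mulrAC divff ?mul1r; last by rewrite pnatr_eq0 -lt0n.
  by rewrite addrC subrK.
apply: nearZ_mul_int => N; have [m mM mN] := hM N.
have h1 := bal N m mN; have h2 := nearZN (ba0 N m mN).
have h3 : nearZ 12^-1 (k%:R * (m%:R * al) - k%:R * (m%:R * a0)).
  apply: cell_nearZ => //; have /ffunP/(_ (Ordinal mM)) : code al = code a0 by rewrite cal ca0.
  by rewrite !ffunE /= => /(congr1 val); rewrite /= !inordK ?cell_ltn.
have := nearZD (nearZD h1 h2) h3.
rewrite (_ : _ + _ = 4^-1); last by field.
move=> h; rewrite (_ : N%:R * _ = k%:R * (N%:R * al - m%:R * al) -
  k%:R * (N%:R * a0 - m%:R * a0) + (k%:R * (m%:R * al) - k%:R * (m%:R * a0)))//.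
by ring.
Qed.

Lemma kronecker_countable : countable [set al : R |
  ~ forall be ka : R, 0 < ka -> exists N : nat,
      (forall j, (j < n)%N -> nearZ ka (N%:R * th j)) /\
      nearZ ka (N%:R * al + be)].
Proof.
apply: (@sub_countable _ _ _ (\bigcup_(kq in [set: nat * nat]) bad kq.1.+1 kq.2)); last first.
  by apply: bigcup_countable => // -[k q] _; exact: countable_bad.
apply: subset_card_le => al; apply: contra_notP => nb be ka ka0.
have [q0 q0k] : exists q0 : nat, ka^-1 < q0.+1%:R.
  by exists (Num.truncn ka^-1); rewrite truncnS_gt.
have q0ka : (q0.+1%:R)^-1 < ka by rewrite invf_plt// posrE.
(* The factorial is a multiple of every j <= q0 + 1, among which the multiplier of the pigeonhole
   step below is found. *)
pose k := (q0.+1)`!; have k0 : (0 < k)%N := fact_gt0 _.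
have kR : (0 : R) < k%:R by rewrite ltr0n.
(* Even 12 k (q0 + 1) errors of size 1/(q + 1) add up to less than [ka]. *)
pose q : nat := Num.truncn ((12 * k * q0.+1)%:R / ka).
have qka : (12 * k * q0.+1)%:R * (q.+1%:R)^-1 < ka.
  rewrite ltr_pdivrMr// mulrC -ltr_pdivrMr// truncnS_gt//.
have [D [D0 Dth Dal]] : exists D : nat, [/\ (0 < D)%N,
    forall j, (j < n)%N -> nearZ q.+1%:R^-1 (D%:R * th j) &
    ~ nearZ 12^-1 (k%:R * (D%:R * al))].
  have : ~ bad k q al.
    by move=> b; apply: nb; exists (k.-1, q) => //=; rewrite prednK.
  move=> /existsNP[N /existsNP[m /not_implyP[h1 h2]]].
  have [Nm|mN|Nm] := ltngtP N m.
  - exists (m - N)%N; rewrite subn_gt0 Nm; split => // [j jn|h].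
      rewrite natrB 1?ltnW// mulrBl -opprB; apply: nearZN; exact: h1.
    apply: h2; move/nearZN : h; rewrite natrB 1?ltnW// (_ : - _ = k%:R * (N%:R * al - m%:R * al))//; by ring.
  - exists (N - m)%N; rewrite subn_gt0 mN; split => // [j jn|h].
      by rewrite natrB 1?ltnW// mulrBl; exact: h1.
    by apply: h2; move: h; rewrite natrB 1?ltnW// mulrBl.
  - exfalso; apply: h2; rewrite Nm subrr mulr0; apply: nearZ0; by rewrite invr_gt0.
pose nu := D%:R * al.
(* Dirichlet: two of q0 + 2 multiples of nu share one of q0 + 1 cells, and j is the difference of
   their indices. *)
have [j [/andP[j0 jq] hj]] : exists j : nat, (0 < j <= q0.+1)%N /\
    nearZ q0.+1%:R^-1 (j%:R * nu).
  pose g (j : 'I_q0.+2) : 'I_q0.+1 := inord (cell q0.+1 (j%:R * nu)).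
  have : ~~ injectiveb g.
    apply/negP => /injectiveP /leq_card; rewrite !card_ord; lia.
  move=> /injectivePn[i [j ij gij]].
  have gij' : cell q0.+1 (i%:R * nu) = cell q0.+1 (j%:R * nu).
    by move: gij => /(congr1 val); rewrite /= !inordK ?cell_ltn.
  have hi := ltn_ord i; have hj := ltn_ord j.
  have [lij|lji|eij] := ltngtP i j.
  - exists (j - i)%N; split; first by lia.
    rewrite natrB 1?ltnW// mulrBl; exact: cell_nearZ.
  - exists (i - j)%N; split; first by lia.
    rewrite natrB 1?ltnW// mulrBl; exact: cell_nearZ.
  - by case/eqP: ij; exact: val_inj.
have [p hp] := hj; pose a := j%:R * nu - p%:~R.
(* The step a is shorter than [ka] but not too short: (k / j) a equals k D al up to an integer, and
   k D al is at distance at least 1/12 from all integers. Hence at most 12 k steps reach any target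
   modulo 1. *)
have a12 : (12 * k)%:R * `|a| >= 1.
  rewrite leNgt; apply/negP => h; apply: Dal.
  have kj : (k = k %/ j * j)%N by rewrite divnK// dvdn_fact// j0.
  exists (p *+ (k %/ j)).
  have -> : k%:R * (D%:R * al) - (p *+ (k %/ j))%:~R = (k %/ j)%:R * a.
    have kR' : k%:R = (k %/ j)%:R * j%:R :> R by rewrite {1}kj natrM.
    by rewrite /a /nu rmorphMn /= -[p%:~R *+ _]mulr_natl kR'; ring.
  rewrite normrM ger0_norm ?ler0n//.
  have : (k %/ j)%:R * `|a| <= k%:R * `|a|.
    by rewrite ler_wpM2r// ler_nat leq_div.
  by move: h; rewrite natrM; lra.
have a0 : a != 0 by apply/eqP => a0; move: a12; rewrite a0 normr0 mulr0 ler10.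
have na0 : 0 < `|a| by rewrite normr_gt0.
(* b represents - be modulo 1 and is chosen on the same side of 0 as a, so that a nonnegative number
   of steps leads to it. *)
have [b [bb babs]] : exists b, (exists z : int, b = - be + z%:~R) /\ 0 <= b / a <= `|a|^-1.
  have /andP[f0 f1] := frac_itv (- be).
  have [ap|an] := ltP 0 a.
    exists (frac (- be)); split; first by exists (- Num.floor (- be)); rewrite /frac rmorphN.
    rewrite divr_ge0 ?(ltW ap)//= gtr0_norm//.
    by rewrite ler_piMl ?invr_ge0 ?(ltW ap)// ltW.
  exists (frac (- be) - 1); split.
    by exists (- Num.floor (- be) - 1); rewrite /frac rmorphB rmorphN /=; ring.
  rewrite ler0_norm// -mulrNN -invrN.
  have : 0 < - a by rewrite oppr_gt0 lt_neqAle a0.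
  move=> na; rewrite divr_ge0 ?(ltW na)//=; last by lra.
  by rewrite ler_piMl ?invr_ge0 ?(ltW na)//; lra.
move: babs => /andP[ba0 ba1].
pose s := Num.truncn (b / a).
have s12 : (s <= 12 * k)%N.
  rewrite -(ler_nat R); apply: (le_trans (_ : _ <= b / a)); first by rewrite truncn_le.
  apply: le_trans ba1 _; rewrite -[X in X <= _]mul1r ler_pdivrMr//.
have sa : `|s%:R * a - b| < ka.
  have /andP[s1 s2] : s%:R <= b / a < s.+1%:R by exact: truncn_itv.
  have -> : s%:R * a - b = (s%:R - b / a) * a by rewrite mulrBl divfK.
  rewrite normrM; apply: (le_lt_trans (_ : _ <= 1 * `|a|)); last first.
    by rewrite mul1r; exact: lt_trans hp q0ka.
  by rewrite ler_wpM2r// ler_norml; move: s2; rewrite -natr1; lra.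
exists (s * j * D)%N; split => [i i_n|].
  rewrite natrM -mulrA; apply: nearZM (Dth _ i_n).
  apply: le_lt_trans qka; rewrite ler_wpM2r ?invr_ge0 ?ler0n// ler_nat.
  by rewrite leq_mul.
move: bb => [z bz]; exists (p *+ s + z).
have -> : (s * j * D)%:R * al + be - (p *+ s + z)%:~R = s%:R * a - b.
  by rewrite bz /a /nu rmorphD rmorphMn /= -[p%:~R *+ _]mulr_natl !natrM; ring.
exact: sa.
Qed.

End kronecker.

(** * Measurability and laws of random vectors *)

Section prob.
Context (R : realType) d (Om : measurableType d) (P : probability Om R).

Lemma measurable_lt (f : Om -> R) (a : R) : measurable_fun setT f ->
  measurable [set w | f w < a].
Proof.
move=> mf; rewrite -[X in measurable X]setTI.
exact: (measurable_fun_ltr mf (measurable_cst a)) (measurableT) [set true] _.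
Qed.

Lemma bounded_integrable (f : Om -> R) M : measurable_fun setT f ->
  (forall w, `|f w| <= M) -> P.-integrable setT (EFin \o f).
Proof.
move=> mf fM; apply: measurable_bounded_integrable => //.
  exact: (le_lt_trans (probability_le1 P measurableT) (ltry _)).
exists M; split; first exact: num_real.
by move=> z Mz w _ /=; apply: le_trans (fM _) (ltW _).
Qed.

End prob.

Section borel.
Context (R : realType) (X : normedModType R[i]).

Lemma separable_dense_seq : separable_space X -> exists D : nat -> X,
  forall x (e : R), 0 < e -> exists n, nr (D n - x) < e.
Proof.
move=> [D [/countable_injP[f fI] clD]].
have /choice[g hg] : forall n, exists x, (exists2 y, D y & f y = n) -> D x /\ f x = n.
  move=> n; have [[y Dy fy]|no] := pselect (exists2 y, D y & f y = n).
    by exists y.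
  by exists 0.
exists g => x e e0; have : closure D x by rewrite clD.
move=> /closure_nrP /(_ _ e0)[y Dy yx]; exists (f y).
have [Dg fg] := hg (f y) (ex_intro2 _ _ y Dy erefl).
by rewrite (fI _ _ _ _ fg)// ?inE.
Qed.

Lemma open_borel (U : set X) : open U -> measurable (U : set (borel X)).
Proof. exact: sub_sigma_algebra. Qed.

Lemma continuous_borel (f : X -> R) : continuous f ->
  measurable_fun setT (f : borel X -> R).
Proof.
move=> cf; apply: (measurability _ (@RGenOInfty.measurableE R)).
move=> _ [_ [a ->] <-]; rewrite setTI; apply: open_borel.
rewrite (_ : _ @^-1` _ = f @^-1` [set z | a < z]).
  by apply: open_comp => //; exact: open_gt.
by apply/seteqP; split=> x /=; rewrite in_itv /= andbT.
Qed.

Context d (Om : measurableType d) (P : probability Om R).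

Lemma meas_comp_cont (S : Om -> X) (f : X -> R) :
  measurable_fun setT (S : Om -> borel X) -> continuous f ->
  measurable_fun setT (fun w => f (S w)).
Proof. by move=> mS cf; apply: measurableT_comp mS; exact: continuous_borel. Qed.

Lemma law_exists (S : Om -> X) : measurable_fun setT (S : Om -> borel X) ->
  exists m : Prob X R, (forall B : set X, m B = P (S @^-1` B)) /\
   forall f : X -> R, bcontinuous f ->
     (\int[m]_x (f x)%:E = \int[P]_w (f (S w))%:E)%E.
Proof.
move=> mS; pose Sm : {mfun Om >-> borel X} :=
  HB.pack (S : Om -> borel X) (isMeasurableFun.Build _ _ _ _ (S : Om -> borel X) mS).
exists (distribution P Sm); split => // f [cf [M fM]].
rewrite integral_distribution//.
  by apply/measurable_EFinP; exact: continuous_borel.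
rewrite (_ : _ \o _ = EFin \o (fun w => f (S w)))//.
apply: (@bounded_integrable _ _ _ P (fun w => f (S w)) M) => //.
exact: meas_comp_cont.
Qed.

Variable D : nat -> X.
Hypothesis hD : forall x (e : R), 0 < e -> exists n, nr (D n - x) < e.

Lemma borel_measurable_nr (S : Om -> X) :
  (forall n, measurable_fun setT (fun w => nr (S w - D n))) ->
  measurable_fun setT (S : Om -> borel X).
Proof.
move=> h; apply: (@measurability _ _ _ (borel X) setT S (@open X) erefl) => _ [U oU <-]; rewrite setTI.
pose B (np : nat * nat) := [set x | nr (x - D np.1) < np.2.+1%:R^-1].
rewrite (_ : _ @^-1` _ = \bigcup_(np in setT) (if `[< B np `<=` U >] then S @^-1` B np else set0)).
  apply: countable_bigcupT_measurable => // np; case: ifPn => // _.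
  exact: (measurable_lt _ (h np.1)).
apply/seteqP; split => [w /= USw|w [np _]]; last first.
  by case: ifPn => // /asboolP BU BS; exact: BU.
have /nbhs_nrP[e e0 eU] : nbhs (S w) U by exact: open_nbhs_nbhs.
have [p pe] : exists p : nat, (p.+1%:R)^-1 < e / 2.
  exists (Num.truncn (e / 2)^-1); rewrite invf_plt ?posrE ?divr_gt0//.
  exact: truncnS_gt.
have [n np] : exists n, nr (D n - S w) < p.+1%:R^-1 by apply: hD.
exists (n, p) => //; rewrite ifT /=; first by rewrite /B /= nrBC.
apply/asboolP => x /= xn; apply: eU.
have {}xn : nr (x - D n) < p.+1%:R^-1 := xn.
apply: le_lt_trans (nr_trans (D n) _ _) _.
by rewrite (splitr e) ltrD//; exact: lt_trans pe.
Qed.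

(** S + S' is within a of [D n] exactly when, for some k, the distances of S to [D k] and of S' to
    [D n - D k] add up to less than a. Density makes countably many k enough, and each event
    involves only real functions of S and of S'. *)
Lemma borel_measurableD (S S' : Om -> X) :
  measurable_fun setT (S : Om -> borel X) ->
  measurable_fun setT (S' : Om -> borel X) ->
  measurable_fun setT ((fun w => S w + S' w) : Om -> borel X).
Proof.
move=> mS mS'; apply: borel_measurable_nr => n.
apply: (measurability _ (@RGenInftyO.measurableE R)).
move=> _ [_ [a ->] <-]; rewrite setTI.
rewrite (_ : _ @^-1` _ = \bigcup_k
  [set w | nr (S w - D k) + nr (S' w - (D n - D k)) < a]).
  apply: countable_bigcupT_measurable => // k.
  apply: measurable_lt; apply: measurable_funD.
    by apply: (meas_comp_cont (f := fun x => nr (x - D k)) mS); exact: nr_continuous.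
  by apply: (meas_comp_cont (f := fun x => nr (x - (D n - D k))) mS'); exact: nr_continuous.
apply/seteqP; split => w /=; rewrite in_itv /= => h.
  have [k hk] : exists k, nr (D k - S w) < (a - nr (S w + S' w - D n)) / 2.
    by apply: hD; rewrite divr_gt0// subr_gt0.
  exists k => //=.
  have : nr (S' w - (D n - D k)) <= nr (S w + S' w - D n) + nr (D k - S w).
    apply: le_trans (nrD _ _); rewrite [D k - _]addrC addrA [S w + _]addrC.
    by rewrite [_ - D n - S w]addrAC addrK opprB addrA addrAC.
  rewrite (nrBC (S w)); lra.
case: h => k _ /=; apply: le_lt_trans; apply: le_trans (nrD _ _).
by rewrite opprB addrACA addKr.
Qed.

End borel.

(** * Borel-Cantelli with geometric bounds *)

Section almost_sure.
Context (R : realType) d (Om : measurableType d) (P : probability Om R).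

Lemma prob_bigcup_geometric (A : nat -> set Om) (c : R) : 0 <= c ->
  (forall k, measurable (A k)) ->
  (forall k, (P (A k) <= (c / 2 ^+ k.+1)%:E)%E) -> (P (\bigcup_k A k) <= c%:E)%E.
Proof.
move=> c0 mA hA.
apply: (le_trans (measure_sigma_subadditive P mA _ (@subset_refl _ _))).
  exact: bigcupT_measurable.
apply: (@le_trans _ _ (\sum_(0 <= k <oo) (c / (2 ^ k.+1)%:R)%:E)%E).
  apply: lee_nneseries => [k _ _|k _]; first exact: measure_ge0.
  by rewrite natrX; exact: hA.
exact: (epsilon_trick0 xpredT).
Qed.

(** Borel-Cantelli: the union of the events from K on has probability at most c / 2^K. *)
Lemma eventually_notin (A : nat -> set Om) (c : R) : 0 <= c ->
  (forall k, measurable (A k)) ->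
  (forall k, (P (A k) <= (c / 2 ^+ k.+1)%:E)%E) ->
  measurable [set w | exists K, forall k, (K <= k)%N -> ~ A k w] /\
  P [set w | exists K, forall k, (K <= k)%N -> ~ A k w] = 1%E.
Proof.
move=> c0 mA hA; set G := [set w | _].
pose B K := \bigcup_k A (k + K)%N.
have mB K : measurable (B K) by apply: bigcupT_measurable => k.
have GE : G = \bigcup_K ~` B K.
  apply/seteqP; split=> w [K].
    by move=> h; exists K => // -[k _]; apply: h; exact: leq_addl.
  by move=> _ nB; exists K => k Kk Ak; apply: nB; exists (k - K)%N; rewrite ?subnK.
have mG : measurable G by rewrite GE; apply: bigcupT_measurable => K; exact: measurableC.
split=> //; suff PC : P (~` G) = 0%E.
  by rewrite -[G]setCK probability_setC ?PC ?sube0//; exact: measurableC.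
apply/eqP; rewrite eq_le measure_ge0 andbT; apply/lee_addgt0Pr => e e0.
have [K Ke] := exists_pow2_lt c e0.
rewrite add0e; apply: (@le_trans _ _ (P (B K))).
  apply: le_measure; rewrite ?inE//; first exact: measurableC.
  by rewrite GE setC_bigcup => w /(_ K I); rewrite setCK.
apply: (@le_trans _ _ (c / 2 ^+ K)%:E); last by rewrite lee_fin ltW.
apply: prob_bigcup_geometric => //; first by rewrite divr_ge0// exprn_ge0.
move=> k; apply: le_trans (hA _) _; rewrite lee_fin -addSn exprD invfM mulrA.
by rewrite mulrAC.
Qed.

End almost_sure.

(** * The weak topology on probability measures *)

Section weak.
Context (R : realType) (X : normedModType R[i]).

Definition bint (m : Prob X R) (f : X -> R) : R := fine (\int[m]_x (f x)%:E)%E.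

Lemma bintE (m : Prob X R) (f : X -> R) : bcontinuous f -> (\int[m]_x (f x)%:E)%E = (bint m f)%:E.
Proof.
move=> [cf [M fM]]; rewrite fineK//; apply: integrable_fin_num => //.
by apply: (@bounded_integrable _ _ _ m f M) => //; exact: continuous_borel.
Qed.

Lemma wnbhsP m (U : set (Prob X R)) : wnbhs m U <->
  exists (n : nat) (f : 'I_n -> X -> R) (e : R), 0 < e /\
    (forall i, bcontinuous (f i)) /\
    forall m' : Prob X R, (forall i, `|bint m' (f i) - bint m (f i)| < e) -> U m'.
Proof.
by split=> -[n [f [e [e0 [bf h]]]]]; exists n, f, e; do 2!split=> //;
  move=> m' hm'; apply: h => i; move: (hm' i); rewrite !bintE// -EFinB abseE lte_fin.
Qed.

Lemma wclosure_idem (A B : set (Prob X R)) :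
  A `<=` wclosure B -> wclosure A `<=` wclosure B.
Proof.
move=> AB m mA U /wnbhsP[n [f [e [e0 [bf h]]]]].
have e2 : 0 < e / 2 by rewrite divr_gt0.
have [|m1 [Am1 hm1]] := mA [set m' | forall i, `|bint m' (f i) - bint m (f i)| < e / 2].
  by apply/wnbhsP; exists n, f, (e / 2).
have [|m2 [Bm2 hm2]] := AB _ Am1 [set m' | forall i, `|bint m' (f i) - bint m1 (f i)| < e / 2].
  by apply/wnbhsP; exists n, f, (e / 2).
exists m2; split=> //; apply: h => i; have := hm1 i; have := hm2 i.
by rewrite /= !ltr_norml; lra.
Qed.

Context d (Om : measurableType d) (P : probability Om R).

(** Almost sure convergence passes to integrals of bounded continuous functions by dominated
    convergence. A basic neighbourhood involves finitely many of them, so one K serves all. *)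
Lemma law_cvg (S : nat -> Om -> X) (S' : Om -> X) (G : set Om)
    (m : nat -> Prob X R) (m' : Prob X R) :
  (forall k, measurable_fun setT (S k : Om -> borel X)) ->
  measurable_fun setT (S' : Om -> borel X) ->
  measurable G -> P G = 1%E -> (forall w, G w -> S k w @[k --> \oo] --> S' w) ->
  (forall k f, bcontinuous f -> (\int[m k]_x (f x)%:E = \int[P]_w (f (S k w))%:E)%E) ->
  (forall f, bcontinuous f -> (\int[m']_x (f x)%:E = \int[P]_w (f (S' w))%:E)%E) ->
  forall U, wnbhs m' U -> exists K, forall k, (K <= k)%N -> U (m k).
Proof.
move=> mS mS' mG PG cS hm hm' U /wnbhsP[n [f [e [e0 [bf hU]]]]].
have cv i : bint (m k) (f i) @[k --> \oo] --> bint m' (f i).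
  have [cf [M fM]] := bf i.
  have [] := @dominated_convergence _ _ _ P setT measurableT
    (fun k w => (f i (S k w))%:E) (fun w => (f i (S' w))%:E) (cst M%:E).
  - by move=> k; apply/measurable_EFinP; exact: meas_comp_cont.
  - by apply/measurable_EFinP; exact: meas_comp_cont.
  - exists (~` G); split; first exact: measurableC.
      by apply: (etrans (probability_setC P mG)); rewrite PG subee.
    apply: subsetC => w Gw _; apply: cvg_EFin; first exact: nearW.
    by apply: continuous_cvg; [exact: cf|exact: cS].
  - by apply: (@bounded_integrable _ _ _ P (cst M) `|M|).
  - by apply: aeW => w k _; rewrite lee_fin.
  move=> _ _; rewrite -hm'// bintE// => h.
  apply: fine_cvg; apply: cvg_trans h; apply: near_eq_cvg; near=> k.
  by rewrite /= hm.
have /choice[K hK] : forall i, exists K, forall k, (K <= k)%N ->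
    `|bint (m k) (f i) - bint m' (f i)| < e.
  move=> i; have /cvgrPdist_lt /(_ e e0)[K _ h] := cv i.
  by exists K => k Kk; rewrite distrC; exact: h.
exists (\max_i K i) => k Kk; apply: hU => i; apply: hK.
by apply: leq_trans Kk; exact: leq_bigmax.
Unshelve. all: by end_near.
Qed.

End weak.

Definition unpickle_dflt (T : countType) (x0 : T) (k : nat) : T := odflt x0 (unpickle k).

Lemma unpickle_dfltK (T : countType) (x0 : T) x : unpickle_dflt x0 (pickle x) = x.
Proof. by rewrite /unpickle_dflt pickleK. Qed.

Section continuous_minmax.
Context (R : realType) (X : topologicalType).

Lemma continuous_maxr (f g : X -> R) : continuous f -> continuous g ->
  continuous (fun x => Num.max (f x) (g x)).
Proof.
move=> cf cg x; under eq_fun do rewrite maxr_absE.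
apply: cvgM; last exact: cvg_cst.
apply: cvgD; first by apply: cvgD; [exact: cf|exact: cg].
by apply: cvg_norm; apply: cvgB; [exact: cf|exact: cg].
Qed.

Lemma continuous_minr (f g : X -> R) : continuous f -> continuous g ->
  continuous (fun x => Num.min (f x) (g x)).
Proof.
move=> cf cg x; under eq_fun do rewrite minr_absE.
apply: cvgM; last exact: cvg_cst.
apply: cvgB; first by apply: cvgD; [exact: cf|exact: cg].
by apply: cvg_norm; apply: cvgB; [exact: cf|exact: cg].
Qed.

End continuous_minmax.

(** * Hypercyclic vectors and the G_delta property *)

Section hc.
Context (R : realType) (X : normedModType R[i]) (T : {linear X -> X}).
Hypothesis cT : continuous T.
Variable D : nat -> X.
Hypothesis hD : forall x (e : R), 0 < e -> exists n, nr (D n - x) < e.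

Definition hits (v : X) (r : R) : set X :=
  \bigcup_N [set x | nr (iter N T x - v) < r].

Lemma open_hits v r : open (hits v r).
Proof.
apply: bigcup_open => N _; rewrite (_ : mkset _ = iter N T @^-1` [set y | nr (y - v) < r])//.
by apply: open_comp; [move=> x _; exact: iter_continuous|exact: open_nr_ball].
Qed.

Let Dp k := unpickle_dflt (0, 0)%N k.

Lemma HCE : HC T = \bigcap_k hits (D (Dp k).1) (Dp k).2.+1%:R^-1.
Proof.
apply/seteqP; split => x.
  move=> dx k _; case: (Dp k) => j p /=.
  have [||y [yD [N _ Ny]]] := dx [set y | nr (y - D j) < p.+1%:R^-1].
  - by exists (D j); rewrite /= subrr nr0 invr_gt0.
  - exact: open_nr_ball.
  by exists N => //=; rewrite Ny.
move=> h O [y Oy] oO.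
have /nbhs_nrP[e e0 eO] : nbhs y O by exact: open_nbhs_nbhs.
have e2 : 0 < e / 2 by rewrite divr_gt0.
have [p pe] := exists_invS_lt e2; have [j jy] := hD y e2.
have [N _] := h (pickle (j, p)) I; rewrite /Dp unpickle_dfltK /= => hN.
exists (iter N T x); split; last by exists N.
apply: eO; apply: le_lt_trans (nr_trans (D j) _ _) _.
by rewrite (splitr e) ltrD//; exact: lt_trans hN pe.
Qed.

Lemma measurable_HC : measurable (HC T : set (borel X)).
Proof.
rewrite HCE; apply: bigcapT_measurable => k; apply: open_borel; exact: open_hits.
Qed.

Section bump.
Variables (v : X) (r : R).

(** Positive exactly where one of the first n iterates comes within r of v; [ubump] turns it into
    continuous minorants of the indicator of [hits v r]. *)
Fixpoint bump n x : R :=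
  if n is k.+1 then Num.max (bump k x) (r - nr (iter k T x - v)) else 0.

Lemma bump_ge0 n x : 0 <= bump n x.
Proof. by elim: n => //= n IH; rewrite le_max IH. Qed.

Lemma bump_homo m n x : (m <= n)%N -> bump m x <= bump n x.
Proof.
elim: n => [|n IH]; first by rewrite leqn0 => /eqP ->.
by rewrite leq_eqVlt ltnS => /predU1P[->//|/IH] h; rewrite (le_trans h)//= le_max lexx.
Qed.

Lemma bump_continuous n : continuous (bump n).
Proof.
elim: n => [|n IH] x; first exact: cvg_cst.
apply: (continuous_maxr IH) => {}x.
apply: cvgB; first exact: cvg_cst.
apply: (@continuous_comp _ _ _ (iter n T) (fun y => nr (y - v))); first exact: iter_continuous.
exact: nr_continuous.
Qed.

Lemma bump_hits n x : 0 < bump n x -> hits v r x.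
Proof.
elim: n => [|n IH] /=; first by rewrite ltxx.
by rewrite lt_max => /orP[//|]; rewrite subr_gt0 => h; exists n.
Qed.

Definition ubump n x : R := Num.min 1 (n%:R * bump n x).

Lemma ubump_bcontinuous n : bcontinuous (ubump n).
Proof.
split; last first.
  exists 1 => x; rewrite ger0_norm ?ge_min ?lexx//.
  by rewrite le_min ler01 mulr_ge0// bump_ge0.
apply: continuous_minr => x; first exact: cvg_cst.
by apply: cvgM; [exact: cvg_cst|exact: bump_continuous].
Qed.

Lemma ubump_itv n x : 0 <= ubump n x <= (\1_(hits v r) x : R).
Proof.
rewrite /ubump le_min ler01 mulr_ge0 ?bump_ge0//= indicE.
have [h|h] := boolP (x \in hits v r); first by rewrite ge_min lexx.
rewrite ge_min; apply/orP; right; rewrite mulr_ge0_le0// leNgt; apply/negP => /bump_hits.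
by move=> hx; move/negP: h; apply; rewrite inE.
Qed.

End bump.

(** One half of the portmanteau theorem. The sets [O n] where [ubump] reaches 1 increase to
    [hits v r], so c < m (O n) for some n. Then c is below the integral of [ubump], a weakly open
    condition, and that integral is at most the mass of [hits v r]. *)
Lemma wopen_hits v r c : Defs.wopen [set m : Prob X R | (c%:E < m (hits v r))%E].
Proof.
move=> m /= cm; have mh := open_borel (open_hits v r).
pose O n : set (borel X) := [set x | 1 <= ubump v r n x].
have mub n : measurable_fun setT (ubump v r n : borel X -> R).
  by apply: continuous_borel; have [] := ubump_bcontinuous v r n.
have mO n : measurable (O n).
  rewrite (_ : O n = ~` [set x | ubump v r n x < 1]); last first.
    by apply/seteqP; split => x; rewrite /O /= leNgt => /negP.
  by apply: measurableC; exact: measurable_lt.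
have Oh : \bigcup_n O n = hits v r.
  apply/seteqP; split => x.
    move=> [n _ /= On]; have /andP[_] := ubump_itv v r n x; rewrite indicE.
    case: (boolP (x \in hits v r)) => [/set_mem//|_] h.
    by have := le_trans (On : 1 <= ubump v r n x) h; rewrite ler10.
  move=> [N _ /= hN].
  pose a := r - nr (iter N T x - v); have a0 : 0 < a by rewrite subr_gt0.
  pose n := maxn N.+1 (Num.truncn a^-1).+1.
  exists n => //; rewrite /O /= /ubump le_min lexx /=.
  apply: (@le_trans _ _ (n%:R * a)).
    rewrite -ler_pdivrMr// mul1r ltW// (lt_le_trans (truncnS_gt _))// ler_nat.
    exact: leq_maxr.
  rewrite ler_wpM2l//; apply: (@le_trans _ _ (bump v r N.+1 x)).
    by rewrite /= le_max lexx orbT.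
  by apply: bump_homo; exact: leq_maxl.
have int_ub (m' : Prob X R) n : (m' (O n) <= \int[m']_x (ubump v r n x)%:E <= m' (hits v r))%E.
  have iE (B : set (borel X)) : measurable B -> m' B = (\int[m']_x (\1_B x)%:E)%E.
    by move=> mB; rewrite integral_indic// setIT.
  rewrite (iE _ (mO n)) (iE _ mh).
  apply/andP; split; apply: ge0_le_integral => //.
  - by apply/measurable_EFinP; exact: measurable_indic.
  - by apply/measurable_EFinP.
  - move=> x _; rewrite lee_fin indicE; have /andP[h0 _] := ubump_itv v r n x.
    by have [|] := boolP (x \in O n); rewrite ?inE.
  - by move=> x _; rewrite lee_fin; have /andP[] := ubump_itv v r n x.
  - by apply/measurable_EFinP.
  - by apply/measurable_EFinP; exact: measurable_indic.
  - by move=> x _; rewrite lee_fin; have /andP[] := ubump_itv v r n x.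
have [n cn] : exists n, (c%:E < m (O n))%E.
  have cv : (m \o O) n @[n --> \oo] --> m (\bigcup_n O n).
    apply: nondecreasing_cvg_mu => //; first by rewrite Oh.
    move=> i j ij; apply/subsetPset => x; rewrite /O /= => h; apply: le_trans h _.
    rewrite /ubump le_min ge_min lexx /= ge_min; apply/orP; right.
    apply: ler_pM => //; first exact: bump_ge0; first by rewrite ler_nat.
    exact: bump_homo.
  rewrite Oh in cv; apply: contrapT => /forallNP no.
  move: cm; rewrite ltNge => /negP; apply; apply: cvge_le cv; apply: nearW => n.
  by rewrite leNgt; apply/negP; exact: no.
have bu := ubump_bcontinuous v r n.
have := int_ub m n; rewrite bintE// => /andP[h1 _].
apply/wnbhsP; exists 1%N, (fun=> ubump v r n), (bint m (ubump v r n) - c).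
split; first by rewrite subr_gt0 -lte_fin (lt_le_trans cn).
split=> // m' /(_ ord0) hm' /=; have := int_ub m' n; rewrite bintE// => /andP[_].
apply: lt_le_trans; rewrite lte_fin; move: hm'; rewrite ltr_norml; lra.
Qed.

(** Full mass on the countable intersection [HCE] amounts to mass above 1 - 1/(q + 1), for every q,
    on each of the open sets. *)
Lemma probs_HC_Gdelta : exists U : nat -> set (Prob X R),
  (forall k, Defs.wopen (U k)) /\ @probs_on X R (HC T) = \bigcap_k U k.
Proof.
pose U (k : nat) : set (Prob X R) := 
  if unpickle k is Some (j, p, q) then
    [set m | ((1 - (q : nat).+1%:R^-1)%:E < m (hits (D j) (p : nat).+1%:R^-1))%E]
  else setT.
exists U; split.
  move=> k; rewrite /U; case: unpickle => [[[j p] q]|]; first exact: wopen_hits.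
  by move=> m _; exists 0%N, (fun i _ => 0), 1; split => //; split => // -[].
have mh j p := open_borel (open_hits (D j) p.+1%:R^-1).
apply/seteqP; split => m.
  move=> /= mHC k _; rewrite /U; case: unpickle => [[[j p] q]|//] /=.
  apply: (@lt_le_trans _ _ 1%E); first by rewrite lte_fin gtrBl invr_gt0.
  rewrite -mHC; apply: le_measure; rewrite ?inE//; first exact: measurable_HC.
  by rewrite HCE => x /(_ (pickle (j, p)) I); rewrite /Dp unpickle_dfltK.
move=> h; rewrite /probs_on /=.
have h1 j p : m (hits (D j) p.+1%:R^-1) = 1%E.
  apply/eqP; rewrite eq_le probability_le1//=; apply/lee_addgt0Pr => e e0.
  have [q qe] := exists_invS_lt e0.
  have := h (pickle (j, p, q)) I; rewrite /U pickleK /= => hq.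
  rewrite -leeBlDr//; apply: le_trans (ltW hq).
  by rewrite -EFinB lee_fin lerB// ltW.
suff : m (~` HC T) = 0%E.
  move=> h0; rewrite -[HC T]setCK; apply: (etrans (probability_setC m _)).
    by apply: measurableC; exact: measurable_HC.
  by rewrite h0 sube0.
rewrite HCE setC_bigcap; apply/eqP; rewrite eq_le measure_ge0 andbT.
apply: prob_bigcup_geometric => // k; first by apply: measurableC; exact: mh.
rewrite mul0r; have := probability_setC m (mh (Dp k).1 (Dp k).2).
by rewrite h1 subee// => ->.
Qed.

End hc.

Lemma injective_unbounded (f : nat -> nat) : injective f ->
  forall K, exists m, (K <= f m)%N.
Proof.
move=> fI K; apply: contrapT => /forallNP no.
have fK (m : 'I_K.+1) : (f m < K)%N by rewrite ltnNge; apply/negP; exact: no.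
have /leq_card : injective (fun m : 'I_K.+1 => Ordinal (fK m)).
  by move=> m m' [] /fI /val_inj.
by rewrite !card_ord ltnn.
Qed.

(** * Infinitely many perturbations and their limit *)

Section scheme.
Context (R : realType) (X : completeNormedModType R[i]) (T : {linear X -> X}).
Hypothesis cT : continuous T.
Variable D : nat -> X.
Hypothesis hD : forall x (e : R), 0 < e -> exists n, nr (D n - x) < e.
Context d (Om : measurableType d) (P : probability Om R).
Variable C : set (Om -> X).
Hypothesis mC : forall S, C S -> measurable_fun setT (S : Om -> borel X).
Hypothesis extC : forall S (u v : X) (e delta : R), C S -> 0 < e -> 0 < delta ->
  exists S', [/\ C S',
    exists A, [/\ measurable A, (P A <= e%:E)%E &
      forall w, ~ A w -> nr (S' w - S w) <= e] &
    forall w, nr (S w - u) < delta ->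
      exists N, nr (iter N T (S' w) - v) < 2 * delta].

(** Makes the hit robust: it holds for every y within 2 e' of [S' w]. The value 2 e' is what
    [geometric_cvg] allows for the total of all later perturbations when their sizes start at e' and
    halve. *)
Lemma scheme_step S (u v : X) (e delta : R) : C S -> 0 < e -> 0 < delta ->
  exists S' e' A, [/\ C S', 0 < e' <= e / 2, measurable A, (P A <= (2 * e)%:E)%E &
    forall w, ~ A w -> nr (S' w - S w) <= e /\
      (nr (S w - u) < delta -> forall y, nr (y - S' w) <= 2 * e' ->
        exists N, nr (iter N T y - v) < 3 * delta)].
Proof.
move=> CS e0 d0; have [S' [CS' [A [mA PA SA]] hit]] := extC u v CS e0 d0.
pose miss N := [set w | nr (S w - u) < delta] `\` [set w | nr (iter N T (S' w) - v) < 2 * delta].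
(* Outcomes near u without a hit up to time M. They decrease to the empty set, so for some M their
   probability is at most e. *)
pose E M := \bigcap_(N in [set N | (N <= M)%N]) miss N.
have mmiss N : measurable (miss N).
  apply: measurableD; apply: measurable_lt.
    by apply: (meas_comp_cont (f := fun x => nr (x - u)) (mC CS)); exact: nr_continuous.
  apply: (meas_comp_cont (f := fun x => nr (iter N T x - v)) (mC CS')) => x.
  by apply: (@continuous_comp _ _ _ (iter N T) (fun y => nr (y - v)));
    [exact: iter_continuous|exact: nr_continuous].
have mE M : measurable (E M) by apply: bigcap_measurableType => N _.
have E0 : \bigcap_M E M = set0.
  rewrite -subset0 => w h; have [wu _] := h 0%N I 0%N (leqnn _).
  have [N hN] := hit w wu; have [_] := h N I N (leqnn _); exact.
have [M PM] : exists M, (P (E M) <= e%:E)%E.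
  have cv : (P \o E) n @[n --> \oo] --> P (\bigcap_M E M).
    apply: nonincreasing_cvg_mu => //.
    - exact: (le_lt_trans (probability_le1 P (mE _)) (ltry _)).
    - by rewrite E0.
    - move=> i j ij; apply/subsetPset => w h N Ni; apply: h.
      exact: leq_trans Ni ij.
  rewrite E0 measure0 in cv; apply: contrapT => /forallNP no.
  have : (e%:E <= 0)%E.
    apply: cvge_ge cv; apply: nearW => n.
    by rewrite leNgt; apply/negP => /ltW; exact: no.
  by rewrite lee_fin leNgt e0.
have [c c1 Tc] := continuous_nr_bounded cT.
have c0 : 0 < c by rewrite (lt_le_trans ltr01).
have iterc N y : (N <= M)%N -> nr (iter N T y) <= c ^+ M * nr y.
  move=> NM; apply: (@le_trans _ _ (c ^+ N * nr y)).
    elim: N {NM} => [|N IH]; first by rewrite expr0 mul1r.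
    by rewrite /= exprS -mulrA (le_trans (Tc _))// ler_wpM2l// ltW.
  by rewrite ler_wpM2r ?nr_ge0// ler_weXn2l.
have cM : 0 < c ^+ M by rewrite exprn_gt0.
(* The iterates up to M expand distances by at most c^M, so a displacement of 2 e' costs at most
   [delta], turning 2 delta into 3 delta. *)
pose e' := Num.min (e / 2) (delta / (2 * c ^+ M)).
have e'0 : 0 < e' by rewrite lt_min !divr_gt0// mulr_gt0.
exists S', e', (A `|` E M); split => //.
- by rewrite e'0 ge_min lexx.
- exact: measurableU.
- rewrite mulrDl mul1r EFinD; apply: le_trans (measureU2 P mA (mE M)) _.
  exact: leeD.
move=> w /not_orP[nA nE]; split; first exact: SA.
move=> wu y yS'.
have [N NM hN] : exists2 N, (N <= M)%N & nr (iter N T (S' w) - v) < 2 * delta.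
  apply: contrapT => no; apply: nE => N NM; split => // hN; apply: no; by exists N.
exists N; apply: le_lt_trans (nr_trans (iter N T (S' w)) _ _) _.
have : nr (iter N T y - iter N T (S' w)) <= delta; last by lra.
rewrite -iterN_lin -iterD_lin; apply: le_trans (iterc _ _ NM) _.
apply: (@le_trans _ _ (c ^+ M * (2 * e'))); first by rewrite ler_wpM2l// ltW.
have : e' <= delta / (2 * c ^+ M) by rewrite ge_min lexx orbT.
by rewrite ler_pdivlMr ?mulr_gt0//; lra.
Qed.

Lemma scheme_limit S0 (eps : R) : C S0 -> 0 < eps ->
  exists S : Om -> X, [/\ measurable_fun setT (S : Om -> borel X),
    exists A, [/\ measurable A, (P A <= eps%:E)%E & forall w, ~ A w -> nr (S w - S0 w) <= eps],
    exists (Sk : nat -> Om -> X) (G : set Om), [/\ forall k, C (Sk k), measurable G,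
      P G = 1%E & forall w, G w -> Sk k w @[k --> \oo] --> S w] &
    P (S @^-1` HC T) = 1%E].
Proof.
move=> CS0 eps0.
(* Two indices for u and v, one for the tolerance, and a fourth one without meaning: through it
   every target recurs at arbitrarily late stages. *)
pose tgt k := @unpickle_dflt (nat * nat * nat * nat)%type (0, 0, 0, 0)%N k.
pose u k := D (tgt k).1.1.1; pose v k := D (tgt k).1.1.2.
pose de k : R := (tgt k).1.2.+1%:R^-1.
have de0 k : 0 < de k by rewrite invr_gt0.
pose good k (s : (Om -> X) * R) (t : (Om -> X) * R * set Om) :=
  [/\ C t.1.1, 0 < t.1.2 <= s.2 / 2, measurable t.2, (P t.2 <= (2 * s.2)%:E)%E &
    forall w, ~ t.2 w -> nr (t.1.1 w - s.1 w) <= s.2 /\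
      (nr (s.1 w - u k) < de k -> forall y, nr (y - t.1.1 w) <= 2 * t.1.2 ->
        exists N, nr (iter N T y - v k) < 3 * de k)].
have /choice[F hF] : forall ks : nat * ((Om -> X) * R), exists t, C ks.2.1 -> 0 < ks.2.2 -> good ks.1 ks.2 t.
  move=> [k [S e]]; have [[CS e0]|no] := pselect (C S /\ 0 < e); last first.
    by exists (S, e, set0) => CS e0; case: no.
  have [S' [e' [A [h1 h2 h3 h4 h5]]]] := scheme_step (u k) (v k) CS e0 (de0 k).
  by exists (S', e', A) => _ _; split.
(* Starting from eps / 8, the exceptional events have total probability at most eps / 2 and the
   displacements add up to at most eps / 4. *)
pose st := fix st k := if k is k'.+1 then (F (k', st k')).1 else (S0, eps / 8).
have st_ok k : C (st k).1 /\ 0 < (st k).2.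
  elim: k => [|k [IH1 IH2]] /=; first by rewrite divr_gt0.
  by have [? /andP[]] := hF (k, st k) IH1 IH2.
pose S k := (st k).1; pose e k := (st k).2; pose A k := (F (k, st k)).2.
have step k : good k (st k) (F (k, st k)).
  by have [h1 h2] := st_ok k; exact: (hF (k, st k) h1 h2).
have CS k : C (S k) by case: (st_ok k).
have e0 k : 0 < e k by case: (st_ok k).
have eh k : e k.+1 <= e k / 2 by case: (step k) => _ /andP[].
have mA k : measurable (A k) by case: (step k).
have ek k : e k <= eps / 8 / 2 ^+ k.
  elim: k => [|k IH]; first by rewrite expr0 divr1.
  rewrite exprS invfM mulrCA; have := eh k; lra.
have PA k : (P (A k) <= (eps / 2 / 2 ^+ k.+1)%:E)%E.
  case: (step k) => _ _ _ h _; apply: le_trans h _; rewrite lee_fin.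
  have := ek k; rewrite exprS invfM -/(e k); lra.
have eps2 : 0 <= eps / 2 by rewrite divr_ge0// ltW.
have [mG PG] := eventually_notin eps2 mA PA.
set G := [set w | _] in mG PG.
have lim w K : (forall k, (K <= k)%N -> ~ A k w) ->
    exists2 l, S k w @[k --> \oo] --> l & forall k, (K <= k)%N -> nr (l - S k w) <= 2 * e k.
  move=> h; apply: geometric_cvg => // k Kk.
  by case: (step k) => _ _ _ _ /(_ w (h _ Kk))[].
(* Off G the limit is set to 0, so that [L] is defined everywhere and measurable. *)
have /choice[L hL] : forall w, exists l, (G w -> S k w @[k --> \oo] --> l) /\ (~ G w -> l = 0).
  move=> w; have [Gw|nG] := pselect (G w); last by exists 0.
  by case: (Gw) => K /lim[l Sl _]; exists l.
have LK w K : (forall k, (K <= k)%N -> ~ A k w) ->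
    forall k, (K <= k)%N -> nr (L w - S k w) <= 2 * e k.
  move=> h; have [l Sl lk] := lim w K h.
  have Gw : G w by exists K.
  by rewrite (cvg_unique _ ((hL w).1 Gw) Sl).
have mL : measurable_fun setT (L : Om -> borel X).
  apply: (borel_measurable_nr hD) => n.
  pose f k w : R := if w \in G then nr (S k w - D n) else nr (0 - D n).
  apply: (@measurable_fun_cvg _ _ _ setT f).
    move=> k; apply: measurable_fun_ifT => //.
      by apply: (measurable_fun_bool true); rewrite setTI preimage_mem_true.
    by apply: (meas_comp_cont (f := fun x => nr (x - D n)) (mC (CS k))); exact: nr_continuous.
  move=> w _; rewrite /f; case: (boolP (w \in G)) => [/set_mem Gw|/negP nG].
    by apply: cvg_nr; exact: (hL w).1.
  rewrite (hL w).2; first exact: cvg_cst.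
  by move=> Gw; apply: nG; rewrite inE.
exists L; split => //.
- exists (\bigcup_k A k); split; first exact: bigcupT_measurable.
    apply: le_trans (prob_bigcup_geometric eps2 mA PA) _.
    by rewrite lee_fin; lra.
  move=> w nA; have : forall k, (0 <= k)%N -> ~ A k w by move=> k _ Ak; apply: nA; exists k.
  move=> /LK /(_ 0%N isT) => h; apply: le_trans h _; rewrite /e /=; lra.
- by exists S, G; split => // w; case: (hL w).
apply/eqP; rewrite eq_le; apply/andP; split.
  apply: probability_le1; rewrite -[_ @^-1` _]setTI; apply: mL => //; exact: (measurable_HC cT hD).
rewrite -PG; apply: le_measure; rewrite ?inE//.
  by rewrite -[_ @^-1` _]setTI; apply: mL => //; exact: (measurable_HC cT hD).
(* To enter O near x, aim at some [D j] near x. [L w] is close to some [D i], and at a late stage k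
   devoted to (i, j, p) so is [S k w], within 1/(p + 1). Since [L w] is within 2 e (k + 1) of
   [S k.+1 w], one of its iterates comes within 3/(p + 1) < r / 2 of [D j]. *)
move=> w [K hK]; rewrite /= => O [x Ox] oO.
have /nbhs_nrP[r r0 rO] : nbhs x O by exact: open_nbhs_nbhs.
have r2 : 0 < r / 2 by rewrite divr_gt0.
have [j jx] := hD x r2.
have [p pr] : exists p : nat, p.+1%:R^-1 < r / 6 by apply: exists_invS_lt; rewrite divr_gt0.
have p0 : (0 : R) < p.+1%:R^-1 / 2 by rewrite divr_gt0.
have [i iL] := hD (L w) p0.
have [K' hK'] : exists K', eps / 4 / 2 ^+ K' < p.+1%:R^-1 / 2.
  exact: exists_pow2_lt.
have [m hm] : exists m : nat, (maxn K K' <= pickle (i, j, p, m))%N.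
  apply: (injective_unbounded (f := fun m => pickle (i, j, p, m))).
  by move=> m m' /(pcan_inj pickleK)[].
set k := pickle _ in hm; move: hm; rewrite geq_max => /andP[Kk K'k].
have tk : tgt k = (i, j, p, m) by rewrite /tgt unpickle_dfltK.
have uk : u k = D i by rewrite /u tk.
have vk : v k = D j by rewrite /v tk.
have dk : de k = p.+1%:R^-1 by rewrite /de tk.
have ek2 : 2 * e k < p.+1%:R^-1 / 2.
  apply: le_lt_trans hK'; apply: (@le_trans _ _ (eps / 4 / 2 ^+ k)).
    by have := ek k; lra.
  rewrite ler_wpM2l ?divr_ge0 ?(ltW eps0)// lef_pV2 ?posrE ?exprn_gt0//.
  by rewrite ler_weXn2l// ler1n.
have [_ hit] : nr (S k.+1 w - S k w) <= e k /\ (nr (S k w - u k) < de k ->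
    forall y, nr (y - S k.+1 w) <= 2 * e k.+1 -> exists N, nr (iter N T y - v k) < 3 * de k).
  by case: (step k) => _ _ _ _ /(_ w (hK _ Kk)).
have [] := hit _ (L w).
- rewrite uk dk; apply: le_lt_trans (nr_trans (L w) _ _) _.
  rewrite [ltRHS]splitr; apply: ltrD; rewrite nrBC//.
  exact: le_lt_trans (LK w K hK k Kk) ek2.
- by apply: LK hK _ _; exact: leqW.
move=> N; rewrite vk dk => hN; exists (iter N T (L w)); split; last by exists N.
apply: rO; apply: le_lt_trans (nr_trans (D j) _ _) _.
rewrite [ltRHS]splitr; apply: ltrD => //; apply: lt_trans hN _.
by move: pr; set q := _^-1; lra.
Qed.

End scheme.

(** * From the limit scheme to density *)

Section assembly.
Context (R : realType) (X : completeNormedModType R[i]) (T : {linear X -> X}).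
Hypothesis cT : continuous T.
Variable D : nat -> X.
Hypothesis hD : forall x (e : R), 0 < e -> exists n, nr (D n - x) < e.

(** [scheme_limit] with errors 2^-(k+1) gives vectors that converge almost surely to [S0], so some
    law among theirs lies in the prescribed neighbourhood of m. That law comes from an almost sure
    limit of members of [C], hence is in the closure of [MM]. *)
Lemma scheme_closure (MM : set (Prob X R)) (m : Prob X R)
    d (Om : measurableType d) (P : probability Om R) (C : set (Om -> X)) S0 :
  (forall S, C S -> measurable_fun setT (S : Om -> borel X)) ->
  (forall S (u v : X) (e delta : R), C S -> 0 < e -> 0 < delta ->
    exists S', [/\ C S',
      exists A, [/\ measurable A, (P A <= e%:E)%E &
        forall w, ~ A w -> nr (S' w - S w) <= e] &
      forall w, nr (S w - u) < delta ->
        exists N, nr (iter N T (S' w) - v) < 2 * delta]) ->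
  (forall S (m' : Prob X R), C S ->
    (forall B : set (borel X), measurable B -> m' B = P (S @^-1` B)) -> MM m') ->
  C S0 -> (forall B : set (borel X), measurable B -> m B = P (S0 @^-1` B)) ->
  wclosure (wclosure MM `&` @probs_on X R (HC T)) m.
Proof.
move=> mC extC CM CS0 m0 U Um.
have c0 k : (0 : R) < 1 / 2 ^+ k.+1 by rewrite divr_gt0// exprn_gt0.
have /choice[S hS] := fun k => scheme_limit cT hD mC extC CS0 (c0 k).
have mS k : measurable_fun setT (S k : Om -> borel X) by case: (hS k).
have /choice[A hA] : forall k, exists A, [/\ measurable A, (P A <= (1 / 2 ^+ k.+1)%:E)%E &
    forall w, ~ A w -> nr (S k w - S0 w) <= 1 / 2 ^+ k.+1] by move=> k; case: (hS k).
have mA k : measurable (A k) by case: (hA k).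
have PA k : (P (A k) <= (1 / 2 ^+ k.+1)%:E)%E by case: (hA k).
have [mG PG] := eventually_notin ler01 mA PA.
set G := [set w | _] in mG PG.
have /choice[mm hmm] := fun k => law_exists P (mS k).
have [m' [m'0 m'int]] := law_exists P (mC _ CS0).
have mint f : bcontinuous f -> (\int[m]_x (f x)%:E = \int[P]_w (f (S0 w))%:E)%E.
  move=> bf; rewrite -m'int//; apply: eq_measure_integral => B mB _.
  by first [exact: (etrans (m0 _ mB) (esym (m'0 B)))|exact: (etrans (m'0 B) (esym (m0 _ mB)))].
have cS w : G w -> S k w @[k --> \oo] --> S0 w.
  move=> [K hK]; apply/cvg_nrP => e e0.
  have [p pe] := exists_invS_lt e0.
  exists (maxn K p) => k; rewrite geq_max => /andP[Kk pk].
  case: (hA k) => _ _ /(_ w (hK _ Kk)) /le_lt_trans; apply.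
  apply: le_lt_trans pe; rewrite div1r lef_pV2 ?posrE ?exprn_gt0// -natrX ler_nat.
  by rewrite (leq_trans _ (ltn_expl _ _))// ltnS ltnW.
have [K hK] := law_cvg mS (mC _ CS0) mG PG cS (fun k => (hmm k).2) mint Um.
exists (mm K); split; last exact: hK.
case: (hS K) => _ _ [Sk [G' [CSk mG' PG' cSk]]] PHC; split; last first.
  by rewrite /probs_on /= (hmm K).1.
move=> V Vm; have /choice[mk hmk] := fun k => law_exists P (mC _ (CSk k)).
have [K' hK'] := law_cvg (fun k => mC _ (CSk k)) (mS K) mG' PG' cSk (fun k => (hmk k).2) (hmm K).2 Vm.
exists (mk K'); split; last exact: hK'.
by apply: CM (CSk K') _ => B _; rewrite (hmk K').1.
Qed.

Lemma dense_Gdelta_scheme (MM : set (Prob X R)) :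
  MM `<=` wclosure (wclosure MM `&` @probs_on X R (HC T)) ->
  dense_Gdelta_in (wclosure MM `&` @probs_on X R (HC T)) (wclosure MM).
Proof.
move=> h; split; last exact: wclosure_idem.
have [U [oU hU]] := probs_HC_Gdelta cT hD.
by exists U; rewrite hU.
Qed.

End assembly.

(** * The circle parametrised by [expi2pi] *)

Section expi.
Context (R : realType).
Local Notation e := (@expi2pi R).

Lemma expiD (a b : R) : e (a + b) = e a * e b.
Proof.
by rewrite /expi2pi mulrDr cosD sinD; apply/eqP; rewrite eq_complex /= eqxx /= addrC.
Qed.

Lemma expi0 : e 0 = 1.
Proof. by rewrite /expi2pi mulr0 cos0 sin0. Qed.

Lemma expi1 : e 1 = 1.
Proof.
rewrite /expi2pi mulr1 mulr_natl mulr2n cosDpi sinDpi cospi sinpi opprK oppr0.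
by [].
Qed.

Lemma nc_expi (t : R) : nc (e t) = 1.
Proof.
apply/eqP; rewrite -sqrp_eq1 ?nc_ge0// nc_sqr /=.
by rewrite cos2Dsin2.
Qed.

Lemma expiX (n : nat) (t : R) : e (n%:R * t) = e t ^+ n.
Proof.
elim: n => [|n IH]; first by rewrite mul0r expi0 expr0.
by rewrite -natr1 mulrDl mul1r expiD IH exprSr.
Qed.

Lemma expi_nat (n : nat) : e n%:R = 1.
Proof. by rewrite -[n%:R]mulr1 expiX expi1 expr1n. Qed.

Lemma expi_int (p : int) : e p%:~R = 1.
Proof.
case: p => n; first exact: expi_nat.
by rewrite NegzE rmorphN /= -[LHS]mulr1 -{1}(expi_nat n.+1) -expiD addNr expi0.
Qed.

Lemma expi_shift (p : int) (t : R) : e (t - p%:~R) = e t.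
Proof. by rewrite -{2}(subrK p%:~R t) [RHS]expiD expi_int mulr1. Qed.

Lemma expi_near1 (ep : R) : 0 < ep ->
  exists2 k : R, 0 < k & forall t, nearZ k t -> nc (e t - 1) < ep.
Proof.
move=> ep0.
have c : continuous (fun t : R => cos (2 * pi * t)).
  move=> t; apply: (@continuous_comp _ _ _ (fun t => 2 * pi * t) cos); last exact: continuous_cos.
  exact: mulrl_continuous.
have s : continuous (fun t : R => sin (2 * pi * t)).
  move=> t; apply: (@continuous_comp _ _ _ (fun t => 2 * pi * t) sin); last exact: continuous_sin.
  exact: mulrl_continuous.
have e2 : 0 < ep / 2 by rewrite divr_gt0.
have /cvgrPdist_lt/(_ _ e2)/nbhs_ballP[k1 /= k10 h1] := c 0.
have /cvgrPdist_lt/(_ _ e2)/nbhs_ballP[k2 /= k20 h2] := s 0.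
exists (Num.min k1 k2); first by rewrite lt_min k10.
move=> t [p]; rewrite lt_min => /andP[t1 t2]; rewrite -(expi_shift p).
set z := t - _ in t1 t2 *.
have {}h1 := h1 z; have {}h2 := h2 z; rewrite /= mulr0 cos0 in h1; rewrite /= mulr0 sin0 in h2.
have {}h1 : `|1 - cos (2 * pi * z)| < ep / 2 by apply: h1; rewrite -ball_normE /= sub0r normrN.
have {}h2 : `|0 - sin (2 * pi * z)| < ep / 2 by apply: h2; rewrite -ball_normE /= sub0r normrN.
rewrite -(ltr_pXn2r (ltn0Sn 1)) ?nnegrE ?nc_ge0 ?(ltW ep0)//.
rewrite nc_sqr /expi2pi /= -(real_normK (num_real _)) -[in X in _ + X](real_normK (num_real _)).
rewrite distrC in h1; rewrite sub0r normrN in h2.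
have -> : sin (2 * pi * z) + - 0 = sin (2 * pi * z) by rewrite subr0.
have := normr_ge0 (cos (2 * pi * z) - 1); have := normr_ge0 (sin (2 * pi * z)).
nra.
Qed.

Lemma expi_surj (z : R[i]) : nc z = 1 -> exists t, z = e t.
Proof.
move=> z1; have := nc_sqr z; rewrite z1 expr1n; case: z {z1} => a b /= ab.
have a1 : -1 <= a <= 1 by apply/andP; split; have := sqr_ge0 b; nra.
have pi0 := @pi_gt0 R.
have ca : cos (acos a) = a by apply: acosK; rewrite in_itv /= .
have sa : sin (acos a) ^+ 2 = b ^+ 2.
  by have := cos2Dsin2 (acos a); rewrite ca; lra.
have ex y : cos y = a -> sin y = b -> exists t, Complex a b = e t.
  move=> cy sy; exists (y / (2 * pi)); rewrite /expi2pi mulrC divfK ?cy ?sy//.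
  by rewrite mulf_neq0// ?gt_eqF// pnatr_eq0.
move/eqP: sa; rewrite eqf_sqr => /orP[] /eqP sb; first exact: (ex (acos a)).
by apply: (ex (- acos a)); rewrite ?cosN// sinN sb opprK.
Qed.

Lemma expi_scale_continuous (X : normedModType R[i]) (x : X) :
  continuous (fun t => e t *: x).
Proof.
move=> t A /nbhs_nrP[ep ep0 h].
have x1 : 0 < nr x + 1 by rewrite ltr_wpDl ?nr_ge0.
have [k k0 hk] := expi_near1 (divr_gt0 ep0 x1).
apply/nbhs_ballP; exists k => // s; rewrite -ball_normE /= => ts; apply: h.
rewrite -scalerBl nrZ.
have -> : nc (e s - e t) = nc (e (s - t) - 1).
  have -> : e s - e t = (e (s - t) - 1) * e t by rewrite mulrBl mul1r -expiD subrK.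
  by rewrite ncM nc_expi mulr1.
have : nc (e (s - t) - 1) < ep / (nr x + 1).
  by apply: hk; exists 0; rewrite subr0 distrC.
rewrite ltr_pdivlMr// => h1; apply: le_lt_trans h1.
by rewrite ler_wpM2l ?nc_ge0// lerDl.
Qed.

End expi.

(** * Vectors near eigenvectors of uncountably many eigenvalues *)

Section good_vectors.
Context (R : realType) (X : normedModType R[i]) (T : {linear X -> X}).
Local Notation e := (@expi2pi R).
Hypothesis cT : continuous T.

Definition near_eigenvalues (g : X) (ep : R) : set R[i] :=
  [set l | nc l = 1 /\ exists y, [/\ y != 0, T y = l *: y & nr (y - g) < ep]].

(* Perfect spanning leaves only countably many eigenvalues to discard, so the eigenvectors
   that remain are good: near them there are eigenvectors for uncountably many eigenvalues. *)
Definition good (g : X) := forall ep : R, 0 < ep -> ~ countable (near_eigenvalues g ep).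

Lemma good_span (D : nat -> X) :
  (forall x (ep : R), 0 < ep -> exists n, nr (D n - x) < ep) ->
  perfectly_spanning T -> forall w (ep : R), 0 < ep -> exists s : seq X,
    (forall g, g \in s -> good g) /\ nr (w - \sum_(g <- s) g) < ep.
Proof.
move=> hD ps w ep ep0.
pose L (np : nat * nat) := near_eigenvalues (D np.1) np.2.+1%:R^-1.
(* E collects the eigenvalues seen from those balls around the [D n] that see only countably many. A
   nonzero eigenvector that is not good has its eigenvalue in E, so spanning off E uses good
   vectors. *)
pose E := \bigcup_(np in [set np | countable (L np)]) L np.
have cE : countable E by apply: bigcup_countable.
have := ps E cE; rewrite eqEsubset => -[_ /(_ w I)] /closure_nrP/(_ _ ep0)[v [n [a [x [hx ->]]]] hw].
pose f (i : 'I_n) := a i *: x i.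
(* Zero terms are dropped: a summand must itself witness its eigenvalue in [near_eigenvalues], which
   asks for nonzero vectors. *)
exists [seq f i | i <- enum 'I_n & f i != 0]; split; last first.
  rewrite nrBC big_map big_filter big_enum_cond /= (_ : \sum_(_ | _) _ = \sum_i f i)//.
  rewrite [RHS](bigID (fun i => f i != 0)) /= [X in _ = _ + X]big1 ?addr0//.
  by move=> i; rewrite negbK => /eqP.
move=> g gs; have [i ifn ->] := seq.mapP gs; move: ifn; rewrite mem_filter => /andP[fi _] r r0 cn.
have [l [l1 nE] hl] := hx i.
have r2 : 0 < r / 2 by rewrite divr_gt0.
have [p pr] := exists_invS_lt r2.
have p0 : (0 : R) < p.+1%:R^-1 by rewrite invr_gt0.
have [k hk] := hD (f i) _ p0.
apply: nE; exists (k, p).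
  apply: sub_countable cn; apply: subset_card_le => l' [l'1 [y [y0 Ty yk]]]; split => //.
  exists y; split => //; apply: le_lt_trans (nr_trans (D k) _ _) _.
  rewrite (splitr r) ltrD//; [exact: lt_trans yk pr|exact: lt_trans hk pr].
split; first exact/nc1P.
exists (f i); split => //; last by rewrite nrBC.
by rewrite /f linearZ /= hl !scalerA mulrC.
Qed.

Lemma pick_unimodular g (ep : R) (E : set R) : good g -> 0 < ep -> countable E ->
  exists y t, [/\ y != 0, T y = e t *: y, nr (y - g) < ep & ~ E t].
Proof.
move=> gg ep0 cE; apply: contrapT => no; apply: (gg _ ep0).
apply: (@sub_countable _ _ _ [set e t | t in E]); last first.
  exact: card_le_trans (card_image_le _ _) cE.
apply: subset_card_le => l [l1 [y [y0 Ty yg]]].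
have [t lt] := expi_surj l1; exists t => //; apply: contrapT => nE.
by apply: no; exists y, t; rewrite -lt.
Qed.

(** T y - a y is nonzero for each a in s and depends continuously on y. So the eigenvalue stays off
    s when an eigenvector is replaced by a nearby periodic one. *)
Lemma eigenvalue_avoid y (l : R[i]) (s : seq R[i]) : y != 0 -> T y = l *: y -> l \notin s ->
  exists2 de : R, 0 < de & forall y', nr (y' - y) < de -> forall a, a \in s -> T y' <> a *: y'.
Proof.
move=> y0 Ty; have [C C1 hC] := continuous_nr_bounded cT.
elim: s => [|a s IH]; first by exists 1.
rewrite inE negb_or => /andP[la /IH[de de0 hde]].
have z0 : 0 < nr (T y - a *: y).
  by rewrite Ty -scalerBl; apply: nr_gt0; rewrite scaler_eq0 negb_or subr_eq0 la.
have c0 : 0 < C + nc a by rewrite ltr_pwDl ?nc_ge0// (lt_le_trans ltr01).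
exists (Num.min de (nr (T y - a *: y) / (C + nc a))).
  by rewrite lt_min de0 divr_gt0.
move=> y'; rewrite lt_min => /andP[h1 h2] b; rewrite inE => /orP[/eqP ->|]; last exact: hde.
move=> Ty'; move: h2; rewrite ltr_pdivlMr// => h2; move: (lt_irreflexive (nr (T y - a *: y))).
suff -> : nr (T y - a *: y) < nr (T y - a *: y) by [].
apply: le_lt_trans h2.
have -> : T y - a *: y = T (y - y') - a *: (y - y').
  by rewrite linearB /= scalerBr Ty' opprB addrA subrK.
apply: le_trans (nrD _ _) _; rewrite nrN nrZ mulrDr nrBC (mulrC _ C).
by rewrite lerD// ?hC// 1?nrBC 1?mulrC//.
Qed.

Lemma pick_periodic g (ep : R) (s : seq R[i]) : periodic_dense T -> good g -> 0 < ep ->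
  exists y l N, [/\ (0 < N)%N, l ^+ N = 1, T y = l *: y, nr (y - g) < ep & l \notin s].
Proof.
move=> pd gg ep0.
have [l [l1 [y [y0 Ty yg]]] ls] : exists2 l, near_eigenvalues g ep l & l \notin s.
  apply: contrapT => no; apply: (gg _ ep0).
  apply: (@sub_countable _ _ _ [set` s]); last exact: finite_set_countable.
  apply: subset_card_le => l hl; apply: contrapT => /negP ls; apply: no.
  by exists l.
have [de de0 hde] := eigenvalue_avoid y0 Ty ls.
have : closure (periodic_eigenvector T) y.
  by apply: pd; split => //; exists l; split => //; exact/nc1P.
move=> /closure_nrP /(_ (Num.min de (ep - nr (y - g))))[].
  by rewrite lt_min de0 subr_gt0.
move=> y' [y'0 [l' [N [N0 [lN Ty']]]]]; rewrite lt_min => /andP[h1 h2].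
exists y', l', N; split => //.
  by apply: le_lt_trans (nr_trans y _ _) _; lra.
by apply/negP => /(hde _ h1).
Qed.

End good_vectors.

(** * Periodic perturbations that are small on average *)

Section sums.
Context (R : realType).

Lemma sum_periodic (f : nat -> R) N q : (forall n, f (n + N)%N = f n) ->
  \sum_(n < N * q) f n = q%:R * \sum_(n < N) f n.
Proof.
move=> fN; elim: q => [|q IH]; first by rewrite muln0 big_ord0 mul0r.
rewrite mulnSr -(big_mkord xpredT f) (@big_cat_nat _ _ _ (N * q)) ?leq_addr//=.
rewrite big_mkord IH -{1}[(N * q)%N]add0n big_addn addKn big_mkord -natr1 mulrDl mul1r.
congr (_ + _); apply: eq_bigr => i _.
have {}fN m : f (i + N * m)%N = f i.
  by elim: m => [|m IHm]; rewrite ?muln0 ?addn0// mulnSr addnA fN.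
exact: fN.
Qed.

Lemma sum_reindex (pi : nat -> nat) M (F : nat -> R) :
  (forall j, (j < M)%N -> (pi j < M)%N) ->
  (forall i j, (i < M)%N -> (j < M)%N -> pi i = pi j -> i = j) ->
  \sum_(j < M) F (pi j) = \sum_(j < M) F j.
Proof.
move=> piM piI; pose h (j : 'I_M) := Ordinal (piM j (ltn_ord j)).
have hI : injective h by move=> i j [] /(piI _ _ (ltn_ord i) (ltn_ord j)) /val_inj.
by rewrite [RHS](reindex_inj hI).
Qed.

(** Parseval for characters of Z/N: if m and m' are distinct, m times the conjugate of m' is an N-th
    root of unity other than 1, so its powers sum to 0 and only the diagonal remains. *)
Lemma roots_orthogonal (N : nat) (ms : seq R[i]) : (0 < N)%N -> uniq ms ->
  (forall m, m \in ms -> m ^+ N = 1) ->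
  \sum_(n < N) nc (\sum_(m <- ms) m ^+ n) ^+ 2 = N%:R * (size ms)%:R.
Proof.
move=> N0 ums msN; apply: complexI.
have nm m : m \in ms -> m * m^*%C = 1.
  move=> /msN mN; rewrite -sqr_normc.
  have : `|m| ^+ N == 1 by rewrite -normrX mN normr1.
  by rewrite pexpr_eq1// => /eqP ->; rewrite expr1n.
rewrite rmorph_sum /= rmorphM /= !rmorph_nat.
transitivity (\sum_(n < N) \sum_(m <- ms) \sum_(m' <- ms) m ^+ n * (m' ^+ n)^*%C).
  apply: eq_bigr => n _; rewrite rmorphXn /= -ncE sqr_normc rmorph_sum /= mulr_suml.
  by apply: eq_bigr => m _; rewrite mulr_sumr.
rewrite exchange_big /=.
transitivity (\sum_(m <- ms) (N%:R : R[i])); last first.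
  by rewrite big_const_seq count_predT iter_addr_0 mulr_natr.
apply: eq_big_seq => m mms; rewrite exchange_big /=.
rewrite (bigD1_seq m)//= [X in _ + X]big1_seq ?addr0.
  under eq_bigr => n _ do rewrite rmorphXn /= -exprMn (nm _ mms) expr1n.
  by rewrite sumr_const card_ord.
move=> m' /andP[m'm m'ms].
under eq_bigr => n _ do rewrite rmorphXn /= -exprMn.
set r := m * _.
have r1 : r != 1.
  apply/negP => /eqP rE; move/negP: m'm; apply; apply/eqP.
  have : m * m'^*%C = m' * m'^*%C by rewrite -/r rE nm.
  move/mulIf => -> //; apply/negP => /eqP z.
  by have := nm _ m'ms; rewrite z mulr0 => /eqP; rewrite eq_sym oner_eq0.
have rN : r ^+ N = 1 by rewrite /r exprMn -rmorphXn /= !msN// rmorph1 mulr1.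
apply/eqP; have := subrX1 r N; rewrite rN subrr => /esym/eqP.
by rewrite mulf_eq0 subr_eq0 (negPf r1) /=.
Qed.

End sums.

Section periodic_block.
Context (R : realType) (X : normedModType R[i]) (T : {linear X -> X}).
Hypothesis cT : continuous T.
Hypothesis pd : periodic_dense T.

(** Only the average over a period can be small, since b itself has to be close to a prescribed
    vector. *)
Definition avg_small (b : X) (ep : R) :=
  exists N, [/\ (0 < N)%N, iter N T b = b & \sum_(n < N) nr (iter n T b) <= ep * N%:R].

Lemma picks_periodic g (de : R) L : good T g -> 0 < de -> exists s : seq (X * R[i] * nat),
  [/\ size s = L, uniq [seq p.1.2 | p <- s] & forall p, p \in s ->
    [/\ (0 < p.2)%N, p.1.2 ^+ p.2 = 1, T p.1.1 = p.1.2 *: p.1.1 & nr (p.1.1 - g) < de]].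
Proof.
move=> gg de0; elim: L => [|L [s [sL us hs]]]; first by exists [::].
have [y [l [N [N0 lN Ty yg ls]]]] := pick_periodic cT [seq p.1.2 | p <- s] pd gg de0.
exists ((y, l, N) :: s); split=> /=; [by rewrite sL|by rewrite ls|].
by move=> p; rewrite inE => /predU1P[->|/hs].
Qed.

(* [b] averages [L] periodic eigenvectors close to [g] with distinct eigenvalues; these are
   orthogonal characters of the period, so the orbit of [b] has mean square norm O(1/L). *)
Lemma periodic_group g (ep : R) : good T g -> 0 < ep ->
  exists2 b, nr (b - g) < ep & avg_small b ep.
Proof.
move=> gg ep0; pose A := nr g + 1.
have A0 : 0 < A by rewrite ltr_wpDl ?nr_ge0.
(* Parameter of |c| <= (t + |c|^2 / t) / 2, which bounds the mean of |c n| through its mean square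
   1/L. Approximating g costs ep / 2, A t / 2 equals ep / 4, and the choice of L makes A / (2 t L)
   at most ep / 4. *)
pose t := ep / (2 * A); have t0 : 0 < t by rewrite divr_gt0// mulr_gt0.
pose L := (Num.truncn (4 * A ^+ 2 / ep ^+ 2)).+1.
have hL : 4 * A ^+ 2 / ep ^+ 2 < L%:R by exact: truncnS_gt.
have L0 : (0 : R) < L%:R by rewrite ltr0n.
have ep2 : 0 < ep / 2 by rewrite divr_gt0.
have [s [sL us hs]] := picks_periodic L gg ep2.
pose N := (\prod_(p <- s) p.2)%N.
have N0 : (0 < N)%N.
  by rewrite /N big_seq prodn_cond_gt0// => p /hs[].
have sN p : p \in s -> p.1.2 ^+ N = 1.
  move=> ps; have [_ pN _ _] := hs p ps.
  have /dvdnP[q ->] : (p.2 %| N)%N by rewrite /N (big_rem p)//= dvdn_mulr.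
  by rewrite mulnC exprM pN expr1n.
have nm p : p \in s -> nc p.1.2 = 1.
  move=> /sN pN; apply/nc1P/eqP; rewrite -(@pexpr_eq1 _ _ N)// -normrX pN normr1//.
pose Li : R[i] := (L%:R^-1)%:C%C.
have nLi : nc Li = L%:R^-1 by rewrite nc_real// invr_ge0 ltW.
pose b := \sum_(p <- s) Li *: p.1.1.
have Tb n : iter n T b = Li *: \sum_(p <- s) p.1.2 ^+ n *: p.1.1.
  rewrite /b iter_sum_lin scaler_sumr; apply: eq_big_seq => p ps.
  by have [_ _ Tp _] := hs p ps; rewrite iterZ_lin (iter_eigen _ Tp).
pose c n := Li * \sum_(p <- s) p.1.2 ^+ n.
have Tbg n : nr (iter n T b - c n *: g) <= ep / 2.
  have -> : iter n T b - c n *: g = Li *: \sum_(p <- s) p.1.2 ^+ n *: (p.1.1 - g).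
    rewrite Tb /c -scalerA -scalerBr; congr (_ *: _).
    by rewrite scaler_suml -sumrB; apply: eq_bigr => p _; rewrite scalerBr.
  rewrite nrZ nLi ler_pdivrMl//.
  apply: le_trans (nr_sum _ _ _) _.
  apply: (@le_trans _ _ (\sum_(p <- s) ep / 2)); last first.
    by rewrite big_const_seq count_predT iter_addr_0 sL mulr_natl.
  rewrite big_seq [leRHS]big_seq; apply: ler_sum => p ps.
  have [_ _ _ /ltW h] := hs p ps; rewrite nrZ.
  suff -> : nc (p.1.2 ^+ n) = 1 by rewrite mul1r.
  by elim: n => [|n IH]; rewrite ?expr0 ?exprS ?ncM ?nm ?IH ?mul1r// /nc normr1.
exists b.
  have := Tbg 0%N; rewrite /= /c; under eq_bigr do rewrite expr0.
  rewrite big_const_seq count_predT iter_addr_0 sL /Li.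
  have -> : (L%:R^-1)%:C%C * L%:R = 1 :> R[i].
    by rewrite -(rmorph_nat (real_complex R)) -rmorphM /= mulVf ?gt_eqF//.
  rewrite scale1r; lra.
exists N; split => //.
  rewrite Tb /b scaler_sumr; apply: eq_big_seq => p ps.
  by rewrite sN// scale1r.
apply: (@le_trans _ _ (\sum_(n < N) (ep / 2 + A * ((t + nc (c n) ^+ 2 / t) / 2)))).
  apply: ler_sum => n _.
  have h1 : nr (iter n T b) <= ep / 2 + nc (c n) * nr g.
    by rewrite -nrZ -[iter n T b](subrK (c n *: g)) (le_trans (nrD _ _))// lerD.
  apply: le_trans h1 _; rewrite lerD2l.
  apply: (@le_trans _ _ (A * nc (c n))).
    by rewrite mulrC ler_wpM2r ?nc_ge0// lerDl.
  rewrite ler_wpM2l ?(ltW A0)// ler_pdivlMr//.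
  rewrite -(ler_pM2r t0) mulrDl divfK ?gt_eqF//.
  by have := sqr_ge0 (nc (c n) - t); rewrite sqrrB; lra.
rewrite big_split /= sumr_const card_ord -mulr_sumr -mulr_suml big_split /=.
rewrite sumr_const card_ord -mulr_suml.
have -> : \sum_(n < N) nc (c n) ^+ 2 = N%:R / L%:R.
  under eq_bigr do rewrite /c ncM exprMn nLi.
  rewrite -mulr_sumr.
  have -> : \sum_(n < N) nc (\sum_(p <- s) p.1.2 ^+ n) ^+ 2 = N%:R * L%:R.
    rewrite -sL -(size_map (fun p => p.1.2) s) -roots_orthogonal//.
      by apply: eq_bigr => n _; rewrite big_map.
    by move=> m /mapP[p ps ->]; exact: sN.
  by rewrite expr2; field; rewrite gt_eqF.
rewrite -[_ *+ N]mulr_natr -[t *+ N]mulr_natr.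
have NR : (0 : R) < N%:R by rewrite ltr0n.
have -> : ep / 2 * N%:R + A * ((t * N%:R + N%:R / L%:R / t) / 2) =
  (ep / 2 + A * ((t + L%:R^-1 / t) / 2)) * N%:R by field; rewrite !gt_eqF.
rewrite ler_pM2r//.
have -> : A * ((t + L%:R^-1 / t) / 2) = ep / 4 + A ^+ 2 / ep / L%:R.
  by rewrite /t; field; rewrite !gt_eqF.
have : A ^+ 2 / ep / L%:R <= ep / 4; last by lra.
rewrite ler_pdivrMr// ler_pdivrMr//.
move: hL; rewrite ltr_pdivrMr ?exprn_gt0//; nra.
Qed.

Lemma avg_smallD b b' (ep ep' : R) : avg_small b ep -> avg_small b' ep' ->
  avg_small (b + b') (ep + ep').
Proof.
move=> [N [N0 bN hN]] [N' [N'0 bN' hN']]; exists (N * N')%N; split.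
- by rewrite muln_gt0 N0.
- rewrite iterD_lin; congr (_ + _).
    by rewrite mulnC -[(N' * N)%N]add0n (iter_periodic _ _ bN).
  by rewrite -[(N * N')%N]add0n (iter_periodic _ _ bN').
apply: (@le_trans _ _ (\sum_(n < N * N') (nr (iter n T b) + nr (iter n T b')))).
  by apply: ler_sum => n _; rewrite iterD_lin nrD.
rewrite big_split /= (sum_periodic (f := fun n => nr (iter n T b))); last first.
  by move=> n; rewrite -{1}(mul1n N) (iter_periodic _ _ bN).
have -> : \sum_(n < N * N') nr (iter n T b') = N%:R * \sum_(n < N') nr (iter n T b').
  rewrite mulnC (sum_periodic (f := fun n => nr (iter n T b')))// => n.
  by rewrite -{1}(mul1n N') (iter_periodic _ _ bN').
have : (0 : R) < N%:R by rewrite ltr0n. have : (0 : R) < N'%:R by rewrite ltr0n.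
rewrite natrM; nra.
Qed.

Lemma periodic_block (s : seq X) (ep : R) : (forall g, g \in s -> good T g) -> 0 < ep ->
  exists2 b, nr (b - \sum_(g <- s) g) < ep & avg_small b ep.
Proof.
elim: s ep => [|g s IH] ep hs ep0.
  exists 0; first by rewrite big_nil subrr nr0.
  by exists 1%N; split=> //=; rewrite ?linear0// big_ord1 /= nr0 mulr1 ltW.
have ep2 : 0 < ep / 2 by rewrite divr_gt0.
have [b1 h1 s1] : exists2 b, nr (b - \sum_(g <- s) g) < ep / 2 & avg_small b (ep / 2).
  by apply: IH => // g' g's; apply: hs; rewrite inE g's orbT.
have [b2 h2 s2] := periodic_group (hs g (mem_head _ _)) ep2.
exists (b2 + b1); last by rewrite [ep]splitr; exact: avg_smallD.
rewrite big_cons opprD addrACA; apply: le_lt_trans (nrD _ _) _.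
by rewrite [ltRHS]splitr ltrD.
Qed.

Lemma periodic_perturbation (D : nat -> X) w (ep : R) :
  (forall x (ep : R), 0 < ep -> exists n, nr (D n - x) < ep) ->
  perfectly_spanning T -> 0 < ep ->
  exists b N, [/\ (0 < N)%N, iter N T b = b, nr (b - w) < ep &
    \sum_(n < N) (ep < nr (iter n T b))%R%:R <= ep * N%:R].
Proof.
move=> hD ps ep0; have ep2 : 0 < ep / 2 by rewrite divr_gt0.
have [s [hs ws]] := good_span hD ps w ep2.
(* Markov: a mean norm of at most ep^2 leaves at most a proportion ep of the times with norm above
   ep. *)
pose de := Num.min (ep / 2) (ep ^+ 2).
have de0 : 0 < de by rewrite lt_min ep2 exprn_gt0.
have [b hb [N [N0 bN hN]]] := periodic_block hs de0.
exists b, N; split => //.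
  apply: le_lt_trans (nr_trans (\sum_(g <- s) g) _ _) _.
  rewrite [ltRHS]splitr ltrD//; last by rewrite nrBC.
  by apply: lt_le_trans hb _; rewrite ge_min lexx.
rewrite -(ler_pM2l ep0) mulr_sumr; apply: (@le_trans _ _ (\sum_(n < N) nr (iter n T b))).
  apply: ler_sum => n _; case: ltP => h; first by rewrite mulr1 ltW.
  by rewrite mulr0 nr_ge0.
apply: le_trans hN _; rewrite mulrA -expr2 ler_wpM2r//.
by rewrite ge_min lexx orbT.
Qed.

End periodic_block.

(** * Convex combinations, the uniform law and its cells *)

Section convex.
Context d (Y : measurableType d) (R : realType).

Lemma measure_probability (M : {measure set Y -> \bar R}) : M setT = 1%E ->
  exists P : probability Y R, forall A, P A = M A.
Proof.
move=> M1; exists (mnormalize M (dirac (point : Y))) => A.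
by rewrite /= /mnormalize M1 /= onee_eq0 /= invr1 mule1.
Qed.

Lemma convex_combination (k : nat) (c : nat -> R) (m : nat -> probability Y R) :
  (forall i, 0 <= c i) -> \sum_(i < k) c i = 1 ->
  exists P : probability Y R, forall A, P A = (\sum_(i < k) (c i)%:E * m i A)%E.
Proof.
move=> c0 c1; pose ms (i : nat) : {measure set Y -> \bar R} := mscale (NngNum (c0 i)) (m i).
pose M : {measure set Y -> \bar R} := msum ms k.
have ME A : M A = (\sum_(i < k) (c i)%:E * m i A)%E by [].
have M1 : M setT = 1%E.
  rewrite ME; under eq_bigr do rewrite probability_setT mule1.
  by rewrite sumEFin c1.
exact: measure_probability M1.
Qed.

End convex.

Section uniform.
Context (R : realType).
Local Notation leb := (@lebesgue_measure R).

(** Half-open, so that it is a disjoint union of N half-open cells of length 1/N for every N > 0. *)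
Lemma uniform_exists : exists U : probability (measurableTypeR R) R,
  forall A, U A = leb (A `&` `[0, 1[).
Proof.
have mI : measurable (`[0, 1[%classic : set (measurableTypeR R)) by exact: measurable_itv.
pose M : {measure set (measurableTypeR R) -> \bar R} := mrestr leb mI.
have M1 : M setT = 1%E.
  by rewrite /M /= /mrestr setTI lebesgue_measure_itv /= lte_fin ltr01 oppr0 adde0.
exact: measure_probability M1.
Qed.

Variable U : probability (measurableTypeR R) R.
Hypothesis UE : forall A, U A = leb (A `&` `[0, 1[).

Lemma measurable_truncn (c : R) (Q : set nat) :
  measurable [set t : measurableTypeR R | Q (Num.truncn (c * t))].
Proof.
have mge (j : nat) : measurable [set t : measurableTypeR R | (j <= Num.truncn (c * t))%N].
  case: j => [|j]; first by rewrite (_ : mkset _ = setT)//; apply/seteqP; split.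
  rewrite (_ : mkset _ = ~` [set t | c * t < j.+1%:R]).
    by apply: measurableC; apply: measurable_lt; exact: mulrl_measurable.
  by apply/seteqP; split => t /=; rewrite truncn_gt_nat leNgt => /negP.
rewrite (_ : mkset _ = \bigcup_j (if `[< Q j >] then
  [set t : measurableTypeR R | (j <= Num.truncn (c * t))%N] `\`
  [set t : measurableTypeR R | (j.+1 <= Num.truncn (c * t))%N] else set0)).
  apply: bigcupT_measurable => j; case: ifP => // _; exact: measurableD.
apply/seteqP; split => [t /= Qt|t [j _]].
  exists (Num.truncn (c * t)) => //; rewrite ifT; last exact/asboolP.
  by split => //=; rewrite ltnn.
case: ifP => // /asboolP Qj [/= h1 h2]; suff -> : Num.truncn (c * t) = j by [].
by apply/eqP; rewrite eqn_leq h1 andbT leqNgt; apply/negP.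
Qed.

Lemma uniform_cells (N : nat) (Q : pred nat) : (0 < N)%N ->
  U [set t | Q (Num.truncn (N%:R * t))] = ((\sum_(j < N) (Q j)%:R) / N%:R)%:E.
Proof.
move=> N0; have NR : (0 : R) < N%:R by rewrite ltr0n.
pose F (j : nat) : set (measurableTypeR R) :=
  if Q j then `[j%:R / N%:R, j.+1%:R / N%:R[%classic else set0.
have mF j : measurable (F j) by rewrite /F; case: ifP => // _; exact: measurable_itv.
have FE t j : (j < N)%N -> F j t <-> [/\ 0 <= t, t < 1, Q j & Num.truncn (N%:R * t) = j].
  move=> jN; rewrite /F; case: ifP => Qj; last by split => // -[].
  split.
    rewrite /= in_itv /= ler_pdivrMr// ltr_pdivlMr// mulrC => /andP[h1 h2].
    have t0 : 0 <= t by rewrite -(pmulr_rge0 _ NR) (le_trans _ h1).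
    split => //; first rewrite -(ltr_pM2l NR) mulr1 (lt_le_trans h2)// ler_nat//.
    by apply: truncn_def; rewrite h1.
  move=> [t0 t1 _ tj]; rewrite /= in_itv /= ler_pdivrMr// ltr_pdivlMr// mulrC -tj.
  by apply: truncn_itv; rewrite mulr_ge0// ltW.
rewrite UE (_ : _ `&` _ = \big[setU/set0]_(j < N) F j); last first.
  rewrite -bigcup_mkord; apply/seteqP; split => [t [/= Qt]|t [j /= jN /FE -/(_ jN)[t0 t1 Qj tj]]].
    rewrite in_itv /= => /andP[t0 t1].
    have tN : (Num.truncn (N%:R * t) < N)%N.
      rewrite -(ltr_nat R); apply: le_lt_trans (_ : N%:R * t < _).
        by rewrite truncn_le// mulr_ge0// ltW.
      by rewrite gtr_pMr.
    by exists (Num.truncn (N%:R * t)) => //; apply/FE.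
  by split; rewrite /= ?tj// in_itv /= t0.
rewrite measure_semi_additive_ord_I//; first last.
- by apply: bigsetU_measurable.
- move=> i j /= iN jN [t [/FE -/(_ iN)[_ _ _ <-] /FE -/(_ jN)[_ _ _ <-]]].
  by [].
rewrite (eq_bigr (fun j : 'I_N => ((Q j)%:R / N%:R)%:E)).
  by rewrite sumEFin mulr_suml.
move=> j _; rewrite /F; case: ifP => _; last by rewrite measure0 mul0r.
apply: (etrans (lebesgue_measure_itv _)); rewrite /= lte_fin ltr_pM2r ?invr_gt0// ltr_nat ltnSn.
by rewrite -EFinB -mulrBl -natr1 addrAC subrr add0r.
Qed.

End uniform.

Lemma image_probability (R : realType) d d' (Y : measurableType d) (Z : measurableType d')
    (P : probability Y R) (f : Y -> Z) : measurable_fun setT f ->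
  exists P' : probability Z R, forall A, P' A = P (f @^-1` A).
Proof.
move=> mf; pose fm : {mfun Y >-> Z} := HB.pack f (isMeasurableFun.Build _ _ _ _ f mf).
by exists (distribution P fm).
Qed.

Definition ext_ord (A : Type) (k : nat) (x0 : A) (f : 'I_k -> A) (i : nat) : A :=
  if insub i is Some j then f j else x0.

Lemma ext_ordE A k x0 (f : 'I_k -> A) (j : 'I_k) : ext_ord x0 f j = f j.
Proof. by rewrite /ext_ord valK. Qed.

(** Among N q cells, cell j lies in cell j / q of the coarser partition into N; this relates an
    odometer to its refinement. *)
Lemma truncn_divn (R : realType) (N q : nat) (t : R) : (0 < q)%N -> 0 <= t ->
  (Num.truncn ((N * q)%:R * t) %/ q)%N = Num.truncn (N%:R * t).
Proof.
move=> q0 t0; apply/esym/truncn_def; set j := Num.truncn _.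
have qR : (0 : R) < q%:R by rewrite ltr0n.
have /andP[h1 h2] : j%:R <= (N * q)%:R * t < j.+1%:R by apply: truncn_itv; rewrite mulr_ge0.
rewrite natrM mulrAC in h1 h2; apply/andP; split.
  rewrite -(ler_pM2r qR); apply: le_trans h1; rewrite -natrM ler_nat; exact: leq_divM.
rewrite -(ltr_pM2r qR); apply: lt_le_trans h2 _; rewrite -natrM ler_nat.
exact: ltn_ceil.
Qed.

Definition permn N (pi : nat -> nat) :=
  (forall j, (j < N)%N -> (pi j < N)%N) /\
  (forall i j, (i < N)%N -> (j < N)%N -> pi i = pi j -> i = j).

(* Mixed-radix digit reversal: it makes the odometer on [N * q] points extend
   the odometer on [N] points. *)
Definition perm_ext N q (pi : nat -> nat) j := (pi (j %/ q) + N * (j %% q))%N.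

(** Reduction modulo N recovers pi (j / q), hence j / q; what is left then recovers j modulo q. *)
Lemma permn_ext N q pi : (0 < q)%N -> permn N pi -> permn (N * q) (perm_ext N q pi).
Proof.
move=> q0 [piN piI].
have dN j : (j < N * q)%N -> (j %/ q < N)%N by rewrite ltn_divLR.
have modE j : (j < N * q)%N -> (perm_ext N q pi j %% N)%N = pi (j %/ q)%N.
  by move=> /dN/piN h; rewrite /perm_ext mulnC addnC modnMDl modn_small.
split=> [j jN|i j iN jN eij].
  have h1 := piN _ (dN _ jN); have h2 : (j %% q < q)%N by rewrite ltn_mod.
  by rewrite /perm_ext; nia.
have := congr1 (modn^~ N) eij; rewrite /= !modE// => h.
have dij := piI _ _ (dN _ iN) (dN _ jN) h.
move: eij; rewrite /perm_ext h => /addnI/eqP.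
rewrite eqn_pmul2l ?(leq_ltn_trans _ (dN _ iN))// => /eqP mij.
by rewrite (divn_eq i q) (divn_eq j q) dij mij.
Qed.

(** * Coupling periodic orbits on the unit interval *)

Section part_a.
Context (R : realType) (X : completeNormedModType R[i]) (T : {linear X -> X}).
Hypothesis cT : continuous T.
Variable D : nat -> X.
Hypothesis hD : forall x (e : R), 0 < e -> exists n, nr (D n - x) < e.
Hypothesis ps : perfectly_spanning T.
Hypothesis pd : periodic_dense T.
Variable U : probability (measurableTypeR R) R.
Hypothesis UE : forall A, U A = lebesgue_measure (A `&` `[0, 1[).

(** The cell of t selects a point of the orbit of a. By [orb_law] every permutation pi yields the
    same periodic measure, and this freedom is what couples the orbits of a and of a + b. *)
Definition orb N a (pi : nat -> nat) (t : measurableTypeR R) : X :=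
  iter (pi (Num.truncn (N%:R * t))) T a.

Lemma orb_measurable_pre N a pi (B : set X) : measurable [set t | B (orb N a pi t)].
Proof. exact: (measurable_truncn _ (fun j => B (iter (pi j) T a))). Qed.

Lemma orb_measurable N a pi : measurable_fun setT (orb N a pi : _ -> borel X).
Proof. by move=> _ B _; rewrite setTI; exact: orb_measurable_pre. Qed.

Lemma orb_law N a pi (B : set (borel X)) : (0 < N)%N -> permn N pi ->
  U [set t | B (orb N a pi t)] =
  (N%:R^-1%:E * \sum_(n < N) @dirac _ (borel X) (iter n T a) R B)%E.
Proof.
move=> N0 [piN piI].
pose Q j := `[< B (iter (pi j) T a) >].
have -> : [set t | B (orb N a pi t)] = [set t | Q (Num.truncn (N%:R * t))].
  by apply/seteqP; split => t /= /asboolP.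
rewrite uniform_cells//.
have -> : \sum_(j < N) (Q j)%:R = \sum_(j < N) (\1_B (iter j T a) : R).
  rewrite -(sum_reindex (fun j => \1_B (iter j T a)) piN piI).
  by apply: eq_bigr => j _; rewrite indicE.
by rewrite -mulrC EFinM -sumEFin; congr (_ * _)%E; apply: eq_bigr.
Qed.

Variables (k : nat) (c : 'I_k -> R).
Hypothesis c0 : forall i, 0 <= c i.
Hypothesis c1 : \sum_(i < k) c i = 1.
Variable P : probability (nat * measurableTypeR R)%type R.
Hypothesis PE : forall A, P A = (\sum_(i < k) (c i)%:E * U [set t | A (i : nat, t)])%E.

(** One periodic orbit per index. The weights sit in [P] and never change, so all laws in the class
    are convex combinations with the same coefficients. *)
Definition odometer (S : nat * measurableTypeR R -> X) :=
  exists (N : nat -> nat) (a : nat -> X) (pi : nat -> nat -> nat),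
    (forall i, [/\ (0 < N i)%N, iter (N i) T (a i) = a i & permn (N i) (pi i)]) /\
    S = fun w => orb (N w.1) (a w.1) (pi w.1) w.2.

Lemma odometer_measurable S : odometer S -> measurable_fun setT (S : _ -> borel X).
Proof.
move=> [N [a [pi [_ ->]]]] _ B mB; rewrite setTI.
rewrite (_ : _ @^-1` _ = \bigcup_i ([set i] `*` [set t | B (orb (N i) (a i) (pi i) t)])).
  by apply: bigcupT_measurable => i; apply: measurableX => //; exact: orb_measurable_pre.
apply/seteqP; split => [[i t] /= h|[i t] [j _ [/= -> ]]//].
by exists i.
Qed.

Lemma odometer_law S (m : Prob X R) : odometer S ->
  (forall B : set (borel X), measurable B -> m B = P (S @^-1` B)) -> FT T m.
Proof.
move=> [N [a [pi [h ->]]]] mE.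
have /choice[mu hmu] := fun i : 'I_k => law_exists U (orb_measurable (N i) (a i) (pi i)).
exists k, c, mu; split => //; split => //; split.
  move=> i; have [Ni ai pii] := h i; exists (N i), (a i); split => //; split => // A mA.
  exact: (etrans ((hmu i).1 A) (@orb_law (N i) (a i) (pi i) A Ni pii)).
move=> A mA; rewrite mE// PE; apply: eq_bigr => i _.
by rewrite (hmu i).1.
Qed.

Lemma odometer_extend S (u v : X) (e delta : R) : odometer S -> 0 < e -> 0 < delta ->
  exists S', [/\ odometer S',
    exists A, [/\ measurable A, (P A <= e%:E)%E &
      forall w, ~ A w -> nr (S' w - S w) <= e] &
    forall w, nr (S w - u) < delta ->
      exists N, nr (iter N T (S' w) - v) < 2 * delta].
Proof.
move=> [N [a [pi [h ->]]]] e0 d0.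
pose ep := Num.min e delta; have ep0 : 0 < ep by rewrite lt_min e0.
have /choice[b /choice[q hbq]] := fun i => periodic_perturbation cT pd (v - a i) hD ps ep0.
pose N' i := (N i * q i)%N; pose a' i := a i + b i.
pose pi' i := perm_ext (N i) (q i) (pi i).
have Nq i : iter (N' i) T (a' i) = a' i.
  have [_ aN _] := h i; have [_ bq _ _] := hbq i.
  rewrite iterD_lin; congr (_ + _); rewrite /N'; first rewrite mulnC.
    by rewrite -[(_ * _)%N]add0n (iter_periodic _ _ aN).
  by rewrite -[(_ * _)%N]add0n (iter_periodic _ _ bq).
have N'0 i : (0 < N' i)%N by have [? _ _] := h i; have [? _ _ _] := hbq i; rewrite muln_gt0; apply/andP.
have pi'P i : permn (N' i) (pi' i).
  by have [_ _ ?] := h i; have [? _ _ _] := hbq i; exact: permn_ext.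
exists (fun w => orb (N' w.1) (a' w.1) (pi' w.1) w.2); split.
- by exists N', a', pi'.
- pose I01 : set (measurableTypeR R) := `[0, 1[%classic.
  have mI : measurable I01 by exact: measurable_itv.
  (* The complement of the unit interval is null; adding it leaves only t >= 0, as [truncn_divn]
     requires. *)
  pose Y i := [set t | ep < nr (orb (N' i) (b i) (pi' i) t)] `|` ~` I01.
  have mY0 i : measurable [set t | ep < nr (orb (N' i) (b i) (pi' i) t)].
    exact: (orb_measurable_pre _ _ _ [set x | ep < nr x]).
  have mY i : measurable (Y i) by apply: measurableU => //; exact: measurableC.
  exists (\bigcup_i ([set i] `*` Y i)); split.
  + by apply: bigcupT_measurable => i; exact: measurableX.
  + rewrite PE; apply: (@le_trans _ _ (\sum_(i < k) (c i)%:E * e%:E)%E); last first.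
      by rewrite -ge0_sume_distrl ?sumEFin ?c1 ?mul1e// => i _; rewrite lee_fin.
    apply: lee_sum => i _; apply: lee_wpmul2l; first by rewrite lee_fin.
    have -> : [set t | (\bigcup_i ([set i] `*` Y i)) (i : nat, t)] = Y i.
      by apply/seteqP; split => [t [j _ [/= ->]]//|t Yt]; exists (i : nat).
    apply: le_trans (measureU2 U (mY0 i) (measurableC mI)) _.
    rewrite [X in (_ + X)%E](_ : _ = 0%E); last by apply: (etrans (UE _)); rewrite setICl measure0.
    rewrite adde0; suff : (U [set t | (ep < nr (orb (N' i) (b i) (pi' i) t))%R] <= e%:E)%E by [].
    have hc := uniform_cells UE (fun j => (ep < nr (iter (pi' i j) T (b i)))%R) (N'0 i).
    rewrite /= in hc; rewrite /orb hc lee_fin ler_pdivrMr ?ltr0n//.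
    have [p1 p2] := pi'P i.
    rewrite (sum_reindex (fun j => (ep < nr (iter j T (b i)))%R%:R) p1 p2).
    have [q0 bq _ hs] := hbq i.
    rewrite /N' mulnC (sum_periodic (f := fun j => (ep < nr (iter j T (b i)))%R%:R)); last first.
      by move=> n; rewrite -{1}(mul1n (q i)) (iter_periodic _ _ bq).
    rewrite mulnC natrM mulrCA ler_wpM2l//; apply: le_trans hs _.
    by rewrite ler_wpM2r// ge_min lexx.
  + move=> [i t] nA; have nY : ~ Y i t by move=> Yt; apply: nA; exists i.
    move: nY => /not_orP[/= /negP]; rewrite -leNgt => hb /contrapT.
    rewrite /I01 /= in_itv /= => /andP[t0 t1].
    have [q0 bq _ _] := hbq i; have [_ aN _] := h i.
    (* pi' j agrees modulo N with pi (j / q), so at every such t the a-part of the new orbit is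
       exactly where the old orbit was, and only the b-part remains. *)
    have -> : orb (N' i) (a' i) (pi' i) t - orb (N i) (a i) (pi i) t = orb (N' i) (b i) (pi' i) t.
      rewrite /orb /a' iterD_lin /pi' /perm_ext truncn_divn// mulnC.
      by rewrite (iter_periodic _ _ aN) addrAC subrr add0r.
    by apply: le_trans hb _; rewrite ge_min lexx.
- move=> [i t] _ /=; rewrite /orb; set p := pi' i _.
  (* The point is already p steps along the orbit. These further iterates complete p periods and
     return it to a' = a + b, which is within [ep] of v. *)
  exists (p * N' i - p)%N; rewrite -iterD subnK; last by rewrite leq_pmulr.
  rewrite -[(_ * _)%N]add0n (iter_periodic _ _ (Nq i)) /=.
  have [_ _ bv _] := hbq i.
  have -> : a' i - v = b i - (v - a i) by rewrite /a' opprB addrA (addrC (a i)).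
  have : ep <= delta by rewrite ge_min lexx orbT.
  lra.
Qed.

End part_a.

Lemma FT_closure (R : realType) (X : completeNormedModType R[i]) (T : {linear X -> X}) (D : nat -> X) :
  continuous T -> (forall x (e : R), 0 < e -> exists n, nr (D n - x) < e) ->
  perfectly_spanning T -> periodic_dense T ->
  FT T `<=` wclosure (wclosure (FT T) `&` @probs_on X R (HC T)).
Proof.
move=> cT hD ps pd m [k [c [mu [c0 [c1 [pmu mE]]]]]].
have [U UE] := uniform_exists R.
have /choice[Pi hPi] : forall i : nat, exists Pi : probability (nat * measurableTypeR R)%type R,
    forall A, Pi A = U [set t | A (i, t)].
  by move=> i; apply: (image_probability U (f := fun t => (i, t))); exact: measurable_fun_pair.
pose c' := ext_ord 0 c.
have [||P PE'] := @convex_combination _ _ _ k c' Pi.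
- by move=> i; rewrite /c' /ext_ord; case: insub.
- by rewrite -c1; apply: eq_bigr => i _; rewrite /c' ext_ordE.
have PE A : P A = (\sum_(i < k) (c i)%:E * U [set t | A (i : nat, t)])%E.
  by rewrite PE'; apply: eq_bigr => i _; rewrite /c' ext_ordE hPi.
have /choice[N /choice[a hNa]] := pmu.
(* Indices from k on carry no mass; they receive the fixed point 0 with period 1, as [odometer]
   wants a periodic orbit at every index. *)
pose N' := ext_ord 1%N N; pose a' := ext_ord 0 a.
pose S0 (w : nat * measurableTypeR R) := orb T (N' w.1) (a' w.1) id w.2.
have idp n : permn n id by [].
apply: (@scheme_closure _ _ _ cT _ hD _ _ _ _ P (odometer T) S0).
- exact: odometer_measurable.
- by move=> S u v e delta; exact: (odometer_extend cT hD ps pd UE c0 c1 PE).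
- by move=> S m'; exact: (odometer_law UE c0 c1 PE).
- exists N', a', (fun=> id); split => // i; rewrite /N' /a' /ext_ord.
  case: insubP => [j _ _|_]; first by have [? [? _]] := hNa j.
  by split => //=; rewrite linear0.
- move=> B mB; rewrite mE// PE; apply: eq_bigr => i _; congr (_ * _)%E.
  have [Ni [ai ->//]] := hNa i.
  apply: (etrans (esym (@orb_law _ _ T U UE (N i) (a i) id B Ni (idp _)))).
  by rewrite /S0 /N' /a' /preimage /= !ext_ordE.
Qed.

(* The bits of even, resp. odd, rank of a [2 q]-bit integer: splitting the binary digits of a
   uniform number in this way gives two independent uniform numbers. *)
Fixpoint evbits (q j : nat) : nat :=
  if q is q'.+1 then (2 * evbits q' (j %/ 4) + (j %/ 2) %% 2)%N else 0%N.

Fixpoint odbits (q j : nat) : nat :=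
  if q is q'.+1 then (2 * odbits q' (j %/ 4) + j %% 2)%N else 0%N.

(** * Independent uniform variables from binary digits *)

Section bits.
Context (R : realType).

Lemma sum_radix4 (F : nat -> R) n : \sum_(j < n * 4) F j =
  \sum_(j < n) (F (4 * j)%N + F (4 * j + 1)%N + F (4 * j + 2)%N + F (4 * j + 3)%N).
Proof.
elim: n => [|n IH]; first by rewrite mul0n !big_ord0.
rewrite [RHS]big_ord_recr /= -IH (_ : (n.+1 * 4)%N = (n * 4).+4); last by lia.
by rewrite !big_ord_recr /= !addrA (mulnC 4 n) addn1 addn2 addn3.
Qed.

Lemma sum_radix2 (F : nat -> R) n : \sum_(j < n * 2) F j =
  \sum_(j < n) (F (2 * j)%N + F (2 * j + 1)%N).
Proof.
elim: n => [|n IH]; first by rewrite mul0n !big_ord0.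
rewrite [RHS]big_ord_recr /= -IH (_ : (n.+1 * 2)%N = (n * 2).+2); last by lia.
by rewrite !big_ord_recr /= !addrA (mulnC 2 n) addn1.
Qed.

(** Summation form of the bijection j -> (evbits q j, odbits q j) from [0, 4^q) onto pairs of q-bit
    integers. The induction absorbs the last base-4 digit by passing to A (2 j) + A (2 j + 1), and
    likewise for B. *)
Lemma sum_bits q (A B : nat -> R) :
  \sum_(j < 4 ^ q) A (evbits q j) * B (odbits q j) =
  (\sum_(j < 2 ^ q) A j) * (\sum_(j < 2 ^ q) B j).
Proof.
elim: q A B => [|q IH] A B; first by rewrite !expn0 !big_ord1.
rewrite !expnSr (sum_radix4 (fun j => A (evbits q.+1 j) * B (odbits q.+1 j))).
rewrite (sum_radix2 A) (sum_radix2 B).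
rewrite -(IH (fun j => A (2 * j)%N + A (2 * j + 1)%N) (fun j => B (2 * j)%N + B (2 * j + 1)%N)).
apply: eq_bigr => j _ /=.
have d4 r : (r < 4)%N -> ((4 * j + r) %/ 4)%N = j by move=> ?; lia.
have -> : ((4 * j) %/ 4)%N = j by lia.
rewrite !d4//.
have -> : ((4 * j) %/ 2 %% 2)%N = 0%N by lia.
have -> : ((4 * j + 1) %/ 2 %% 2)%N = 0%N by lia.
have -> : ((4 * j + 2) %/ 2 %% 2)%N = 1%N by lia.
have -> : ((4 * j + 3) %/ 2 %% 2)%N = 1%N by lia.
have -> : (4 * j %% 2)%N = 0%N by lia.
have -> : ((4 * j + 1) %% 2)%N = 1%N by lia.
have -> : ((4 * j + 2) %% 2)%N = 0%N by lia.
have -> : ((4 * j + 3) %% 2)%N = 1%N by lia.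
by rewrite !addn0; ring.
Qed.

Variable U : probability (measurableTypeR R) R.
Hypothesis UE : forall A, U A = lebesgue_measure (A `&` `[0, 1[).
Let I01 : set (measurableTypeR R) := `[0, 1[%classic.

Let mI : measurable I01.
Proof. exact: measurable_itv. Qed.

Lemma uniformI A : U (A `&` I01) = U A.
Proof. by rewrite !UE -setIA setIid. Qed.

Lemma uniform_bits q (A B : pred nat) :
  U [set t | A (evbits q (Num.truncn ((4 ^ q)%:R * t))) &&
             B (odbits q (Num.truncn ((4 ^ q)%:R * t)))] =
  (U [set t | A (Num.truncn ((2 ^ q)%:R * t))] *
   U [set t | B (Num.truncn ((2 ^ q)%:R * t))])%E.
Proof.
have h := uniform_cells UE (fun j => A (evbits q j) && B (odbits q j)) (_ : 0 < 4 ^ q)%N.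
rewrite /= in h; rewrite h ?expn_gt0// !uniform_cells ?expn_gt0// -EFinM; congr EFin.
have -> : \sum_(j < 4 ^ q) (A (evbits q j) && B (odbits q j))%:R =
    \sum_(j < 4 ^ q) ((A (evbits q j))%:R * (B (odbits q j))%:R) :> R.
  by apply: eq_bigr => j _; rewrite -natrM mulnb.
rewrite (sum_bits q (fun j => (A j)%:R) (fun j => (B j)%:R)).
have -> : (4 ^ q)%:R = (2 ^ q)%:R * (2 ^ q)%:R :> R by rewrite -natrM -expnMn.
by field; rewrite pnatr_eq0 -lt0n expn_gt0.
Qed.

Definition bitsum (b : nat -> nat -> nat) (q : nat) (t : R) : R :=
  (b q (Num.truncn ((4 ^ q)%:R * t)))%:R / (2 ^ q)%:R.

Definition dyadic (q : nat) (t : R) : R := (Num.truncn ((2 ^ q)%:R * t))%:R / (2 ^ q)%:R.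

(** The common feature of [evbits] and [odbits]: a further base-4 digit of j appends one binary
    digit. It makes [bitsum] increase with q. *)
Definition isbits (b : nat -> nat -> nat) :=
  (forall q j, (2 * b q (j %/ 4) <= b q.+1 j <= 2 * b q (j %/ 4) + 1)%N) /\ forall j, b 0%N j = 0%N.

Lemma isbits_ev : isbits evbits.
Proof. by split => // q j /=; lia. Qed.

Lemma isbits_od : isbits odbits.
Proof. by split => // q j /=; lia. Qed.

Lemma bits_lt b q j : isbits b -> (b q j < 2 ^ q)%N.
Proof.
move=> [h h0]; elim: q j => [|q IH] j; first by rewrite h0.
have := h q j; have := IH (j %/ 4)%N; rewrite expnS; lia.
Qed.

Lemma bitsum_homo b q q' t : isbits b -> 0 <= t -> (q <= q')%N -> bitsum b q t <= bitsum b q' t.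
Proof.
move=> [h _] t0; elim: q' => [|q' IH]; first by rewrite leqn0 => /eqP ->.
rewrite leq_eqVlt ltnS => /predU1P[->//|/IH] {}IH; apply: le_trans IH _.
rewrite /bitsum ler_pdivrMr ?ltr0n ?expn_gt0// mulrAC ler_pdivlMr ?ltr0n ?expn_gt0//.
rewrite -!natrM ler_nat expnS mulnA leq_mul// mulnC.
have := h q' (Num.truncn ((4 ^ q'.+1)%:R * t)).
by rewrite [in (4 ^ q'.+1)%N]expnSr truncn_divn// => /andP[].
Qed.

Lemma bitsum_le1 b q t : isbits b -> bitsum b q t <= 1.
Proof.
move=> hb; rewrite /bitsum ler_pdivrMr ?ltr0n ?expn_gt0// mul1r ler_nat ltnW//.
exact: bits_lt.
Qed.

Definition bitlim b (t : R) : R := sup (range (fun q => bitsum b q t)).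

Lemma bitlim_gt b t a : isbits b -> (a < bitlim b t) <-> exists q, a < bitsum b q t.
Proof.
move=> hb; have hs : has_sup (range (fun q => bitsum b q t)).
  split; first by exists (bitsum b 0 t), 0%N.
  by exists 1 => _ [q _ <-]; exact: bitsum_le1.
split=> [h|[q]].
  by have [_ [q _ <-] aq] := sup_gt hs.1 h; exists q.
move=> /lt_le_trans; apply; apply: ub_le_sup; first exact: hs.2.
by exists q.
Qed.

Lemma measurable_bitsum_gt b q a : measurable [set t : measurableTypeR R | a < bitsum b q t].
Proof. exact: (measurable_truncn (4 ^ q)%:R (fun j => a < (b q j)%:R / (2 ^ q)%:R)). Qed.

Lemma measurable_dyadic_gt q a : measurable [set t : measurableTypeR R | a < dyadic q t].
Proof. exact: (measurable_truncn (2 ^ q)%:R (fun j => a < j%:R / (2 ^ q)%:R)). Qed.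

Lemma bitlim_measurable b : isbits b ->
  measurable_fun setT (bitlim b : measurableTypeR R -> measurableTypeR R).
Proof.
move=> hb; apply: (measurability _ (@RGenOInfty.measurableE R)).
move=> _ [_ [a ->] <-]; rewrite setTI.
rewrite (_ : _ @^-1` _ = \bigcup_q [set t : measurableTypeR R | a < bitsum b q t]).
  by apply: bigcupT_measurable => q; exact: measurable_bitsum_gt.
apply/seteqP; split => t /=; rewrite in_itv /= andbT.
  by move=> /(bitlim_gt _ _ hb)[q]; exists q.
by case=> q _ /= h; apply/bitlim_gt => //; exists q.
Qed.

Lemma dyadic_homo q q' t : 0 <= t -> (q <= q')%N -> dyadic q t <= dyadic q' t.
Proof.
move=> t0; elim: q' => [|q' IH]; first by rewrite leqn0 => /eqP ->.
rewrite leq_eqVlt ltnS => /predU1P[->//|/IH] {}IH; apply: le_trans IH _.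
rewrite /dyadic ler_pdivrMr ?ltr0n ?expn_gt0// mulrAC ler_pdivlMr ?ltr0n ?expn_gt0//.
rewrite -!natrM ler_nat [X in (_ * X <= _)%N]expnS mulnA leq_mul//.
by rewrite -(truncn_divn _ (isT : 0 < 2)%N t0) -expnSr leq_divM.
Qed.

Lemma dyadic_gt t a : 0 <= t -> a < t <-> exists q, a < dyadic q t.
Proof.
move=> t0.
have qt q : dyadic q t <= t < dyadic q t + (2 ^ q)%:R^-1.
  have p0 : (0 : R) < (2 ^ q)%:R by rewrite ltr0n expn_gt0.
  rewrite /dyadic -[X in _ + X]mul1r -mulrDl ler_pdivrMr// ltr_pdivlMr// mulrC natr1.
  by apply: truncn_itv; rewrite mulr_ge0// ltW.
split=> [at_|[q aq]]; last by have /andP[h _] := qt q; exact: lt_le_trans h.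
have ta : 0 < t - a by rewrite subr_gt0.
have [q hq] := exists_pow2_lt 1 ta; exists q.
by have /andP[_] := qt q; move: hq; rewrite div1r natrX; lra.
Qed.

Let cvgU (F : nat -> set (measurableTypeR R)) (G : set (measurableTypeR R)) :
  (forall q, measurable (F q)) ->
  (forall t q q', I01 t -> (q <= q')%N -> F q t -> F q' t) ->
  (forall t, I01 t -> G t <-> exists q, F q t) ->
  U (F q) @[q --> \oo] --> U G.
Proof.
move=> mF Fh FG; rewrite -uniformI.
have -> : G `&` I01 = \bigcup_q (F q `&` I01).
  apply/seteqP; split => t.
    by move=> [Gt It]; have [q Fq] := (FG t It).1 Gt; exists q.
  by move=> [q _ [Fq It]]; split => //; apply/(FG t It); exists q.
under eq_fun do rewrite -uniformI.
apply: (@nondecreasing_cvg_mu _ _ _ U (fun q => F q `&` I01)).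
- by move=> q; exact: measurableI.
- by apply: bigcupT_measurable => q; exact: measurableI.
- by move=> q q' qq'; apply/subsetPset => t [Fq It]; split => //; exact: Fh qq' Fq.
Qed.

(** The truncations increase to their limits, so a strict lower bound on a limit is attained at a
    finite depth. Both sides are thus limits along q of quantities that [uniform_bits] makes
    equal. *)
Lemma bits_halflines a b : U [set t | a < bitlim evbits t /\ b < bitlim odbits t] =
  (U `]a, +oo[%classic * U `]b, +oo[%classic)%E.
Proof.
have I0 t : I01 t -> 0 <= t by rewrite /I01 /= in_itv /= => /andP[].
have c1 : U [set t | a < bitsum evbits q t /\ b < bitsum odbits q t] @[q --> \oo] -->
    U [set t | a < bitlim evbits t /\ b < bitlim odbits t].
  apply: cvgU => [q|t q q' /I0 t0 qq' [h1 h2]|t /I0 t0].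
  - exact: measurableI (measurable_bitsum_gt _ _ _) (measurable_bitsum_gt _ _ _).
  - split; [apply: lt_le_trans h1 _|apply: lt_le_trans h2 _];
      apply: bitsum_homo => //; [exact: isbits_ev|exact: isbits_od].
  - split.
      move=> [/(bitlim_gt _ _ isbits_ev)[q hq] /(bitlim_gt _ _ isbits_od)[q' hq']].
      exists (maxn q q'); split; [apply: lt_le_trans hq _|apply: lt_le_trans hq' _];
        apply: bitsum_homo => //; [exact: isbits_ev|exact: leq_maxl|exact: isbits_od|exact: leq_maxr].
    move=> [q [h1 h2]]; split; apply/bitlim_gt; [exact: isbits_ev|by exists q|exact: isbits_od|by exists q].
have c2 c : U [set t | c < dyadic q t] @[q --> \oo] --> U `]c, +oo[%classic.
  apply: cvgU => [q|t q q' /I0 t0 qq' h|t /I0 t0].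
  - exact: measurable_dyadic_gt.
  - by apply: lt_le_trans h _; exact: dyadic_homo.
  - by rewrite /= in_itv /= andbT; exact: dyadic_gt.
have fU A : measurable A -> U A \is a fin_num by move=> mA; exact: fin_num_measure.
have c3 : (U [set t | (a < dyadic q t)%R] * U [set t | (b < dyadic q t)%R])%E @[q --> \oo] -->
    (U `]a, +oo[%classic * U `]b, +oo[%classic)%E.
  by apply: cvgeM => //; apply: mule_def_fin; apply: fU; exact: measurable_itv.
suff e : (fun q => U [set t | a < bitsum evbits q t /\ b < bitsum odbits q t]) =
    (fun q => (U [set t | (a < dyadic q t)%R] * U [set t | (b < dyadic q t)%R])%E).
  by rewrite e in c1; exact: (cvg_unique _ c1 c3).
apply/funext => q.
have := uniform_bits q (fun j => a < j%:R / (2 ^ q)%:R) (fun j => b < j%:R / (2 ^ q)%:R).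
rewrite /dyadic => <-; congr (U _).
by apply/seteqP; split => t /=; [case=> h1 h2; apply/andP|move=> /andP].
Qed.

Lemma halfline_unique (m1 m2 : {measure set (measurableTypeR R) -> \bar R}) :
  (forall a, m1 `]a, +oo[%classic = m2 `]a, +oo[%classic) ->
  (m1 setT < +oo)%E ->
  forall A, measurable A -> m1 A = m2 A.
Proof.
move=> h fin.
apply: (@measure_unique _ _ (measurableTypeR R) (@RGenOInfty.G R) (fun k => `]- k%:R, +oo[%classic)).
- exact: RGenOInfty.measurableE.
- move=> _ _ [a ->] [b ->]; exists (Num.max a b).
  by apply/seteqP; split => t /=; rewrite !in_itv /= !andbT gt_max; [move=> [-> ->]|move=> /andP].
- by move=> k; exists (- k%:R).
- apply/seteqP; split => // t _; exists (Num.truncn (- t)).+1 => //=.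
  by rewrite in_itv /= andbT ltrNl truncnS_gt.
- by move=> _ [a ->]; exact: h.
- by move=> k; apply: le_lt_trans fin; apply: le_measure; rewrite ?inE//; exact: measurable_itv.
Qed.

Lemma split_uniform : exists f g : measurableTypeR R -> measurableTypeR R,
  [/\ measurable_fun setT f, measurable_fun setT g & forall A B, measurable A -> measurable B ->
    U (f @^-1` A `&` g @^-1` B) = (U A * U B)%E].
Proof.
pose f : measurableTypeR R -> measurableTypeR R := bitlim evbits.
pose g : measurableTypeR R -> measurableTypeR R := bitlim odbits.
have mf : measurable_fun setT f := bitlim_measurable isbits_ev.
have mg : measurable_fun setT g := bitlim_measurable isbits_od.
have mfp A : measurable A -> measurable (f @^-1` A) by move=> mA; rewrite -[_ @^-1` _]setTI; exact: mf.
have mgp A : measurable A -> measurable (g @^-1` A) by move=> mA; rewrite -[_ @^-1` _]setTI; exact: mg.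
exists f, g; split => //.
have Ufin A : measurable A -> U A = (fine (U A))%:E.
  by move=> mA; rewrite fineK//; exact: fin_num_measure.
have Uge A : 0 <= fine (U A) by exact: fine_ge0.
have lt1 A : measurable A -> (U A < +oo)%E.
  by move=> mA; exact: (le_lt_trans (probability_le1 U mA) (ltry _)).
(* A finite measure is determined by half-lines. This is used twice: here in A, with a half-line for
   g, and then in B, with A fixed. *)
have hb b A : measurable A -> U (f @^-1` A `&` g @^-1` `]b, +oo[%classic) = (U A * U `]b, +oo[%classic)%E.
  have mb : measurable (g @^-1` `]b, +oo[%classic) by apply: mgp; exact: measurable_itv.
  move=> mA.
  pose m1 : {measure set (measurableTypeR R) -> \bar R} := pushforward (mrestr U mb) f.
  pose m2 : {measure set (measurableTypeR R) -> \bar R} := mscale (NngNum (Uge `]b, +oo[%classic)) U.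
  have m2E B : m2 B = (U B * U `]b, +oo[%classic)%E.
    transitivity ((fine (U `]b, +oo[%classic))%:E * U B)%E => //.
    by rewrite -Ufin; [exact: muleC|exact: measurable_itv].
  rewrite -m2E; apply: (@halfline_unique (m1 mf) m2) => //.
    move=> a; rewrite m2E -bits_halflines; congr (U _).
    by apply/seteqP; split => t /=; rewrite /f /g !in_itv /= !andbT.
  by rewrite /m1 /= /pushforward /mrestr preimage_setT setTI; exact: lt1.
move=> A B mA mB; have mA' := mfp _ mA.
pose m1 : {measure set (measurableTypeR R) -> \bar R} := pushforward (mrestr U mA') g.
pose m2 : {measure set (measurableTypeR R) -> \bar R} := mscale (NngNum (Uge A)) U.
have m2E C : m2 C = (U A * U C)%E.
  by transitivity ((fine (U A))%:E * U C)%E => //; rewrite -Ufin.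
rewrite -m2E setIC; apply: (@halfline_unique (m1 mg) m2) => //.
  by move=> a; rewrite m2E -hb// setIC.
by rewrite /m1 /= /pushforward /mrestr preimage_setT setTI; exact: lt1.
Qed.

(** The sequence is f, f o g, f o g o g, and so on. Since g is again uniform and independent of f,
    the first term is independent of the others, which are the same sequence evaluated at g. *)
Lemma iid_uniform : exists u : nat -> measurableTypeR R -> measurableTypeR R,
  (forall n, measurable_fun setT (u n)) /\
  forall n (A : nat -> set (measurableTypeR R)), (forall j, measurable (A j)) ->
    U [set t | forall j, (j < n)%N -> A j (u j t)] = (\prod_(j < n) U (A j))%E.
Proof.
have [f [g [mf mg fg]]] := split_uniform.
pose u := fix u n : measurableTypeR R -> measurableTypeR R := if n is n'.+1 then u n' \o g else f.
have mu n : measurable_fun setT (u n).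
  by elim: n => [//|n IH] /=; exact: measurableT_comp.
exists u; split => // n A mA; elim: n A mA => [|n IH] A mA.
  rewrite big_ord0 (_ : mkset _ = setT) ?probability_setT//.
  by apply/seteqP; split.
rewrite big_ord_recl -(IH (fun j => A j.+1))// -fg//; last first.
  rewrite (_ : mkset _ = \bigcap_(j in [set j | (j < n)%N]) (u j @^-1` A j.+1))//.
  by apply: bigcap_measurableType => j _; rewrite -[_ @^-1` _]setTI; exact: mu.
congr (U _); apply/seteqP; split => [t h|t [h1 h2] [|j]//=].
  by split; [exact: (h 0%N)|move=> j jn; exact: (h j.+1)].
by rewrite ltnS => /h2.
Qed.

End bits.

(** * Trigonometric integrals and second moments *)

Section trig_integral.
Context (R : realType).
Local Notation leb := (@lebesgue_measure R).

Lemma FTC_unit_interval (F f : R -> R) : (forall x : R, is_derive x 1 F (f x)) ->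
  continuous f -> F 0 = F 1 -> (\int[leb]_(x in `[0%R, 1%R]) (f x)%:E = 0)%E.
Proof.
move=> dF cf F01.
have cF : continuous F.
  move=> x; apply: differentiable_continuous; apply/derivable1_diffP.
  by have [] := dF x.
rewrite (@continuous_FTC2 _ f F)//.
- by rewrite -EFinB F01 subrr.
- exact: continuous_subspaceT.
- split.
  + by move=> x _; have [] := dF x.
  + by apply: cvg_at_right_filter; exact: cF.
  + by apply: cvg_at_left_filter; exact: cF.
- by move=> x _; rewrite derive1E; have [_ ->] := dF x.
Qed.

Lemma continuous_cos2pi : continuous (fun t : R => cos (2 * pi * t)).
Proof.
move=> t; apply: (@continuous_comp _ _ _ (fun t => 2 * pi * t) cos).
  exact: mulrl_continuous.
exact: continuous_cos.
Qed.

Lemma continuous_sin2pi : continuous (fun t : R => sin (2 * pi * t)).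
Proof.
move=> t; apply: (@continuous_comp _ _ _ (fun t => 2 * pi * t) sin).
  exact: mulrl_continuous.
exact: continuous_sin.
Qed.

Lemma integral_cos2pi : (\int[leb]_(x in `[0%R, 1%R]) (cos (2 * pi * x))%:E = 0)%E.
Proof.
have p0 : (2 * pi : R) != 0 by rewrite mulf_neq0// ?pnatr_eq0// gt_eqF// pi_gt0.
apply: (@FTC_unit_interval (fun x => (2 * pi)^-1 * sin (2 * pi * x))).
- move=> x; rewrite (_ : (fun _ => _) = (2 * pi)^-1 \*: (sin \o ((2 * pi : R) \*: id)))//.
  apply: is_derive_eq.
  change ((2 * pi)^-1 * (cos (2 * pi * x) * (2 * pi * 1)) = cos (2 * pi * x)).
  by rewrite mulr1 mulrCA mulVf// mulr1.
- exact: continuous_cos2pi.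
- by rewrite mulr0 sin0 mulr1 mulr_natl sin2pi.
Qed.

Lemma integral_sin2pi : (\int[leb]_(x in `[0%R, 1%R]) (sin (2 * pi * x))%:E = 0)%E.
Proof.
have p0 : (2 * pi : R) != 0 by rewrite mulf_neq0// ?pnatr_eq0// gt_eqF// pi_gt0.
apply: (@FTC_unit_interval (fun x => - (2 * pi)^-1 * cos (2 * pi * x))).
- move=> x; rewrite (_ : (fun _ => _) = (- (2 * pi)^-1) \*: (cos \o ((2 * pi : R) \*: id)))//.
  apply: is_derive_eq.
  change (- (2 * pi)^-1 * (- sin (2 * pi * x) * (2 * pi * 1)) = sin (2 * pi * x)).
  by rewrite mulr1 [- sin _ * _]mulNr mulrNN mulrCA mulVf// mulr1.
- exact: continuous_sin2pi.
- by rewrite mulr0 cos0 mulr1 mulr1 mulr_natl cos2pi mulr1.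
Qed.

Variable U : probability (measurableTypeR R) R.
Hypothesis UE : forall A, U A = leb (A `&` `[0, 1[).

Lemma integral_unit_uniform (f : R -> R) M : continuous f -> (forall x, `|f x| <= M) ->
  (\int[U]_x (f x)%:E = \int[leb]_(x in `[0%R, 1%R]) (f x)%:E)%E.
Proof.
move=> cf fM.
pose I01 : set (measurableTypeR R) := `[0, 1[%classic.
have mI : measurable I01 by exact: measurable_itv.
have mf : measurable_fun setT (f : measurableTypeR R -> R) by exact: continuous_measurable_fun.
rewrite (@negligible_integral _ _ _ U setT (~` I01))//.
- rewrite setTD setCK (eq_measure_integral leb).
    rewrite /I01 integral_itv_bndo_bndc//.
    by apply/measurable_EFinP; exact: measurable_funS mf.
  by move=> A mA AI; apply: (etrans (UE A)); rewrite setIidl.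
- exact: measurableC.
- exact: (@bounded_integrable _ _ _ U f M).
- by apply: (etrans (UE _)); rewrite setICl measure0.
Qed.

End trig_integral.

Section second_moment.
Context (R : realType) (U : probability (measurableTypeR R) R).
Context d (Om : measurableType d) (P : probability Om R).

(** Independence identifies the joint law of a and b with the product U x U, and Fubini produces the
    factor given by the integral of f, which is 0. *)
Lemma product_integral (a b : Om -> R) (f : R -> R) :
  measurable_fun setT a -> measurable_fun setT b ->
  (forall A B : set R, measurable A -> measurable B ->
    P (a @^-1` A `&` b @^-1` B) = (U A * U B)%E) ->
  continuous f -> (forall x, `|f x| <= 1) -> (\int[U]_x (f x)%:E = 0)%E ->
  (\int[P]_w (f (a w) * f (b w))%:E = 0)%E.
Proof.
move=> ma mb ab cf f1 f0.
have mf : measurable_fun setT (f : measurableTypeR R -> R) by exact: continuous_measurable_fun.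
pose phi w : measurableTypeR R * measurableTypeR R := (a w, b w).
have mphi : measurable_fun setT phi by exact: measurable_fun_pair.
pose F (z : measurableTypeR R * measurableTypeR R) : \bar R := (f z.1 * f z.2)%:E.
have mF : measurable_fun setT F.
  apply/measurable_EFinP; apply: measurable_funM.
    by apply: measurableT_comp => //; exact: measurable_fst.
  by apply: measurableT_comp => //; exact: measurable_snd.
have Fle z : `|f z.1 * f z.2| <= 1 by rewrite normrM mulr_ile1.
pose phim : {mfun Om >-> _} := HB.pack phi (isMeasurableFun.Build _ _ _ _ phi mphi).
have iF : P.-integrable setT (F \o phim).
  apply: (@bounded_integrable _ _ _ P (fun w => f (a w) * f (b w)) 1) => //.
    by apply: measurable_funM; exact: measurableT_comp.
  by move=> w; exact: (Fle (phi w)).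
transitivity (\int[distribution P phim]_z F z)%E; first by rewrite integral_distribution.
rewrite (eq_measure_integral (U \x U)%E); last first.
  by move=> A mA _; apply/esym/product_measure_unique => // B C mB mC; exact: ab.
have UU1 : (U \x U)%E (setT `*` setT) = 1%E.
  apply: (etrans (product_measure1E U U measurableT measurableT)).
  exact: etrans (congr2 mule (probability_setT U) (probability_setT U)) (mule1 _).
rewrite -integral12_prod_meas1; last first.
  apply: (@measurable_bounded_integrable _ _ _ (U \x U)%E
    (fun z : measurableTypeR R * measurableTypeR R => f z.1 * f z.2) setT) => //.
  - by rewrite -setXTT; apply: le_lt_trans (ltry 1); rewrite -UU1.
  - exact/measurable_EFinP.
  - exists 1; split; first exact: num_real.
    by move=> r r1 z _ /=; apply: le_trans (Fle z) (ltW r1).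
rewrite integral0_eq// => x _; rewrite /fubini_F /F /=.
under eq_integral do rewrite EFinM.
by rewrite integralZl ?f0 ?mule0//; exact: (@bounded_integrable _ _ _ U f 1).
Qed.

Lemma integral_sum_bounded (I : Type) (s : seq I) (h : I -> Om -> R) (r : I -> R) :
  (forall i, measurable_fun setT (h i)) -> (forall i, exists M, forall w, `|h i w| <= M) ->
  (forall i, \int[P]_w (h i w)%:E = (r i)%:E)%E ->
  (\int[P]_w (\sum_(i <- s) h i w)%:E = (\sum_(i <- s) r i)%:E)%E.
Proof.
move=> mh bh hr.
have ih i : P.-integrable setT (EFin \o h i).
  by have [M hM] := bh i; exact: bounded_integrable hM.
suff : P.-integrable setT (EFin \o (fun w => \sum_(i <- s) h i w)) /\
  (\int[P]_w (\sum_(i <- s) h i w)%:E = (\sum_(i <- s) r i)%:E)%E by case.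
elim: s => [|i s [IH1 IH2]].
  have -> : (fun w => \sum_(i <- [::]) h i w) = cst 0 by apply/funext => w; rewrite big_nil.
  split; first by apply: (@bounded_integrable _ _ _ P (cst 0) 0) => // w; rewrite normr0.
  by rewrite big_nil integral0_eq// => w _; rewrite big_nil.
have E : EFin \o (fun w => \sum_(i <- i :: s) h i w) =
    (EFin \o h i \+ (EFin \o (fun w => (\sum_(i <- s) h i w)%R)))%E.
  by apply/funext => w /=; rewrite big_cons EFinD.
split; first by rewrite E; exact: integrableD.
transitivity (\int[P]_w (EFin \o h i \+ (EFin \o (fun w => (\sum_(i <- s) h i w)%R))) w)%E.
  by apply: eq_integral => w _; rewrite /= big_cons EFinD.
by rewrite integralD_EFin// big_cons EFinD hr -IH2.
Qed.

Lemma markov_bound (h : Om -> R) (r a : R) : measurable_fun setT h ->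
  (forall w, 0 <= h w) -> 0 < a -> (\int[P]_w (h w)%:E = r%:E)%E ->
  (P [set w | (a <= h w)%R] <= (r / a)%:E)%E.
Proof.
move=> mh h0 a0 hr.
have mA : measurable [set w | a <= h w].
  rewrite (_ : mkset _ = ~` [set w | h w < a]); first exact/measurableC/measurable_lt.
  by apply/seteqP; split => w /=; rewrite leNgt => /negP.
rewrite mulrC EFinM -hr lee_pdivlMl//.
have <- : (\int[P]_w (a * \1_[set w | (a <= h w)%R] w)%:E = a%:E * P [set w | (a <= h w)%R])%E.
  under eq_integral do rewrite EFinM.
  by rewrite ge0_integralZl// ?integral_indic ?setIT// ?lee_fin ?ltW//; apply/measurable_EFinP; exact: measurable_indic.
apply: ge0_le_integral => //.
- by move=> w _; rewrite lee_fin mulr_ge0// ltW.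
- by apply/measurable_EFinP; apply: measurable_funM => //; exact: measurable_indic.
- exact/measurable_EFinP.
- move=> w _; rewrite lee_fin indicE; case: (boolP (w \in _)) => [/set_mem//|_].
    by rewrite mulr1.
  by rewrite mulr0.
Qed.

End second_moment.

(** [steinhaus_measure] speaks of the closed interval and [U] of the half-open one. *)
Lemma lebesgue_itv01 (R : realType) (A : set R) : measurable A ->
  lebesgue_measure (A `&` `[0, 1]) = lebesgue_measure (A `&` `[0, 1[).
Proof.
move=> mA; have mI : measurable (`[0, 1[%classic : set R) by exact: measurable_itv.
have mp : measurable ([set 1] : set R) by exact: measurable_set1.
have m1 : measurable (A `&` `[0, 1[) by exact: measurableI.
have m2 : measurable (A `&` [set 1]) by exact: measurableI.
have mI' : measurable (`[0, 1]%classic : set R) by exact: measurable_itv.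
apply/eqP; rewrite eq_le; apply/andP; split; last first.
  apply: le_measure; rewrite ?inE//; first exact: measurableI.
  by apply: setIS => x /=; rewrite !in_itv /= => /andP[-> /ltW].
have sub : A `&` `[0, 1] `<=` (A `&` `[0, 1[) `|` (A `&` [set 1]).
  move=> x [Ax]; rewrite /= !in_itv /= => /andP[x0]; rewrite le_eqVlt => /orP[/eqP x1|x1].
    by right; split.
  by left; rewrite x0 x1.
apply: (@le_trans _ _ (lebesgue_measure ((A `&` `[0, 1[) `|` (A `&` [set 1])))).
  by apply: le_measure; rewrite ?inE//; [exact: measurableI|exact: measurableU].
apply: (le_trans (@measureU2 _ _ _ (@lebesgue_measure R) _ _ m1 m2)).
rewrite [X in (_ + X)%E](_ : _ = 0%E) ?adde0//.
apply/eqP; rewrite eq_le measure_ge0 andbT -(lebesgue_measure_set1 (1 : R)).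
by apply: le_measure; rewrite ?inE//; exact: subIsetr.
Qed.

(** * Blocks of eigenvectors with controlled phases *)

Section picks.
Context (R : realType) (X : normedModType R[i]) (T : {linear X -> X}).
Local Notation e := (@expi2pi R).

Definition eigsys (x : nat -> X) (th : nat -> R) j := x j != 0 /\ T (x j) = e (th j) *: x j.

(** Each new phase avoids the countable exceptional set of all previous phases. A time N1 suited to
    the previous ones is then corrected by a time N2 that brings the new phase to its target and
    almost fixes the others. *)
Lemma picks_unimodular g (de : R) (n L : nat) (th : nat -> R) : good T g -> 0 < de ->
  exists (y : nat -> X) (th' : nat -> R), [/\ forall j, (j < n)%N -> th' j = th j,
    forall j, (n <= j < n + L)%N -> eigsys y th' j /\ nr (y j - g) < de &
    forall (eta : nat -> R) (ka : R), 0 < ka -> exists N : nat,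
      (forall j, (j < n)%N -> nearZ ka (N%:R * th j)) /\
      (forall j, (n <= j < n + L)%N -> nearZ ka (N%:R * th' j + eta j))].
Proof.
move=> gg de0; elim: L => [|L [y [th' [agr hy kr]]]].
  exists (fun=> 0), th; split => // [j|eta ka ka0]; first by lia.
  exists 0%N; split => [j _|j]; last by lia.
  by rewrite mul0r; exact: nearZ0.
have [z [t [z0 Tz zg nt]]] := pick_unimodular gg de0 (kronecker_countable (n + L) th').
exists (fun j => if j == (n + L)%N then z else y j), (fun j => if j == (n + L)%N then t else th' j).
split.
- by move=> j jn; rewrite ifF ?agr//; lia.
- move=> j /andP[nj]; rewrite addnS ltnS leq_eqVlt => /orP[/eqP ->|jL].
    by rewrite /eigsys eqxx.
  rewrite /eigsys /= (_ : (j == (n + L)%N) = false); last by lia.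
  by apply: (hy j); rewrite nj.
move=> eta ka ka0; have ka2 : 0 < ka / 2 by rewrite divr_gt0.
have [N1 [h1 h2]] := kr eta _ ka2.
have [N2 [h3 h4]] := (contrapT nt : forall be ka : R, 0 < ka -> exists N : nat,
  (forall j, (j < n + L)%N -> nearZ ka (N%:R * th' j)) /\
  nearZ ka (N%:R * t + be)) (N1%:R * t + eta (n + L)%N) _ ka2.
exists (N1 + N2)%N; split => [j jn|j /andP[nj]].
  rewrite natrD mulrDl [ka]splitr; apply: nearZD; first exact: h1.
  by rewrite -agr//; apply: h3; lia.
rewrite addnS ltnS leq_eqVlt => /orP[/eqP ->|jL].
  rewrite eqxx natrD mulrDl [N1%:R * t + _]addrC -addrA.
  by apply: nearZ_le h4; lra.
rewrite ifF; last by lia.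
rewrite natrD mulrDl addrAC [ka]splitr; apply: nearZD; first by apply: h2; rewrite nj.
by apply: h3.
Qed.

End picks.

Section part_b.
Context (R : realType) (X : completeNormedModType R[i]) (T : {linear X -> X}).
Local Notation e := (@expi2pi R).
Variable D : nat -> X.
Hypothesis hD : forall x (ep : R), 0 < ep -> exists n, nr (D n - x) < ep.
Hypothesis ps : perfectly_spanning T.
Context d (Om : measurableType d) (P : probability Om R) (om : nat -> Om -> R).
Hypothesis mom : forall j, measurable_fun setT (om j).

Hypothesis average_small : forall (n : nat) (c ep : R), 0 < c -> 0 < ep ->
  exists L A, [/\ (0 < L)%N, measurable A, (P A <= ep%:E)%E &
    forall w, ~ A w -> nc (\sum_(n <= j < n + L) e (om j w)) <= c * L%:R].

Definition block n n' (x : nat -> X) (ph : nat -> R) : X := \sum_(n <= j < n') e (ph j) *: x j.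

Lemma block_cat m n p x ph : (n <= m)%N -> (m <= p)%N ->
  block n p x ph = block n m x ph + block m p x ph.
Proof. exact: big_cat_nat. Qed.

Lemma eq_block n n' x x' ph ph' : (forall j, (n <= j < n')%N -> x j = x' j) ->
  (forall j, (n <= j < n')%N -> ph j = ph' j) -> block n n' x ph = block n n' x' ph'.
Proof. by move=> hx hp; apply: eq_big_nat => j jn; rewrite hx// hp. Qed.

Lemma block_perturb n n' x (ep : R) : 0 < ep -> exists2 ka : R, 0 < ka &
  forall ph ph' : nat -> R, (forall j, (n <= j < n')%N -> nearZ ka (ph' j - ph j)) ->
    nr (block n n' x ph' - block n n' x ph) <= ep.
Proof.
move=> ep0; pose M := \sum_(n <= j < n') nr (x j) + 1.
have M0 : 0 < M by rewrite ltr_wpDl// sumr_ge0// => j _; exact: nr_ge0.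
have [ka ka0 hka] := expi_near1 (divr_gt0 ep0 M0).
exists ka => // ph ph' h; rewrite /block -sumrB.
apply: (@le_trans _ _ (\sum_(n <= j < n') (ep / M) * nr (x j))); last first.
  by rewrite -mulr_sumr mulrAC ler_pdivrMr// ler_wpM2l ?(ltW ep0)// lerDl.
apply: le_trans (nr_sum _ _ _) _; rewrite big_nat [leRHS]big_nat.
apply: ler_sum => j jn; rewrite -scalerBl nrZ ler_wpM2r ?nr_ge0//.
have -> : e (ph' j) - e (ph j) = (e (ph' j - ph j) - 1) * e (ph j).
  by rewrite mulrBl mul1r -expiD subrK.
by rewrite ncM nc_expi mulr1 ltW//; apply: hka; exact: h.
Qed.

Definition extends n n' (x x' : nat -> X) (th th' : nat -> R) :=
  [/\ (n <= n')%N, forall j, (j < n)%N -> x' j = x j /\ th' j = th j &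
      forall j, (n <= j < n')%N -> eigsys T x' th' j].

Definition small_block n n' (x : nat -> X) (ep : R) := exists A : set Om,
  [/\ measurable A, (P A <= ep%:E)%E & forall w, ~ A w -> nr (block n n' x (om^~ w)) <= ep].

(** The starting phases eta are arbitrary because a hit is needed at every outcome, whatever the
    values of the random phases; of the old phases th only recurrence is asked. *)
Definition hitting_block n n' (x : nat -> X) (th : nat -> R) (g : X) (ep : R) :=
  forall (eta : nat -> R) (ka : R), 0 < ka -> exists N : nat,
    (forall j, (j < n)%N -> nearZ ka (N%:R * th j)) /\
    nr (block n n' x (fun j => N%:R * th j + eta j) - g) <= ep.

(* The new terms are eigenvectors close to [g] divided by their number [L]: with independent
   phases they average out, while the Kronecker property of the chosen eigenvalues brings
   all their phases close to 0 along times at which the old terms have almost returned. *)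
Lemma group_extend n x th g (ep : R) : good T g -> 0 < ep -> exists n' x' th',
  [/\ extends n n' x x' th th', small_block n n' x' ep & hitting_block n n' x' th' g ep].
Proof.
move=> gg ep0; pose G := nr g + 1.
have G0 : 0 < G by rewrite ltr_wpDl ?nr_ge0.
have ep2 : 0 < ep / 2 by rewrite divr_gt0.
have ep4 : 0 < ep / 4 by rewrite divr_gt0.
have [L [A [L0 mA PA hA]]] := average_small n (divr_gt0 ep2 G0) ep0.
have [y [th' [agr hy kr]]] := picks_unimodular n L th gg ep4.
have LR : (0 : R) < L%:R by rewrite ltr0n.
pose Li : R[i] := (L%:R^-1)%:C%C.
have nLi : nc Li = L%:R^-1 by rewrite nc_real// invr_ge0 ltW.
have Li0 : Li != 0.
  by apply/negP => /eqP h; move: nLi; rewrite h /nc normr0 => /esym/eqP; rewrite invr_eq0 gt_eqF.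
pose x' j := if (j < n)%N then x j else Li *: y j.
have bE ph : block n (n + L) x' ph = Li *: \sum_(n <= j < n + L) e (ph j) *: y j.
  rewrite /block scaler_sumr; apply: eq_big_nat => j /andP[nj _].
  by rewrite /x' ltnNge nj /= !scalerA mulrC.
exists (n + L)%N, x', th'; split.
- split; first exact: leq_addr.
    by move=> j jn; rewrite /x' jn agr.
  move=> j jn; have [[y0 Ty] _] := hy j jn; rewrite /eigsys /x' ltnNge.
  move: (jn) => /andP[-> _] /=; split; first by rewrite scaler_eq0 negb_or Li0.
  by rewrite linearZ /= Ty !scalerA mulrC.
- exists A; split => // w nA; rewrite bE.
  have -> : \sum_(n <= j < n + L) e (om j w) *: y j =
      (\sum_(n <= j < n + L) e (om j w)) *: g + \sum_(n <= j < n + L) e (om j w) *: (y j - g).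
    by rewrite scaler_suml -big_split /=; apply: eq_bigr => j _; rewrite -scalerDr addrC subrK.
  rewrite nrZ nLi ler_pdivrMl//; apply: le_trans (nrD _ _) _.
  have h1 : nr ((\sum_(n <= j < n + L) e (om j w)) *: g) <= ep / 2 * L%:R.
    rewrite nrZ; apply: (@le_trans _ _ (ep / 2 / G * L%:R * nr g)).
      by rewrite ler_wpM2r ?nr_ge0//; exact: hA.
    rewrite mulrAC ler_pM2r// mulrAC ler_pdivrMr// ler_wpM2l ?(ltW ep2)//.
    by rewrite lerDl.
  have h2 : nr (\sum_(n <= j < n + L) e (om j w) *: (y j - g)) <= ep / 4 * L%:R.
    apply: le_trans (nr_sum _ _ _) _.
    apply: (@le_trans _ _ (\sum_(n <= j < n + L) ep / 4)); last first.
      by rewrite sumr_const_nat addKn mulr_natr.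
    rewrite big_nat [leRHS]big_nat; apply: ler_sum => j jn.
    by rewrite nrZ nc_expi mul1r ltW//; case: (hy j jn).
  by move: h1 h2; nra.
move=> eta ka ka0.
have [ka1 ka10 hka1] := expi_near1 (divr_gt0 ep4 (ltr_wpDl (nr_ge0 g) (addr_gt0 ltr01 ep4))).
have kk : 0 < Num.min ka ka1 by rewrite lt_min ka0.
have [N [hN1 hN2]] := kr eta _ kk.
exists N; split.
  move=> j jn; rewrite agr//; apply: nearZ_le (hN1 _ jn).
  by rewrite ge_min lexx.
rewrite bE.
have -> : Li *: \sum_(n <= j < n + L) e (N%:R * th' j + eta j) *: y j - g =
    Li *: \sum_(n <= j < n + L) (e (N%:R * th' j + eta j) *: y j - g).
  rewrite sumrB scalerBr; congr (_ - _); rewrite sumr_const_nat addKn.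
  rewrite -[g *+ L]scaler_nat scalerA /Li -(rmorph_nat (real_complex R)) -rmorphM /= mulVf ?gt_eqF//.
  by rewrite scale1r.
rewrite nrZ nLi ler_pdivrMl//.
apply: le_trans (nr_sum _ _ _) _.
apply: (@le_trans _ _ (\sum_(n <= j < n + L) ep)); last first.
  by rewrite sumr_const_nat addKn mulr_natl.
rewrite big_nat [leRHS]big_nat; apply: ler_sum => j jn.
have [_ yg] := hy j jn.
have -> : e (N%:R * th' j + eta j) *: y j - g =
    (e (N%:R * th' j + eta j) - 1) *: y j + (y j - g).
  by rewrite scalerBl scale1r addrA subrK.
apply: le_trans (nrD _ _) _; rewrite nrZ.
have hy2 : nr (y j) <= nr g + (1 + ep / 4).
  have := nrD (y j - g) g; rewrite subrK; lra.
have he : nc (e (N%:R * th' j + eta j) - 1) <= ep / 4 / (nr g + (1 + ep / 4)).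
  by apply/ltW/hka1; apply: nearZ_le (hN2 _ jn); rewrite ge_min lexx orbT.
have K0 : 0 < nr g + (1 + ep / 4) by rewrite ltr_wpDl ?nr_ge0// addr_gt0.
have : nc (e (N%:R * th' j + eta j) - 1) * nr (y j) <= ep / 4.
  apply: (@le_trans _ _ (ep / 4 / (nr g + (1 + ep / 4)) * (nr g + (1 + ep / 4)))).
    by apply: ler_pM => //; [exact: nc_ge0|exact: nr_ge0].
  by rewrite divfK// gt_eqF.
lra.
Qed.

Lemma block_extend (s : seq X) n x th (ep : R) : (forall g, g \in s -> good T g) -> 0 < ep ->
  exists n' x' th', [/\ extends n n' x x' th th', small_block n n' x' ep &
    hitting_block n n' x' th' (\sum_(g <- s) g) ep].
Proof.
elim: s ep => [|g s IH] ep hs ep0.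
  exists n, x, th; split.
  - by split => // j; lia.
  - exists set0; split => //; first by rewrite measure0 lee_fin ltW.
    by move=> w _; rewrite /block big_geq// nr0 ltW.
  - move=> eta ka ka0; exists 0%N; split => [j _|].
      by rewrite mul0r; exact: nearZ0.
    by rewrite /block big_geq// big_nil subrr nr0 ltW.
have ep3 : 0 < ep / 3 by rewrite divr_gt0.
have [n1 [x1 [th1 [[nn1 ag1 eig1] [A1 [mA1 PA1 hA1]] hit1]]]] := IH _ (fun g' g's => hs g' (mem_behead (s := g :: s) g's)) ep3.
have [n2 [x2 [th2 [[nn2 ag2 eig2] [A2 [mA2 PA2 hA2]] hit2]]]] := group_extend n1 x1 th1 (hs g (mem_head _ _)) ep3.
have x12 j : (n <= j < n1)%N -> x2 j = x1 j by move=> /andP[_ /ag2[]].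
have th12 j : (j < n1)%N -> th2 j = th1 j by move=> /ag2[].
exists n2, x2, th2; split.
- split; first exact: leq_trans nn1 nn2.
    move=> j jn; have [h1 h2] := ag1 j jn; have [h3 h4] := ag2 j (leq_trans jn nn1).
    by rewrite h3 h4.
  move=> j /andP[nj jn2]; have [jn1|n1j] := ltnP j n1; last by apply: eig2; rewrite n1j.
  have [h1 h2] := ag2 j jn1; rewrite /eigsys h1 h2; apply: eig1; by rewrite nj.
- exists (A1 `|` A2); split; first exact: measurableU.
    apply: le_trans (measureU2 P mA1 mA2) _; apply: le_trans (leeD PA1 PA2) _.
    by rewrite -EFinD lee_fin; lra.
  move=> w /not_orP[nA1 nA2]; rewrite (block_cat _ _ nn1 nn2).
  rewrite (eq_block x12 (fun _ _ => erefl)); apply: le_trans (nrD _ _) _.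
  have := hA1 w nA1; have := hA2 w nA2; lra.
move=> eta ka ka0; have ka2 : 0 < ka / 2 by rewrite divr_gt0.
have [N1 [h1 h2]] := hit1 eta _ ka2.
have [ka' ka'0 hka'] := block_perturb n n1 x1 ep3.
have kk : 0 < Num.min (ka / 2) ka' by rewrite lt_min ka2.
(* During N1 the phases of the last group advance too, so N2 aims with starting phases advanced by
   N1 steps. Its tolerance ka' keeps the first block where N1 brought it. *)
have [N2 [h3 h4]] := hit2 (fun j => N1%:R * th2 j + eta j) _ kk.
exists (N2 + N1)%N; split.
  move=> j jn; have jn1 := leq_trans jn nn1.
  rewrite natrD mulrDl [ka]splitr; apply: nearZD.
    by apply: nearZ_le (h3 _ jn1); rewrite ge_min lexx.
  by rewrite th12//; exact: h1.
rewrite big_cons (block_cat _ _ nn1 nn2).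
rewrite (@eq_block n n1 x2 x1 _ (fun j => (N2 + N1)%:R * th1 j + eta j))//; last first.
  by move=> j /andP[_ jn1]; rewrite th12.
have h5 : nr (block n n1 x1 (fun j => (N2 + N1)%:R * th1 j + eta j) -
    block n n1 x1 (fun j => N1%:R * th1 j + eta j)) <= ep / 3.
  apply: hka' => j /andP[_ jn1].
  rewrite (_ : _ - _ = N2%:R * th2 j); last by rewrite th12// natrD; ring.
  by apply: nearZ_le (h3 _ jn1); rewrite ge_min lexx orbT.
have h6 : nr (block n1 n2 x2 (fun j => (N2 + N1)%:R * th2 j + eta j) - g) <= ep / 3.
  rewrite (@eq_block n1 n2 x2 x2 _ (fun j => N2%:R * th2 j + (N1%:R * th2 j + eta j)))//.
  by move=> j _; rewrite natrD mulrDl addrA.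
set b1 := block n n1 _ _ in h5 *; set b2 := block n1 n2 _ _ in h6 *.
set b0 := block n n1 _ _ in h2 h5; set S := \sum_(g <- s) g in h2 *.
have -> : b1 + b2 - (g + S) = (b1 - b0) + (b0 - S) + (b2 - g).
  have -> : b1 - b0 + (b0 - S) = b1 - S by rewrite addrA subrK.
  by rewrite [g + S]addrC opprD addrACA.
apply: le_trans (nrD _ _) _; apply: le_trans (lerD (nrD _ _) (lexx _)) _.
lra.
Qed.

Variable n0 : nat.

(** The first n0 phases are reserved for those of the given measure; joint laws are available for n0
    + k phases at a time, hence the bound n0 <= n. *)
Definition steinhaus_sum (S : Om -> X) := exists n x th, [/\ (n0 <= n)%N,
  forall j, (j < n)%N -> eigsys T x th j & S = fun w => block 0 n x (om^~ w)].

Lemma steinhaus_sum_measurable S : steinhaus_sum S -> measurable_fun setT (S : Om -> borel X).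
Proof.
move=> [n [x [th [_ _ ->]]]]; elim: n => [|n IH].
  rewrite (_ : (fun _ => _) = cst 0)//; last by apply/funext => w; rewrite /block big_geq.
rewrite (_ : (fun _ => _) = (fun w => block 0 n x (om^~ w) + e (om n w) *: x n)); last first.
  by apply/funext => w; rewrite /block big_nat_recr.
apply: (borel_measurableD hD) => //.
apply: (@measurability _ _ _ (borel X) setT _ (@open X) erefl) => _ [V oV <-].
rewrite (_ : _ @^-1` _ = om n @^-1` ((fun t => e t *: x n) @^-1` V))//.
apply: mom => //; apply: open_measurable.
by apply: open_comp => // t _; exact: expi_scale_continuous.
Qed.

Lemma iter_block N n x th ph : (forall j, (j < n)%N -> eigsys T x th j) ->
  iter N T (block 0 n x ph) = block 0 n x (fun j => N%:R * th j + ph j).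
Proof.
move=> h; rewrite /block iter_sum_lin; apply: eq_big_nat => j jn.
have [_ Tx] := h j jn; rewrite iterZ_lin (iter_eigen _ Tx) scalerA -expiX -expiD addrC.
by [].
Qed.

Lemma steinhaus_sum_extend S (u v : X) (ep delta : R) : steinhaus_sum S -> 0 < ep -> 0 < delta ->
  exists S', [/\ steinhaus_sum S',
    exists A, [/\ measurable A, (P A <= ep%:E)%E &
      forall w, ~ A w -> nr (S' w - S w) <= ep] &
    forall w, nr (S w - u) < delta ->
      exists N, nr (iter N T (S' w) - v) < 2 * delta].
Proof.
move=> [n [x [th [n0n eig ->]]]] ep0 d0.
have d4 : 0 < delta / 4 by rewrite divr_gt0.
(* Once the old sum has returned it contributes about u, so the new block must supply v - u. Three
   errors of delta / 4 join the delta of the assumption on w, below 2 delta in total. *)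
have [s [hs ws]] := good_span hD ps (v - u) d4.
have r0 : 0 < Num.min ep (delta / 4) by rewrite lt_min ep0.
have [n' [x' [th' [[nn' ag eig'] [A [mA PA hA]] hit]]]] := block_extend n x th hs r0.
have xx j : (0 <= j < n)%N -> x' j = x j by move=> /ag[].
have bS w : block 0 n x' (om^~ w) = block 0 n x (om^~ w) by apply: eq_block.
have eig2 j : (j < n')%N -> eigsys T x' th' j.
  move=> jn'; have [jn|nj] := ltnP j n; last by apply: eig'; rewrite nj.
  have [h1 h2] := ag j jn; rewrite /eigsys h1 h2; exact: eig.
exists (fun w => block 0 n' x' (om^~ w)); split.
- by exists n', x', th'; split => //; exact: leq_trans nn'.
- exists A; split => //; first by apply: le_trans PA _; rewrite lee_fin ge_min lexx.
  move=> w nA; rewrite (block_cat _ _ (leq0n n) nn') bS addrAC subrr add0r.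
  by apply: le_trans (hA w nA) _; rewrite ge_min lexx.
move=> w wu; have [ka ka0 hka] := block_perturb 0 n x d4.
have [N [h1 h2]] := hit (om^~ w) _ ka0.
exists N; rewrite (iter_block _ _ eig2) (block_cat _ _ (leq0n n) nn').
rewrite (@eq_block 0 n x' x _ (fun j => N%:R * th j + om j w))//; last first.
  by move=> j /ag[_ ->].
have h3 : nr (block 0 n x (fun j => N%:R * th j + om j w) - block 0 n x (om^~ w)) <= delta / 4.
  apply: hka => j jn; rewrite addrK; have [_ <-] := ag j jn; exact: h1.
have h4 : nr (block n n' x' (fun j => N%:R * th' j + om j w) - \sum_(g <- s) g) <= delta / 4.
  by apply: le_trans h2 _; rewrite ge_min lexx orbT.
set b1 := block 0 n _ _ in h3 *; set b2 := block n n' _ _ in h4 *.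
set b0 := block 0 n _ _ in h3 wu; set Z := \sum_(g <- s) g in ws h4.
have -> : b1 + b2 - v = (b1 - b0) + (b0 - u) + (b2 - Z) + (Z - (v - u)).
  have -> : b1 - b0 + (b0 - u) = b1 - u by rewrite addrA subrK.
  rewrite -[RHS]addrA; have -> : b2 - Z + (Z - (v - u)) = b2 - (v - u) by rewrite addrA subrK.
  by rewrite opprB addrACA addKr.
apply: le_lt_trans (nrD _ _) _; apply: le_lt_trans (lerD (nrD _ _) (lexx _)) _.
apply: le_lt_trans (lerD (lerD (nrD _ _) (lexx _)) (lexx _)) _.
by rewrite (nrBC Z); lra.
Qed.

End part_b.

(** * Averages of independent uniform phases *)

Section averages.
Context (R : realType) (U : probability (measurableTypeR R) R).
Local Notation e := (@expi2pi R).
Hypothesis UE : forall A, U A = lebesgue_measure (A `&` `[0, 1[).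
Context d (Om : measurableType d) (P : probability Om R) (om : nat -> Om -> R).
Hypothesis mom : forall j, measurable_fun setT (om j).
Hypothesis pair_indep : forall i j, i != j -> forall A B : set R, measurable A -> measurable B ->
  P (om i @^-1` A `&` om j @^-1` B) = (U A * U B)%E.

(** The real part of e (om i w) times the conjugate of e (om j w); the imaginary parts cancel in the
    double sum. *)
Let corr (i j : nat) (w : Om) : R := cos (2 * pi * om i w) * cos (2 * pi * om j w) +
  sin (2 * pi * om i w) * sin (2 * pi * om j w).

Let mcos j : measurable_fun setT (fun w => cos (2 * pi * om j w)).
Proof.
apply: (@measurableT_comp _ _ _ _ _ _ (fun t : R => cos (2 * pi * t))) => //.
by apply: continuous_measurable_fun; exact: continuous_cos2pi.
Qed.

Let msin j : measurable_fun setT (fun w => sin (2 * pi * om j w)).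
Proof.
apply: (@measurableT_comp _ _ _ _ _ _ (fun t : R => sin (2 * pi * t))) => //.
by apply: continuous_measurable_fun; exact: continuous_sin2pi.
Qed.

Let cos1 (t : R) : `|cos t| <= 1. Proof. by rewrite ler_norml cos_geN1 cos_le1. Qed.
Let sin1 (t : R) : `|sin t| <= 1. Proof. by rewrite ler_norml sin_geN1 sin_le1. Qed.

Lemma integral_corr i j : (\int[P]_w (corr i j w)%:E = (i == j)%:R%:E)%E.
Proof.
have [->|ij] := eqVneq i j.
  rewrite (eq_integral (cst 1%E)); first by apply: (etrans (integral_cst P measurableT 1%E)); rewrite mul1e; exact: probability_setT.
  by move=> w _; rewrite /corr -!expr2 cos2Dsin2.
pose h (b : bool) w : R := if b then cos (2 * pi * om i w) * cos (2 * pi * om j w)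
  else sin (2 * pi * om i w) * sin (2 * pi * om j w).
have -> : (\int[P]_w (corr i j w)%:E = \int[P]_w (\sum_(b <- [:: true; false]) h b w)%:E)%E.
  by apply: eq_integral => w _; rewrite !big_cons big_nil addr0.
rewrite (integral_sum_bounded _ (r := fun=> 0)) ?big1//.
- by case; apply: measurable_funM.
- by case; exists 1 => w; rewrite normrM mulr_ile1.
- case; apply: (product_integral (f := fun t => _ (2 * pi * t)) (mom i) (mom j) (pair_indep ij)).
  + exact: continuous_cos2pi.
  + by move=> t; exact: cos1.
  + rewrite (integral_unit_uniform UE (@continuous_cos2pi R) (fun t => cos1 _)).
    exact: integral_cos2pi.
  + exact: continuous_sin2pi.
  + by move=> t; exact: sin1.
  + rewrite (integral_unit_uniform UE (@continuous_sin2pi R) (fun t => sin1 _)).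
    exact: integral_sin2pi.
Qed.

Lemma sqr_sum_expi (s : seq nat) w :
  nc (\sum_(j <- s) e (om j w)) ^+ 2 = \sum_(i <- s) \sum_(j <- s) corr i j w.
Proof.
have -> : \sum_(j <- s) e (om j w) =
    Complex (\sum_(j <- s) cos (2 * pi * om j w)) (\sum_(j <- s) sin (2 * pi * om j w)).
  by elim: s => [|j s IH]; rewrite ?big_nil// !big_cons IH.
rewrite nc_sqr /= !expr2 !mulr_suml -big_split /=; apply: eq_bigr => i _.
by rewrite !mulr_sumr -big_split.
Qed.

Lemma average_small (n : nat) (c ep : R) : 0 < c -> 0 < ep ->
  exists L A, [/\ (0 < L)%N, measurable A, (P A <= ep%:E)%E &
    forall w, ~ A w -> nc (\sum_(n <= j < n + L) e (om j w)) <= c * L%:R].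
Proof.
(* The squared sum has mean L, so by Markov it reaches (c L)^2 with probability at most 1/(c^2 L),
   which is below [ep] for this L. *)
move=> c0 ep0; pose L := (Num.truncn (c ^+ 2 * ep)^-1).+1.
have ce : 0 < c ^+ 2 * ep by rewrite mulr_gt0// exprn_gt0.
have hL : (c ^+ 2 * ep)^-1 < L%:R by exact: truncnS_gt.
have LR : (0 : R) < L%:R by rewrite ltr0n.
pose s := index_iota n (n + L).
pose h w := nc (\sum_(j <- s) e (om j w)) ^+ 2.
have mcorr i j : measurable_fun setT (corr i j).
  by apply: measurable_funD; apply: measurable_funM.
have bcorr i j w : `|corr i j w| <= 2.
  apply: le_trans (ler_normD _ _) _; rewrite !normrM.
  by rewrite (_ : 2 = 1 + 1)// lerD// mulr_ile1.
have hE : h = fun w => \sum_(i <- s) \sum_(j <- s) corr i j w.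
  by apply/funext => w; exact: sqr_sum_expi.
have mh : measurable_fun setT h.
  by rewrite hE; apply: measurable_sum => i; apply: measurable_sum.
have ih : (\int[P]_w (h w)%:E = L%:R%:E)%E.
  rewrite hE (integral_sum_bounded _ (r := fun i => \sum_(j <- s) (i == j)%:R)).
  - congr EFin; rewrite (eq_big_seq (fun=> 1)).
      by rewrite big_const_seq count_predT iter_addr_0 size_iota addKn.
    move=> i si; rewrite (bigD1_seq i) ?iota_uniq//= eqxx big1 ?addr0// => j.
    by rewrite eq_sym => /negPf ->.
  - by move=> i; exact: measurable_sum.
  - move=> i; exists (\sum_(j <- s) 2) => w; apply: le_trans (ler_norm_sum _ _ _) _.
    exact: ler_sum.
  - move=> i; apply: integral_sum_bounded => // j; last exact: integral_corr.
    by exists 2.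
have cL : 0 < (c * L%:R) ^+ 2 by rewrite exprn_gt0// mulr_gt0.
exists L, [set w | (c * L%:R) ^+ 2 <= h w]; split => //.
- rewrite (_ : mkset _ = ~` [set w | h w < (c * L%:R) ^+ 2]).
    by apply: measurableC; exact: measurable_lt.
  by apply/seteqP; split => w /=; rewrite leNgt => /negP.
- apply: le_trans (markov_bound mh _ cL ih) _; first by move=> w; exact: sqr_ge0.
  rewrite lee_fin ler_pdivrMr//; move: hL; rewrite -[X in X < _]mul1r ltr_pdivrMr//.
  by rewrite exprMn; nra.
- move=> w /= /negP; rewrite -ltNge => hw; apply: ltW.
  by rewrite -(ltr_pXn2r (ltn0Sn 1)) ?nnegrE ?nc_ge0// mulr_ge0// ltW.
Qed.

End averages.

Section boxes.
Context (R : realType) (U : probability (measurableTypeR R) R).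
Context d (Om : measurableType d) (P : probability Om R) (om : nat -> Om -> R) (n0 : nat).
Hypothesis box : forall k (A : nat -> set R), (forall j, measurable (A j)) ->
  P [set w | forall j, (j < n0 + k)%N -> A j (om j w)] = (\prod_(j < n0 + k) U (A j))%E.

(** The remaining coordinates are left free by [setT], in a box of the form n0 + k large enough to
    contain i and j. *)
Lemma box_pair i j : i != j -> forall A B : set R, measurable A -> measurable B ->
  P (om i @^-1` A `&` om j @^-1` B) = (U A * U B)%E.
Proof.
move=> ij A B mA mB; pose C k := if k == i then A else if k == j then B else setT.
have mC k : measurable (C k) by rewrite /C; case: ifP => // _; case: ifP.
pose m := (n0 + (i + j).+1)%N.
have im : (i < m)%N by rewrite /m; lia.
have jm : (j < m)%N by rewrite /m; lia.
have -> : om i @^-1` A `&` om j @^-1` B = [set w | forall k, (k < m)%N -> C k (om k w)].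
  apply/seteqP; split => w /=.
    move=> [Ai Bj] k _; rewrite /C; case: ifPn => [/eqP ->//|_].
    by case: ifPn => [/eqP ->//|_].
  move=> h; have := h _ im; have := h _ jm; rewrite /C !eqxx.
  by rewrite eq_sym (negPf ij).
rewrite box// (bigD1 (Ordinal im))//= (bigD1 (Ordinal jm))/=; last by rewrite -val_eqE /= eq_sym.
rewrite big1 ?mule1; last first.
  move=> k /andP[]; rewrite -!val_eqE /= => /negPf ki /negPf kj.
  by rewrite /C ki kj probability_setT.
by rewrite /C !eqxx eq_sym (negPf ij).
Qed.

Lemma box_single i (A : set R) : measurable A -> P (om i @^-1` A) = U A.
Proof.
move=> mA; have ij : i != i.+1 by lia.
have := box_pair ij mA (measurableT : measurable (setT : set R)).
by rewrite preimage_setT setIT probability_setT mule1.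
Qed.

End boxes.

(** * Density for Steinhaus measures *)

Lemma steinhaus_sum_law (R : realType) (X : completeNormedModType R[i]) (T : {linear X -> X})
    (U : probability (measurableTypeR R) R) d (Om : measurableType d) (P : probability Om R)
    (om : nat -> Om -> R) n0 S (m : Prob X R) :
  (forall A, U A = lebesgue_measure (A `&` `[0, 1[)) ->
  (forall j, measurable_fun setT (om j)) ->
  (forall k (A : nat -> set R), (forall j, measurable (A j)) ->
    P [set w | forall j, (j < n0 + k)%N -> A j (om j w)] = (\prod_(j < n0 + k) U (A j))%E) ->
  steinhaus_sum T om n0 S ->
  (forall B : set (borel X), measurable B -> m B = P (S @^-1` B)) -> ST T m.
Proof.
move=> UE mom box [n [x [th [n0n eig ->]]]] mE.
exists n, (fun j : 'I_n => x j); split.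
  move=> j; have [xj Tx] := eig j (ltn_ord j); split => //.
  by exists (expi2pi (th j)); split => //; apply/nc1P; exact: nc_expi.
have single := box_single box.
exists d, Om, P, (fun j : 'I_n => om j); split => //; split; last split.
- by move=> j A mA; rewrite lebesgue_itv01//; apply: (etrans (single _ _ mA)); exact: UE.
- move=> A mA; pose A' := ext_ord setT A.
  have mA' j : measurable (A' j) by rewrite /A' /ext_ord; case: insub.
  have -> : \bigcap_(j in [set: 'I_n]) (om j @^-1` A j) =
      [set w | forall j, (j < n0 + (n - n0))%N -> A' j (om j w)].
    rewrite subnKC//; apply/seteqP; split => w h.
      move=> j jn; have := h (Ordinal jn) I.
      by rewrite /A' -[j]/(nat_of_ord (Ordinal jn)) ext_ordE.
    by move=> j _; have := h j (ltn_ord j); rewrite /A' ext_ordE.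
  rewrite box// subnKC//; apply: eq_bigr => j _.
  by rewrite /A' ext_ordE; apply/esym; exact: single.
- move=> B mB; rewrite mE//; congr (P _).
  by apply/seteqP; split => w /=; rewrite /block big_mkord.
Qed.

(** The space carrying the given phases may have no further randomness, so it is multiplied by the
    unit interval: the first n phases live on the old factor, all later ones are i.i.d. uniform on
    the new one. *)
Lemma ST_closure (R : realType) (X : completeNormedModType R[i]) (T : {linear X -> X}) (D : nat -> X) :
  continuous T -> (forall x (e : R), 0 < e -> exists n, nr (D n - x) < e) ->
  perfectly_spanning T ->
  ST T `<=` wclosure (wclosure (ST T) `&` @probs_on X R (HC T)).
Proof.
move=> cT hD ps m [n [x [eigx [d [Om [P [th [mth [uth [ith mE]]]]]]]]]].
have [U UE] := uniform_exists R.
have [u [mu iu]] := iid_uniform UE.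
have QT : (P \x U)%E setT = 1%E.
  rewrite -setXTT; apply: (etrans (product_measure1E P U measurableT measurableT)).
  exact: etrans (congr2 mule (probability_setT P) (probability_setT U)) (mule1 _).
have [Q QE] := measure_probability QT.
have QX A B : measurable A -> measurable B -> Q (A `*` B) = (P A * U B)%E.
  by move=> mA mB; apply: (etrans (QE _)); exact: product_measure1E.
pose om j (w : Om * measurableTypeR R) : R :=
  if insub j is Some i then th i w.1 else u (j - n)%N w.2.
have mom j : measurable_fun setT (om j).
  rewrite /om; case: insub => [i|].
    by apply: (measurableT_comp (mth i)); exact: measurable_fst.
  by apply: (measurableT_comp (mu (j - n)%N)); exact: measurable_snd.
have omlt (i : 'I_n) w : om i w = th i w.1 by rewrite /om valK.
have omge j w : om (n + j)%N w = u j w.2.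
  by rewrite /om insubF ?addKn// ltnNge leq_addr.
have uthU j A : measurable A -> P (th j @^-1` A) = U A.
  by move=> mA; rewrite uth// lebesgue_itv01//; apply/esym; exact: UE.
have box k (A : nat -> set R) : (forall j, measurable (A j)) ->
    Q [set w | forall j, (j < n + k)%N -> A j (om j w)] = (\prod_(j < n + k) U (A j))%E.
  move=> mA.
  have -> : [set w | forall j, (j < n + k)%N -> A j (om j w)] =
      (\bigcap_(j in [set: 'I_n]) (th j @^-1` A j)) `*`
      [set t | forall j, (j < k)%N -> A (n + j)%N (u j t)].
    apply/seteqP; split => w h.
      split => [i _|j jk].
        by rewrite /= -omlt; apply: h; rewrite ltn_addr.
      by rewrite -omge; apply: h; rewrite ltn_add2l.
    case: h => h1 h2 j jnk; have [jn|nj] := ltnP j n.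
      by have := h1 (Ordinal jn) I; rewrite /= -omlt.
    rewrite -(subnKC nj) omge; apply: h2; lia.
  rewrite QX; last first.
  - rewrite (_ : mkset _ = \bigcap_(j in [set j | (j < k)%N]) (u j @^-1` A (n + j)%N))//.
    apply: bigcap_measurableType => j _.
    by have := mu j measurableT _ (mA (n + j)%N); rewrite setTI.
  - apply: fin_bigcap_measurable => // j _.
    by rewrite -[_ @^-1` _]setTI; exact: mth.
  rewrite ith// (iu k (fun j => A (n + j)%N) (fun j => mA _)) big_split_ord /=; congr (_ * _)%E.
  by apply: eq_bigr => j _; exact: uthU.
have /choice[l hl] : forall j, exists t, x j != 0 /\ T (x j) = expi2pi t *: x j.
  move=> j; have [x0 [l [l1 Tx]]] := eigx j.
  by have [t lt] := expi_surj ((nc1P l).1 l1); exists t; rewrite -lt.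
pose x' := ext_ord 0 x; pose th' := ext_ord 0 l.
have sumE w : block 0 n x' (om^~ w) = \sum_(j < n) expi2pi (th j w.1) *: x j.
  by rewrite /block big_mkord; apply: eq_bigr => j _; rewrite omlt /x' ext_ordE.
have avg := average_small UE mom (fun i j ij => @box_pair _ _ _ _ _ _ _ box i j ij).
apply: (@scheme_closure _ _ _ cT _ hD _ _ _ _ Q (steinhaus_sum T om n)
  (fun w => block 0 n x' (om^~ w))).
- by move=> S; exact: (steinhaus_sum_measurable hD mom).
- by move=> S v v' e delta; exact: (steinhaus_sum_extend hD ps avg).
- by move=> S m'; apply: steinhaus_sum_law UE mom box.
- exists n, x', th'; split => // j jn; rewrite /eigsys /x' /th'.
  by rewrite -[j]/(nat_of_ord (Ordinal jn)) !ext_ordE; exact: hl.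
- move=> B mB; rewrite mE//.
  have -> : (fun w => block 0 n x' (om^~ w)) @^-1` B =
      [set w | B (\sum_(j < n) expi2pi (th j w) *: x j)] `*` setT.
    by apply/seteqP; split => w /=; rewrite sumE// => -[].
  rewrite QX//; first by rewrite probability_setT mule1.
  (* The product formula [QX] needs the event on the old factor to be measurable; [om'] gives the
     same phases there, padded with 0, so that [steinhaus_sum_measurable] applies. *)
  pose om' j (w : Om) : R := if insub j is Some i then th i w else 0.
  have mS : measurable_fun setT ((fun w => block 0 n x' (om'^~ w)) : Om -> borel X).
    apply: (@steinhaus_sum_measurable _ _ T D hD _ _ om' _ 0) => [j|].
      by rewrite /om'; case: insub => [i|]; [exact: mth|exact: measurable_cst].
    exists n, x', th'; split => // j jn; rewrite /eigsys /x' /th'.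
    by rewrite -[j]/(nat_of_ord (Ordinal jn)) !ext_ordE; exact: hl.
  rewrite (_ : mkset _ = (fun w => block 0 n x' (om'^~ w)) @^-1` B).
    by rewrite -[_ @^-1` _]setTI; exact: mS.
  suff E w : block 0 n x' (om'^~ w) = \sum_(j < n) expi2pi (th j w) *: x j.
    by apply/seteqP; split => w /=; rewrite E.
  by rewrite /block big_mkord; apply: eq_bigr => j _; rewrite /om' valK /x' ext_ordE.
Qed.

Theorem theorem1p6 (R : realType) (X : completeNormedModType R[i])
  (T : {linear X -> X}) :
  continuous T -> separable_space X ->
  ((perfectly_spanning T -> periodic_dense T ->
      dense_Gdelta_in (FTbar_on T (HC T)) (FTbar T)) /\
   (perfectly_spanning T ->
      dense_Gdelta_in (STbar_on T (HC T)) (STbar T))).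
Proof.
move=> cT /separable_dense_seq[D hD]; split=> [ps pd|ps].
  by apply: (dense_Gdelta_scheme cT hD); exact: FT_closure hD ps pd.
by apply: (dense_Gdelta_scheme cT hD); exact: ST_closure hD ps.
Qed.
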